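(* Let $(M,H,\mathcal E(1,0))$ be a CR manifold with Fefferman space $\tilde M$, $\mathbb W$ a representation of $\tilde G$, and $\tilde{\mathcal W}\to\tilde M$ and $\mathcal W\to M$ the corresponding tractor bundles. Let $\mathbf k=\tilde\Pi(\mathbb J)\in\mathfrak X(\tilde M)$. Then: (1) A section $\varphi\in\Gamma(\tilde{\mathcal W})$ lies in $\Gamma(\mathcal W)$ if and only if $\nabla^{\tilde{\mathcal W}}_{\mathbf k}\varphi=0$. (2) The restriction of $\nabla^{\tilde{\mathcal W}}$ to $\Gamma(\mathcal W)\subset\Gamma(\tilde{\mathcal W})$ descends to a linear connection on the bundle $\mathcal W\to M$, which coincides with the normal tractor connection $\nabla^{\mathcal W}$.
   Context: CR manifold: $M$ is a smooth manifold of dimension $2n+1$ with a complex rank $n$ subbundle $H\subset TM$ such that $H^{1,0}\subset T_{\mathbb C}M$ is involutive; non-degenerate (the map $H\times H\to Q:=TM/H$ induced by the Lie bracket is non-degenerate), $Q$ oriented, Levi form of signature $(p,q)$, $p+q=n$. $\mathcal K$ is the $(n+1)$st complex exterior power of the annihilator of $H^{0,1}$ in $T^*_{\mathbb C}M$, and a complex line bundle $\mathcal E(1,0)$ with a duality between $\mathcal E(1,0)^{\otimes(n+2)}$ and $\mathcal K$ is fixed; $\mathcal E(-1,0)=\mathcal E(1,0)^*$. The Fefferman space $\tilde M\to M$ is the circle bundle of real lines in $\mathcal E(-1,0)$. Groups: $\mathbb V$ is complex of dimension $n+2$ with Hermitian form $\langle\ ,\ \rangle$ of signature $(p+1,q+1)$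 with real part $\langle\ ,\ \rangle_{\mathbb R}$; $\mathbb V^1$ a null complex line, $\mathbb V^1_{\mathbb R}\subset\mathbb V^1$ a real line; $G=SU(\mathbb V)\supset P=\operatorname{Stab}(\mathbb V^1)$; $\tilde G=SO_0(\mathbb V,\langle\ ,\ \rangle_{\mathbb R})\supset\tilde P=\operatorname{Stab}(\mathbb V^1_{\mathbb R})$; Lie algebras $\mathfrak g,\mathfrak p,\tilde{\mathfrak g},\tilde{\mathfrak p}$. $(\mathcal G\to M,\omega)$ is the regular normal Cartan geometry of type $(G,P)$ determined by $(M,H,\mathcal E(1,0))$, with $\mathcal E(-1,0)=\mathcal G\times_P\mathbb V^1$; one has $\tilde M=\mathcal G/(G\cap\tilde P)$. $\tilde{\mathcal G}=\mathcal G\times_{G\cap\tilde P}\tilde P$ with $\tilde\omega$ the unique Cartan connection extending $\omega$; this is the normal Cartan geometry of the conformal structure of $\tilde M$. Tractor bundles: for a representation $\mathbb W$ of $\tilde G$, $\tilde{\mathcal W}=\tilde{\mathcal G}\times_{\tilde P}\mathbb W\cong\mathcal G\times_{G\cap\tilde P}\mathbb W\to\tilde M$ and $\mathcal W=\mathcal G\times_P\mathbb W\to M$. The normal tractor connections $\nabla^{\tilde{\mathcal W}}$, $\nabla^{\mathcal W}$ are induced by $\tilde\omega$ and $\omega$: if a section corresponds to an equivariant function $f$ and $\bar\xi$ is a lift of a vector field $\xi$, then the derivative along $\xi$ corresponds to $\bar\xi\cdot f+\omega(\bar\xi)(f)$ (respectively with $\tilde\omega$). $\Gamma(\mathcal W)$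 ($P$-equivariant functions $\mathcal G\to\mathbb W$) is regarded as a subspace of $\Gamma(\tilde{\mathcal W})$ ($(G\cap\tilde P)$-equivariant functions $\mathcal G\to\mathbb W$). $\tilde{\mathcal A}=\tilde{\mathcal G}\times_{\tilde P}\tilde{\mathfrak g}$ is the adjoint tractor bundle, $\tilde\Pi:\tilde{\mathcal A}\to T\tilde M=\tilde{\mathcal G}\times_{\tilde P}(\tilde{\mathfrak g}/\tilde{\mathfrak p})$ the natural projection, and $\mathbb J\in\Gamma(\tilde{\mathcal A})$ the section corresponding to the constant function $\mathcal G\to\tilde{\mathfrak g}$ given by multiplication by $i$ on $\mathbb V$. The vector field $\mathbf k=\tilde\Pi(\mathbb J)$ spans the vertical bundle of $\tilde M\to M$. ''Descends'' in (2) means: for $\varphi\in\Gamma(\mathcal W)$ and a lift $\tilde\xi$ to $\tilde M$ of $\xi\in\mathfrak X(M)$, $\nabla^{\tilde{\mathcal W}}_{\tilde\xi}\varphi$ lies in $\Gamma(\mathcal W)$ and depends only on $\xi$ and $\varphi$. *)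

(* Defs.v *)
From HB Require Import structures.
From mathcomp Require Import all_boot all_order all_algebra.
From mathcomp Require Import all_classical all_reals all_analysis.
From mathcomp Require Import complex.

Set Implicit Arguments.
Unset Strict Implicit.
Unset Printing Implicit Defensive.

Import Order.TTheory GRing.Theory Num.Theory numFieldNormedType.Exports.

Local Open Scope classical_set_scope.
Local Open Scope ring_scope.
Local Open Scope complex_scope.

Fixpoint Ck (R : realType) (E F : normedModType R) (k : nat) (O : set E)
    (f : E -> F) : Prop :=
  (forall x, O x -> {for x, continuous f}) /\
  (if k is k'.+1 then
     forall v : E, (forall x, O x -> derivable f x v) /\
                   Ck k' O (fun x => 'D_v f x)
   else True).

Definition smooth_on (R : realType) (E F : normedModType R) (O : set E)
  (f : E -> F) : Prop := forall k, Ck k O f.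

Definition csmooth_on (R : realType) (E : normedModType R) (O : set E)
    (f : E -> R[i]) : Prop :=
  smooth_on O (fun x => complex.Re (f x)) /\
  smooth_on O (fun x => complex.Im (f x)).

(* The atlas is indexed by the points of the manifold: [cdom x], [cmap x] and
   [cinv x] describe a chart around x.  The tangent space at x is 'rV[R]_m,
   read in the preferred chart at x; tangent maps, vector fields and brackets
   below are all expressed with respect to this identification. *)
Record manifold (R : realType) (m : nat) := Manifold {
  carrier :> topologicalType;
  cdom : carrier -> set carrier;
  cmap : carrier -> carrier -> 'rV[R]_m;
  cinv : carrier -> 'rV[R]_m -> carrier;
  cdom_open : forall x, open (cdom x);
  cdom_mem : forall x, cdom x x;
  cimg_open : forall x, open (cmap x @` cdom x);
  cmapK : forall x y, cdom x y -> cinv x (cmap x y) = y;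
  cmap_cont : forall x y, cdom x y -> {for y, continuous (cmap x)};
  cinv_cont : forall x y, cdom x y -> {for cmap x y, continuous (cinv x)};
  transition_smooth : forall x y,
    smooth_on (cmap x @` (cdom x `&` cdom y)) (cmap y \o cinv x);
  manifold_hausdorff : hausdorff_space carrier;
  manifold_second_countable : @second_countable carrier }.

Section Manifolds.
Variables (R : realType).

Definition smooth_plot k m (M : manifold R m) (O : set 'rV[R]_k)
    (c : 'rV[R]_k -> M) : Prop :=
  (forall t, O t -> {for t, continuous c}) /\
  forall x, smooth_on (O `&` c @^-1` cdom x) (cmap x \o c).

Definition smooth_map m m' (M : manifold R m) (N : manifold R m')
    (U : set M) (f : M -> N) : Prop :=
  (forall x, U x -> {for x, continuous f}) /\
  forall x y, smooth_on (cmap x @` (cdom x `&` U `&` f @^-1` cdom y))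
                        (cmap y \o f \o cinv x).

Definition smooth_fun m (M : manifold R m) (F : normedModType R)
    (U : set M) (f : M -> F) : Prop :=
  forall x, smooth_on (cmap x @` (cdom x `&` U)) (f \o cinv x).

Definition csmooth_fun m (M : manifold R m) (U : set M) (f : M -> R[i]) :=
  smooth_fun U (fun x => complex.Re (f x)) /\
  smooth_fun U (fun x => complex.Im (f x)).

Definition tmap m m' (M : manifold R m) (N : manifold R m') (f : M -> N)
    (x : M) (v : 'rV[R]_m) : 'rV[R]_m' :=
  'D_v (cmap (f x) \o f \o cinv x) (cmap x x).

Definition dfun m (M : manifold R m) (F : normedModType R) (f : M -> F)
    (x : M) (v : 'rV[R]_m) : F :=
  'D_v (f \o cinv x) (cmap x x).

Definition velocity m (M : manifold R m) (c : R -> M) (t : R) : 'rV[R]_m :=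
  'D_1 (cmap (c t) \o c) t.

(* coordinate expression, in the chart around x, of the vector field X *)
Definition vf_coord m (M : manifold R m) (x : M) (X : M -> 'rV[R]_m)
    (t : 'rV[R]_m) : 'rV[R]_m :=
  let y := cinv x t in 'D_(X y) (cmap x \o cinv y) (cmap y y).

Definition smooth_vf m (M : manifold R m) (U : set M) (X : M -> 'rV[R]_m) :=
  forall x, smooth_on (cmap x @` (cdom x `&` U)) (vf_coord x X).

Definition lie m (M : manifold R m) (X Y : M -> 'rV[R]_m) (x : M) : 'rV[R]_m :=
  'D_(X x) (vf_coord x Y) (cmap x x) - 'D_(Y x) (vf_coord x X) (cmap x x).

Definition re_vf m (M : manifold R m) (Z : M -> 'rV[R[i]]_m) (x : M) :=
  map_mx (@complex.Re R) (Z x).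
Definition im_vf m (M : manifold R m) (Z : M -> 'rV[R[i]]_m) (x : M) :=
  map_mx (@complex.Im R) (Z x).

Definition cplx a b (v : 'M[R]_(a, b)) : 'M[R[i]]_(a, b) :=
  map_mx (fun r : R => r%:C) v.

Definition clie m (M : manifold R m) (Z W : M -> 'rV[R[i]]_m) (x : M) :
    'rV[R[i]]_m :=
  cplx (lie (re_vf Z) (re_vf W) x - lie (im_vf Z) (im_vf W) x) +
  'i%C *: cplx (lie (re_vf Z) (im_vf W) x + lie (im_vf Z) (re_vf W) x).

Definition smooth_cvf m (M : manifold R m) (Z : M -> 'rV[R[i]]_m) :=
  smooth_vf setT (re_vf Z) /\ smooth_vf setT (im_vf Z).

End Manifolds.

(* J x matters only on the row space of H x.  [posQ x] is the set of tangent
   vectors whose class in T_x M / H_x is positive.  The real part of the Levi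
   form is (xi, eta) |-> [J xi, eta] mod H. *)
Section CR.
Variables (R : realType) (n : nat) (M : manifold R n.*2.+1).
Implicit Types (x y : M) (H J : M -> 'M[R]_n.*2.+1).

Definition sectionH H (xi : M -> 'rV[R]_n.*2.+1) : Prop :=
  smooth_vf setT xi /\ forall x, (xi x <= H x)%MS.

Definition H10 H J x : set 'rV[R[i]]_n.*2.+1 :=
  [set z | exists2 v : 'rV[R]_n.*2.+1,
             (v <= H x)%MS & z = cplx v - 'i%C *: cplx (v *m J x)].

Definition H01 H J x : set 'rV[R[i]]_n.*2.+1 :=
  [set z | exists2 v : 'rV[R]_n.*2.+1,
             (v <= H x)%MS & z = cplx v + 'i%C *: cplx (v *m J x)].

Definition levi_value H J x (T X Y : 'rV[R]_n.*2.+1) (c : R) : Prop :=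
  forall xi eta, sectionH H xi -> sectionH H eta -> xi x = X -> eta x = Y ->
    (lie (fun y => xi y *m J y) eta x - c *: T <= H x)%MS.

Record cr_structure (p q : nat) := CRStructure {
  crH : M -> 'M[R]_n.*2.+1;
  crJ : M -> 'M[R]_n.*2.+1;
  posQ : M -> set 'rV[R]_n.*2.+1;
  crJ_stable : forall x (v : 'rV[R]_n.*2.+1),
    (v <= crH x)%MS -> (v *m crJ x <= crH x)%MS;
  crJJ : forall x (v : 'rV[R]_n.*2.+1),
    (v <= crH x)%MS -> v *m crJ x *m crJ x = - v;
  crH_frame : forall x, exists (U : set M) (X : M -> 'M[R]_(n, n.*2.+1)),
    [/\ open U, U x,
        forall i, smooth_vf U (fun y => row i (X y)),
        forall i, smooth_vf U (fun y => row i (X y *m crJ y)) &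
        forall y, U y -> row_free (col_mx (X y) (X y *m crJ y)) /\
                         (crH y :=: col_mx (X y) (X y *m crJ y))%MS];
  cr_involutive : forall Z W : M -> 'rV[R[i]]_n.*2.+1,
    smooth_cvf Z -> smooth_cvf W ->
    (forall x, H10 crH crJ x (Z x)) -> (forall x, H10 crH crJ x (W x)) ->
    forall x, H10 crH crJ x (clie Z W x);
  cr_nondegenerate : forall x xi, sectionH crH xi ->
    (forall eta, sectionH crH eta -> (lie xi eta x <= crH x)%MS) -> xi x = 0;
  posQ_frame : forall x, exists (U : set M) (T : M -> 'rV[R]_n.*2.+1),
    [/\ open U, U x, smooth_vf U T,
        forall y, U y -> ~~ (T y <= crH y)%MS &
        forall y v, U y ->
          (posQ y v <-> exists2 c : R, 0 < c & (v - c *: T y <= crH y)%MS)];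
  levi_signature : p + q = n /\
    forall x, exists (T : 'rV[R]_n.*2.+1) (E : 'M[R]_(n, n.*2.+1)),
      let EJ := E *m crJ x in
      [/\ posQ x T, row_free (col_mx E EJ), (crH x :=: col_mx E EJ)%MS,
          forall i j, levi_value crH crJ x T (row i E) (row j E)
            (if i == j then (if (i < p)%N then 1 else -1) else 0) &
          forall i j, levi_value crH crJ x T (row i E) (row j EJ) 0] }.

(* The fibre at x of the (n+1)st exterior power of the annihilator of H^{0,1}.
   As this annihilator has rank n+1, each element is a_0 /\ ... /\ a_n for
   covectors a_j (the columns of A); it is viewed as the (n+1)-form sending
   the rows of W to det (a_j (w_i)). *)
Definition canonical_fibre p q (S : cr_structure p q) x :
    set ('M[R[i]]_(n.+1, n.*2.+1) -> R[i]) :=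
  [set kap | exists2 A : 'M[R[i]]_(n.*2.+1, n.+1),
     (forall w, H01 (crH S) (crJ S) x w -> w *m A = 0) &
     kap = fun W => \det (W *m A)].

Definition smooth_canonical_section p q (S : cr_structure p q) (U : set M)
    (kap : M -> 'M[R[i]]_(n.+1, n.*2.+1) -> R[i]) : Prop :=
  (forall x, U x -> canonical_fibre S x (kap x)) /\
  forall X : 'I_n.+1 -> M -> 'rV[R]_n.*2.+1,
    (forall i, smooth_vf U (X i)) ->
    csmooth_fun U (fun x => kap x (\matrix_(i, j) (X i x 0 j)%:C)).

End CR.

(* In a one-dimensional vector space addition is determined by scalar
   multiplication, and linear maps are the homogeneous ones. *)
Record line_bundle (R : realType) (m : nat) (M : manifold R m) := LineBundle {
  ltot :> manifold R m.+2;
  lproj : ltot -> M;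
  lscale : R[i] -> ltot -> ltot;
  lproj_smooth : smooth_map setT lproj;
  lproj_scale : forall z e, lproj (lscale z e) = lproj e;
  lscale1 : forall e, lscale 1 e = e;
  lscaleA : forall z w e, lscale z (lscale w e) = lscale (z * w) e;
  lscale_smooth : forall k (O : set 'rV[R]_k) z c, open O ->
    csmooth_on O z -> smooth_plot O c ->
    smooth_plot O (fun t => lscale (z t) (c t));
  ltriv : forall x, exists (U : set M) (s : M -> ltot) (t : ltot -> R[i]),
    [/\ open U /\ U x, smooth_map U s, csmooth_fun (lproj @^-1` U) t,
        forall y, U y -> lproj (s y) = y /\ forall z, t (lscale z (s y)) = z &
        forall e, U (lproj e) -> e = lscale (t e) (s (lproj e))] }.

Definition nonzero (R : realType) m (M : manifold R m) (L : line_bundle M) :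
    set L := [set e | lscale 0 e <> e].

(* Nondegeneracy makes L' the dual line bundle of L. *)
Record line_duality (R : realType) m (M : manifold R m)
    (L L' : line_bundle M) := LineDuality {
  lpair :> L -> L' -> R[i];
  lpair_scalel : forall z e e', lproj e = lproj e' ->
    lpair (lscale z e) e' = z * lpair e e';
  lpair_scaler : forall z e e', lproj e = lproj e' ->
    lpair e (lscale z e') = z * lpair e e';
  lpair_nondeg : forall e e', lproj e = lproj e' ->
    nonzero e -> nonzero e' -> lpair e e' <> 0;
  lpair_smooth : forall k (O : set 'rV[R]_k) c c', open O ->
    smooth_plot O c -> smooth_plot O c' ->
    (forall t, O t -> lproj (c t) = lproj (c' t)) ->
    csmooth_on O (fun t => lpair (c t) (c' t)) }.

Record canonical_duality (R : realType) n (M : manifold R n.*2.+1) p q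
    (S : cr_structure M p q) (L : line_bundle M) := CanonicalDuality {
  kpair :> M -> ('I_n.+2 -> L) -> ('M[R[i]]_(n.+1, n.*2.+1) -> R[i]) -> R[i];
  kpair_scalel : forall x l kap (i : 'I_n.+2) z,
    (forall j, lproj (l j) = x) -> canonical_fibre S x kap ->
    kpair x (fun j => if j == i then lscale z (l j) else l j) kap =
    z * kpair x l kap;
  kpair_scaler : forall x l kap z,
    (forall j, lproj (l j) = x) -> canonical_fibre S x kap ->
    kpair x l (fun W => z * kap W) = z * kpair x l kap;
  kpair_nondeg : forall x l kap,
    (forall j, lproj (l j) = x) -> canonical_fibre S x kap ->
    (forall j, nonzero (l j)) -> (exists W, kap W <> 0) ->
    kpair x l kap <> 0;
  kpair_smooth : forall (U : set M) (l : 'I_n.+2 -> M -> L) kap, open U ->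
    (forall j, smooth_map U (l j)) ->
    (forall j x, U x -> lproj (l j x) = x) ->
    smooth_canonical_section S U kap ->
    csmooth_fun U (fun x => kpair x (fun j => l j x) (kap x)) }.

(* The space of real lines in the fibres of L: e and e' have the same image
   under [fq] iff they span the same real line, and the smooth structure is
   the one for which [fq] is a surjective submersion. *)
Record real_lines (R : realType) n (M : manifold R n.*2.+1)
    (L : line_bundle M) (Mt : manifold R n.*2.+2) := RealLines {
  fq : L -> Mt;
  fproj : Mt -> M;
  fq_smooth : smooth_map (@nonzero R _ M L) fq;
  fq_surj : forall y, exists2 e : L, nonzero e & fq e = y;
  fq_eq : forall e e' : L, nonzero e -> nonzero e' ->
    (fq e = fq e' <-> exists r : R, e' = lscale r%:C e);
  fq_submersion : forall e : L, nonzero e ->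
    forall w, exists v, tmap fq e v = w;
  fproj_fq : forall e : L, nonzero e -> fproj (fq e) = lproj e }.

Section Groups.
Variables (R : realType) (k : nat).

Definition smooth_curve (K : set 'M[R]_k) (a : R -> 'M[R]_k) : Prop :=
  [/\ smooth_on setT a, forall t, K (a t) & a 0 = 1%:M].

Definition lie_alg (K : set 'M[R]_k) : set 'M[R]_k :=
  [set X | exists2 a, smooth_curve K a & derive1 a 0 = X].

Definition mxbracket (X Y : 'M[R]_k) : 'M[R]_k := X *m Y - Y *m X.

(* A map into K (an embedded submanifold of the matrix space) is smooth iff it
   is smooth as a matrix-valued map. *)
Record principal_bundle (K : set 'M[R]_k) dT dM (T : manifold R dT)
    (M : manifold R dM) := PrincipalBundle {
  pproj : T -> M;
  pact : T -> 'M[R]_k -> T;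
  pproj_smooth : smooth_map setT pproj;
  pproj_act : forall u a, K a -> pproj (pact u a) = pproj u;
  pact1 : forall u, pact u 1%:M = u;
  pactM : forall u a b, K a -> K b -> pact (pact u a) b = pact u (a *m b);
  pact_smooth : forall d (O : set 'rV[R]_d) c a, open O ->
    smooth_plot O c -> smooth_on O a -> (forall t, O t -> K (a t)) ->
    smooth_plot O (fun t => pact (c t) (a t));
  ptriv : forall x, exists (U : set M) (s : M -> T) (g : T -> 'M[R]_k),
    [/\ open U /\ U x, smooth_map U s, smooth_fun (pproj @^-1` U) g,
        forall y, U y ->
          pproj (s y) = y /\ forall a, K a -> g (pact (s y) a) = a &
        forall u, U (pproj u) -> K (g u) /\ u = pact (s (pproj u)) (g u)] }.

Record cartan_geometry (G P : set 'M[R]_k) dT dM (T : manifold R dT)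
    (M : manifold R dM) := CartanGeometry {
  cbundle :> principal_bundle P T M;
  om : T -> 'rV[R]_dT -> 'M[R]_k;
  om_linear : forall u, linear (om u);
  om_smooth : forall x (e : 'rV[R]_dT),
    smooth_on (cmap x @` cdom x) (fun t =>
      let u := cinv x t in om u ('D_e (cmap u \o cinv x) t));
  om_in : forall u v, lie_alg G (om u v);
  om_inj : forall u, injective (om u);
  om_surj : forall u X, lie_alg G X -> exists v, om u v = X;
  om_equivariant : forall u a v, P a ->
    om (pact cbundle u a) (tmap (fun w : T => pact cbundle w a) u v) =
    invmx a *m om u v *m a;
  om_fundamental : forall u a, smooth_curve P a ->
    om u (velocity (fun t => pact cbundle u (a t)) 0 :> 'rV[R]_dT) =
    derive1 a 0 }.

Definition om_inv (G P : set 'M[R]_k) dT dM (T : manifold R dT)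
    (M : manifold R dM) (C : cartan_geometry G P T M) (X : 'M[R]_k) (u : T) :
    'rV[R]_dT := xget 0 [set v | om C u v = X].

(* The curvature K = d om + 1/2 [om, om], evaluated on the constant vector
   fields om^{-1}(X) and om^{-1}(Y). *)
Definition curvature (G P : set 'M[R]_k) dT dM (T : manifold R dT)
    (M : manifold R dM) (C : cartan_geometry G P T M) (u : T)
    (X Y : 'M[R]_k) : 'M[R]_k :=
  mxbracket X Y - om C u (lie (om_inv C X) (om_inv C Y) u).

Definition p_plus (G P : set 'M[R]_k) : set 'M[R]_k :=
  [set Z | lie_alg G Z /\ forall X, lie_alg P X -> \tr (Z *m X) = 0].

(* Vanishing of the Kostant codifferential of the curvature function:
   (del* f)(Y) = sum_a [Z_a, f(Y, X_a)] - 1/2 sum_a f([Z_a, Y], X_a), where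
   X_a represent a basis of g/p and Z_a is the dual basis of p_+ for the trace
   form, which is a multiple of the Killing form on the real forms used here. *)
Definition normal_cartan (G P : set 'M[R]_k) dT dM (T : manifold R dT)
    (M : manifold R dM) (C : cartan_geometry G P T M) : Prop :=
  forall (u : T) (X Z : 'I_dM -> 'M[R]_k),
    (forall a, lie_alg G (X a)) -> (forall a, p_plus G P (Z a)) ->
    (forall a b, \tr (Z a *m X b) = (a == b)%:R) ->
    forall Y, lie_alg G Y ->
      \sum_a (mxbracket (Z a) (curvature C u Y (X a))
              - 2^-1 *: curvature C u (mxbracket (Z a) Y) (X a)) = 0.

Record representation (G : set 'M[R]_k) (d : nat) := Representation {
  rho :> 'M[R]_k -> 'M[R]_d;
  drho : 'M[R]_k -> 'M[R]_d;
  rho1 : rho 1%:M = 1%:M;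
  rhoM : forall a b, G a -> G b -> rho (a *m b) = rho a *m rho b;
  rho_smooth : forall l (O : set 'rV[R]_l) a, open O ->
    smooth_on O a -> (forall t, O t -> G (a t)) ->
    smooth_on O (fun t => rho (a t));
  drhoE : forall a, smooth_curve G a ->
    derive1 (fun t => rho (a t)) 0 = drho (derive1 a 0) }.

(* The group of the representation may be bigger than G, so that one and the
   same representation of the bigger group is used for both tractor bundles. *)
Section Tractors.
Variables (G P G' : set 'M[R]_k) (dT dM : nat) (T : manifold R dT).
Variables (M : manifold R dM) (C : cartan_geometry G P T M).
Variables (d : nat) (W : representation G' d).

Definition tractor_section : set (T -> 'cV[R]_d) :=
  [set f | smooth_fun setT f /\
           forall u a, P a -> f (pact C u a) = W (invmx a) *m f u].

Definition tractor_conn (xi : M -> 'rV[R]_dM) (f : T -> 'cV[R]_d) (u : T) :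
    'cV[R]_d :=
  let v := xget 0 [set v | tmap (pproj C) u v = xi (pproj C u)] in
  dfun f u v + drho W (om C u v) *m f u.

Definition linear_connection
    (D : (M -> 'rV[R]_dM) -> (T -> 'cV[R]_d) -> T -> 'cV[R]_d) : Prop :=
  forall xi eta (f : M -> R) phi psi,
    smooth_vf setT xi -> smooth_vf setT eta -> smooth_fun setT f ->
    tractor_section phi -> tractor_section psi ->
    [/\ tractor_section (D xi phi),
        forall u, D (fun x => xi x + f x *: eta x) phi u =
                  D xi phi u + f (pproj C u) *: D eta phi u,
        forall u, D xi (fun u => phi u + psi u) u = D xi phi u + D xi psi u &
        forall u, D xi (fun u => f (pproj C u) *: phi u) u =
          dfun f (pproj C u) (xi (pproj C u)) *: phi u
          + f (pproj C u) *: D xi phi u].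

End Tractors.

Definition adjoint_section (G P : set 'M[R]_k) dT dM (T : manifold R dT)
    (M : manifold R dM) (C : cartan_geometry G P T M) : set (T -> 'M[R]_k) :=
  [set s | [/\ smooth_fun setT s, forall u, lie_alg G (s u) &
               forall u a, P a -> s (pact C u a) = invmx a *m s u *m a]].

(* xi is the image of s under the projection from the adjoint tractor bundle
   to the tangent bundle *)
Definition is_adjoint_proj (G P : set 'M[R]_k) dT dM (T : manifold R dT)
    (M : manifold R dM) (C : cartan_geometry G P T M) (s : T -> 'M[R]_k)
    (xi : M -> 'rV[R]_dM) : Prop :=
  forall u, xi (pproj C u) = tmap (pproj C) u (om_inv C (s u) u).

End Groups.

Section HermitianGroups.
Variables (R : realType) (N : nat) (h : 'M[R[i]]_N).

Definition herm (x y : 'cV[R[i]]_N) : R[i] :=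
  ((map_mx (@conjc R) y)^T *m h *m x) 0 0.

Definition herm_signature (r : nat) : Prop :=
  exists2 B : 'M[R[i]]_N, B \in unitmx &
    (map_mx (@conjc R) B)^T *m h *m B =
    diag_mx (\row_(i < N) (if (i < r)%N then 1 else -1)).

Definition realify (B : 'M[R[i]]_N) : 'M[R]_(N + N) :=
  block_mx (map_mx (@complex.Re R) B) (- map_mx (@complex.Im R) B)
           (map_mx (@complex.Im R) B) (map_mx (@complex.Re R) B).

Definition rvec (x : 'cV[R[i]]_N) : 'cV[R]_(N + N) :=
  col_mx (map_mx (@complex.Re R) x) (map_mx (@complex.Im R) x).

Definition cvec (x : 'cV[R]_(N + N)) : 'cV[R[i]]_N :=
  \col_i (usubmx x i 0 +i* dsubmx x i 0).

Definition SUgroup : set 'M[R]_(N + N) :=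
  [set A | exists B : 'M[R[i]]_N,
     [/\ A = realify B, forall x y, herm (B *m x) (B *m y) = herm x y &
         \det B = 1]].

Definition SOgroup : set 'M[R]_(N + N) :=
  [set A | (forall x y, complex.Re (herm (cvec (A *m x)) (cvec (A *m y))) =
                        complex.Re (herm (cvec x) (cvec y))) /\ \det A = 1].

Definition SO0group : set 'M[R]_(N + N) := connected_component SOgroup 1%:M.

Variable v0 : 'cV[R[i]]_N.

Definition Pgroup : set 'M[R]_(N + N) :=
  [set A | SUgroup A /\ exists z : R[i], cvec (A *m rvec v0) = z *: v0].

Definition Ptgroup : set 'M[R]_(N + N) :=
  [set A | SO0group A /\ exists r : R, A *m rvec v0 = r *: rvec v0].

Definition at_v0 (X : 'M[R]_(N + N)) : 'cV[R[i]]_N := cvec (X *m rvec v0).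

(* the filtration component g^{-1} of the |2|-graded Lie algebra g *)
Definition g_minus1 : set 'M[R]_(N + N) :=
  [set X | lie_alg SUgroup X /\ herm (at_v0 X) v0 = 0].

End HermitianGroups.

Section CRCartan.
Variables (R : realType) (p q n : nat) (h : 'M[R[i]]_n.+2).
Variables (v0 : 'cV[R[i]]_n.+2) (M : manifold R n.*2.+1).
Variables (S : cr_structure M p q) (E1 Em1 : line_bundle M).
Variables (ev : line_duality Em1 E1) (D : canonical_duality S E1).
Variables (dG : nat) (GG : manifold R dG).
Variable C : cartan_geometry (SUgroup h) (Pgroup h v0) GG M.

(* Since g^{-2} = g, only this component of the condition is not vacuous. *)
Definition regular_cartan : Prop :=
  forall u X Y, g_minus1 h v0 X -> g_minus1 h v0 Y ->
    g_minus1 h v0 (curvature C u X Y).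

(* (H, J) corresponds to g^{-1}/p = Hom(V^1, (V^1)^perp / V^1) with its complex
   structure, and the orientation of Q to that of g/g^{-1} given by
   X |-> Im <X v0, v0>. *)
Definition induces_cr : Prop :=
  forall (u : GG) (v v' : 'rV[R]_dG),
  let x := pproj C u in let d w := tmap (pproj C) u w in
  [/\ (d v <= crH S x)%MS <-> g_minus1 h v0 (om C u v),
      g_minus1 h v0 (om C u v) -> g_minus1 h v0 (om C u v') ->
      (exists z : R[i],
         at_v0 v0 (om C u v') = 'i%C *: at_v0 v0 (om C u v) + z *: v0) ->
      d v' = d v *m crJ S x &
      posQ S x (d v) <-> 0 < complex.Im (herm h (at_v0 v0 (om C u v)) v0)].

(* beta u = [u, v0] describes an isomorphism of the associated bundle
   GG x_P V^1 with E(-1,0).  It is compatible with the duality between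
   E(1,0)^{n+2} and the canonical bundle: via T_C M / H^{0,1} = GG x_P (V^1)^* (x)
   (V / V^1), the determinant on V identifies the canonical bundle with
   GG x_P (V^1)^{n+2}, and v0^{n+2} corresponds at u to the form
   (d pi w_0, ..., d pi w_n) |-> det (v0, om(w_0) v0, ..., om(w_n) v0). *)
Record tautological_iso (beta : GG -> Em1) : Prop := TautologicalIso {
  beta_smooth : smooth_map setT beta;
  beta_proj : forall u, lproj (beta u) = pproj C u;
  beta_nonzero : forall u, nonzero (beta u);
  beta_equivariant : forall u a z, Pgroup h v0 a ->
    cvec (a *m rvec v0) = z *: v0 -> beta (pact C u a) = lscale z (beta u);
  beta_canonical : forall u kap (l : 'I_n.+2 -> E1),
    (forall j, lproj (l j) = pproj C u) ->
    canonical_fibre S (pproj C u) kap ->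
    (forall w : 'M[R]_(n.+1, dG),
       kap (\matrix_(i, j) (tmap (pproj C) u (row i w) 0 j)%:C) =
       \det (row_mx v0 (\matrix_(i < n.+2, j < n.+1)
                          at_v0 v0 (om C u (row j w)) i 0) : 'M[R[i]]_n.+2)) ->
    D (pproj C u) l kap = \prod_j ev (beta u) (l j) }.

(* (GG, om) -> (GGt, omt) exhibits the latter as the extension to the
   principal bundle GG x_{G :&: P~} P~ over the Fefferman space. *)
Variables (Mt : manifold R n.*2.+2) (F : real_lines Em1 Mt).
Variables (dGt : nat) (GGt : manifold R dGt).
Variable Ct : cartan_geometry (SO0group h) (Ptgroup h v0) GGt Mt.

Record fefferman_extension (beta : GG -> Em1) (j : GG -> GGt) : Prop :=
  FeffermanExtension {
  j_smooth : smooth_map setT j;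
  j_proj : forall u, pproj Ct (j u) = fq F (beta u);
  j_equivariant : forall u a, SUgroup h a -> Ptgroup h v0 a ->
    j (pact C u a) = pact Ct (j u) a;
  j_om : forall u v, om Ct (j u) (tmap j u v) = om C u v }.

End CRCartan.

(* Main.v *)
Require Import Defs.
From HB Require Import structures.
From mathcomp Require Import all_boot all_order all_algebra.
From mathcomp Require Import all_classical all_reals all_analysis.
From mathcomp Require Import complex.
From mathcomp Require Import ring lra.
Import Order.TTheory GRing.Theory Num.Theory numFieldNormedType.Exports.
Local Open Scope classical_set_scope.
Local Open Scope ring_scope.
Local Open Scope complex_scope.

Set Implicit Arguments.
Unset Strict Implicit.
Unset Printing Implicit Defensive.

(** The vector field k generates a circle inside P.  Let E be the one-parameter
    group in P acting on v0 by e^{it}, on a dual null vector by e^{it}, and on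
    their orthogonal complement by e^{-2it/n}.  Multiplication by i minus E'(0)
    is the velocity of a curve of isometries fixing v0, so it lies in p~, and k
    is the image of the fundamental field of E'(0) on GG.  For a section phi
    with f = phi o j, the derivative of t |-> W(E t) f(u E(t)) at 0 is therefore
    the value of nabla_k phi at j(u): it vanishes identically iff f is
    equivariant under E.  Each element of P is the product of some E(t) and an
    element mapping v0 to a positive multiple of itself, hence lying in
    G n P~, which proves (1).  For (2), the submersion fq o beta covers any lift
    xit to M~ of a vector field xi on M by a lift of xi to GG; as j pulls om~
    back to om, both tractor connections are then given by the same formula.

    Two facts are less formal.  SU(V) is contained in the identity component
    SO_0: the unitary group is generated by quasi-reflections, each of which
    lies on a circle of isometries through 1.  The projection M~ -> M is
    differentiable because the submersion fq has differentiable local right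
    inverses, obtained by Banach's fixed point theorem. *)

(** * Calculus of C^k maps *)

(** The scalars e^{it} have determinant e^{i(n+2)t} on V, so multiplication by i is not itself
    tangent to SU(V). The plane spanned by v0 and its dual null vector contributes e^{2it}, and the
    speed -2/n on the n-dimensional complement cancels it. The correction i - E'(0) kills v0, but
    its curve consists of unitary maps whose determinant need not be 1; this is one reason to place
    all of U(V), and not only SU(V), inside SO_0.

    Being parallel along k is a condition on the whole extended bundle, whereas the computation with
    E takes place on the image of j. The P~-translates of that image exhaust the bundle, since a
    nonzero complex multiple of beta(u) is a real multiple of some beta(u E(t)).

    The encoding adds two obstacles. Lifts in the tractor connection are picked by choice, so the
    derivative is first studied on tangent vectors of the total space, where it is linear and kills
    vertical vectors. A Lie algebra is a mere set of velocities and [drho] is specified only there,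
    so linearity has to be drawn from products and reparametrisations of curves. *)

Lemma near_eq_continuous (S T : topologicalType) (f g : S -> T) x :
  (\near x, f x = g x) -> {for x, continuous f} -> {for x, continuous g}.
Proof.
move=> fg; have fgx : f x = g x by exact: nbhs_singleton fg.
move=> fc; have : f @ x --> g x by rewrite -fgx; exact: fc.
by apply: cvg_trans; exact: near_eq_cvg.
Qed.

Section Ck_basic.
Variables (R : realType) (E F : normedModType R).
Implicit Types (f g : E -> F) (O : set E).

Lemma CkW k O f : Ck k.+1 O f -> Ck k O f.
Proof.
elim: k f => [|k IH] f; first by case.
by move=> [fc fd]; split=> // v; have [dv /IH] := fd v.
Qed.

Lemma Ck_le k l O f : (k <= l)%N -> Ck l O f -> Ck k O f.
Proof.
move=> /subnK <-; elim: (l - k)%N => [//|m IH].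
by rewrite addSn => /CkW.
Qed.

(** Every clause of the recursion is a condition at the points of O, so [Ck] localises to
    singletons. The derivatives still see f on a neighbourhood, which is why changing f on O later
    requires O open. *)
Lemma CkP k O f : Ck k O f <-> forall x, O x -> Ck k [set x] f.
Proof.
elim: k f => [|k IH] f.
  split=> [[fc _] x Ox|H]; split=> //; first by move=> y ->; exact: fc.
  by move=> x /H[/(_ x erefl)].
split=> [[fc fd] x Ox|H].
  split=> [y ->|v]; first exact: fc.
  have [dv cv] := fd v; split=> [y ->|]; first exact: dv.
  exact: (IH _).1 cv x Ox.
split=> [x /H[/(_ x erefl)] //|v]; split=> [x /H[_ /(_ v)[/(_ x erefl)]] //|].
by apply/IH => x /H[_ /(_ v)[_]].
Qed.

Lemma Ck_sub k O O' f : O' `<=` O -> Ck k O f -> Ck k O' f.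
Proof. by move=> OO' /CkP H; apply/CkP => x /OO'/H. Qed.

Lemma Ck_ext k O f g : open O -> (forall x, O x -> f x = g x) ->
  Ck k O f -> Ck k O g.
Proof.
move=> oO; elim: k f g => [|k IH] f g fg.
  have fgn x : O x -> \near x, f x = g x.
    by move=> Ox; near=> y; apply: fg; near: y; exact: open_nbhs_nbhs.
  move=> [fc _]; split=> // x Ox.
  exact: near_eq_continuous (fgn x Ox) (fc x Ox).
have fgn x : O x -> \near x, f x = g x.
  by move=> Ox; near=> y; apply: fg; near: y; exact: open_nbhs_nbhs.
move=> [fc fd]; split.
  move=> x Ox; exact: near_eq_continuous (fgn x Ox) (fc x Ox).
move=> v; have [dv cv] := fd v; split.
  by move=> x Ox; apply: near_eq_derivable (dv x Ox); apply: fgn.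
apply: IH cv => x Ox; apply: near_eq_derive; exact: fgn.
Unshelve. all: by end_near. Qed.

Lemma Ck_cst k O (c : F) : Ck k O (fun _ => c).
Proof.
elim: k c => [|k IH] c.
  by split=> // x _; exact: cst_continuous.
split=> [x _|v]; first exact: cst_continuous.
split; first by move=> x _; exact: derivable_cst.
have -> : (fun x => 'D_v (fun=> c) x) = (fun=> 0).
  by apply/funext => x; exact: (derive_cst c).
exact: IH.
Qed.

Lemma Ck_add k O f g : open O -> Ck k O f -> Ck k O g ->
  Ck k O (fun x => f x + g x).
Proof.
move=> oO; elim: k f g => [|k IH] f g [fc fd] [gc gd].
  split=> // x Ox.
  by apply: (@continuousD _ _ _ f g); [exact: fc|exact: gc].
split=> [x Ox|v].
  by apply: (@continuousD _ _ _ f g); [exact: fc|exact: gc].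
have [fv cfv] := fd v; have [gv cgv] := gd v; split.
  by move=> x Ox; apply: (@derivableD _ _ _ f g); [exact: fv|exact: gv].
apply: Ck_ext (IH _ _ cfv cgv) => // x Ox.
by rewrite (@deriveD _ _ _ f g); [|exact: fv|exact: gv].
Qed.

Lemma Ck_sum k O (I : Type) (r : seq I) (f : I -> E -> F) : open O ->
  (forall i, Ck k O (f i)) -> Ck k O (fun x => \sum_(i <- r) f i x).
Proof.
move=> oO fi; elim: r => [|i r IH].
  rewrite (_ : (fun _ => _) = fun=> 0); first exact: Ck_cst.
  by apply/funext => x; rewrite big_nil.
rewrite (_ : (fun _ => _) = fun x => f i x + \sum_(i <- r) f i x).
  exact: Ck_add.
by apply/funext => x; rewrite big_cons.
Qed.

End Ck_basic.

Section derive_scale.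
Variables (R : realType) (E F : normedModType R).

(** The increment is t times the difference quotient. A directional derivative gives continuity only
    along its own line, which is all that the product rule below uses. *)
Lemma derivable_continuous_line (f : E -> F) x v : derivable f x v ->
  (fun t : R => f (t *: v + x)) @ 0^' --> f x.
Proof.
move=> df.
have -> : (fun t : R => f (t *: v + x)) =
    (fun t => f x + (f (t *: v + x) - f x)).
  by apply/funext => t; rewrite addrCA subrr addr0.
rewrite -[X in _ --> X]addr0; apply: cvgD; first exact: cvg_cst.
have : (fun t : R => t *: (t^-1 *: (f (t *: v + x) - f x))) @ 0^' -->
    (0 : R) *: 'D_v f x.
  apply: cvgZ; last exact: df.
  by apply: cvg_within; exact: cvg_id.
rewrite scale0r; apply: cvg_trans; apply: near_eq_cvg; near=> t.
rewrite scalerA divff ?scale1r //; near: t; exact: nbhs_dnbhs_neq.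
Unshelve. all: by end_near. Qed.

Lemma is_derive_scale (h : E -> R) (f : E -> F) x v :
  derivable h x v -> derivable f x v ->
  is_derive x v (fun y => h y *: f y) ('D_v h x *: f x + h x *: 'D_v f x).
Proof.
move=> dh df.
suff H : (fun t : R => t^-1 *: (((fun y => h y *: f y) \o shift x) (t *: v) -
    h x *: f x)) @ 0^' --> 'D_v h x *: f x + h x *: 'D_v f x.
  split; first by apply/cvg_ex; eexists; exact: H.
  exact: cvg_lim.
have -> : (fun t : R => t^-1 *: (((fun y => h y *: f y) \o shift x) (t *: v) -
    h x *: f x)) = (fun t => (t^-1 *: (h (t *: v + x) - h x)) *: f (t *: v + x)
      + h x *: (t^-1 *: (f (t *: v + x) - f x))).
  apply/funext => t /=; move: (h (t *: v + x)) (f (t *: v + x)) => A y.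
  rewrite -[_ *: (A - _)]/(t^-1 * (A - h x)) -scalerA.
  rewrite [h x *: (_ *: _)]scalerA [h x * _]mulrC -[(_ * h x) *: _]scalerA.
  by rewrite -scalerDr scalerBl [h x *: (y - _)]scalerBr addrA subrK.
apply: cvgD.
  by apply: cvgZ; [exact: dh|exact: derivable_continuous_line].
by apply: cvgZ; [exact: cvg_cst|exact: df].
Qed.

Lemma Ck_scale k O (h : E -> R) (f : E -> F) : open O ->
  Ck k O h -> Ck k O f -> Ck k O (fun x => h x *: f x).
Proof.
move=> oO; elim: k h f => [|k IH] h f.
  by move=> [hc _] [fc _]; split=> // x Ox; apply: continuousZ;
    [exact: hc|exact: fc].
move=> Hh Hf; have Hh' := CkW Hh; have Hf' := CkW Hf.
case: Hh Hf => [hc hd] [fc fd]; split=> [x Ox|v].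
  by apply: continuousZ; [exact: hc|exact: fc].
have [hv chv] := hd v; have [fv cfv] := fd v; split.
  by move=> x Ox; have [] := is_derive_scale (hv x Ox) (fv x Ox).
apply: (@Ck_ext _ _ _ _ _ (fun x => 'D_v h x *: f x + h x *: 'D_v f x)) => //.
  by move=> x Ox; have [_ ->] := is_derive_scale (hv x Ox) (fv x Ox).
by apply: Ck_add => //; apply: IH.
Qed.

End derive_scale.

Lemma Ck_mul (R : realType) (E : normedModType R) k O (f g : E -> R) : open O ->
  Ck k O f -> Ck k O g -> Ck k O (fun x => f x * g x).
Proof. exact: Ck_scale. Qed.

Section Ck_mx.
Variables (R : realType) (E : normedModType R) (m n : nat).
Implicit Types (f : E -> 'M[R]_(m, n)).

Lemma continuous_mxP (T : topologicalType) (f : T -> 'M[R]_(m, n)) x :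
  {for x, continuous f} <-> forall i j, {for x, continuous (fun y => f y i j)}.
Proof.
split=> [fc i j|H].
  by apply: (@continuous_comp _ _ _ f (fun M : 'M[R]_(m, n) => M i j));
    [exact: fc|exact: coord_continuous].
apply/cvgrPdist_lt => /= e e0.
near=> y.
rewrite [ltLHS]/Num.Def.normr/= mx_normrE; apply: bigmax_lt => // -[i j] _ /=.
rewrite !mxE.
move: i j; near: y; apply: filter_forall => i; apply: filter_forall => j.
by have /cvgrPdist_lt /(_ e e0) := H i j.
Unshelve. all: by end_near. Qed.

Lemma Ck_mxP k O f : open O ->
  Ck k O f <-> forall i j, Ck k O (fun x => f x i j).
Proof.
move=> oO; elim: k f => [|k IH] f.
  split=> [[fc _] i j|H]; split=> // x Ox.
    by move: (fc x Ox) => /continuous_mxP; apply.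
  by apply/continuous_mxP => i j; have [c _] := H i j; exact: c.
have dE v : (forall x, O x -> derivable f x v) -> forall i j x, O x ->
    ('D_v f x) i j = 'D_v (fun y => f y i j) x.
  by move=> fv i j x Ox; rewrite derive_mx ?mxE //; exact: fv.
split=> [[fc fd] i j|H]; split.
- by move=> x Ox; move: (fc x Ox) => /continuous_mxP; apply.
- move=> v; have [fv cfv] := fd v; split.
    by move=> x Ox; move: (fv x Ox) => /derivable_mxP; apply.
  by apply: Ck_ext ((IH _).1 cfv i j) => // x Ox; exact: dE.
- by move=> x Ox; apply/continuous_mxP => i j; have [] := H i j => c _; exact: c.
- move=> v.
  have fv x : O x -> derivable f x v.
    by move=> Ox; apply/derivable_mxP => i j; have [_ /(_ v)[d _]] := H i j; exact: d.
  split=> //; apply/IH => i j.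
  have [_ /(_ v)[_]] := H i j.
  by apply: Ck_ext => // x Ox; rewrite dE.
Qed.

End Ck_mx.

(** * Restriction to lines, the mean value theorem and strict differentiability *)

Section line.
Variables (R : realType) (E F : normedModType R).

Lemma line_quotient (f : E -> F) a v (t : R) :
  (fun h : R => h^-1 *: (((fun s : R => f (s *: v + a)) \o shift t) (h *: 1) -
     f (t *: v + a))) =
  (fun h : R => h^-1 *: ((f \o shift (t *: v + a)) (h *: v) - f (t *: v + a))).
Proof.
apply/funext => h /=; congr (_ *: (f _ - _)).
by rewrite [h *: 1]mulr1 scalerDl addrA.
Qed.

Lemma derivable_line (f : E -> F) a v (t : R) :
  derivable f (t *: v + a) v -> derivable (fun s : R => f (s *: v + a)) t 1.
Proof. by rewrite /derivable line_quotient. Qed.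

Lemma derive_line (f : E -> F) a v (t : R) :
  'D_1 (fun s : R => f (s *: v + a)) t = 'D_v f (t *: v + a).
Proof. by rewrite /derive line_quotient. Qed.

(** On the line through a, derivability in one real variable is differentiability, so homogeneity is
    the linearity of a differential; this includes c = 0. *)
Lemma deriveZdir (f : E -> F) a v (c : R) : derivable f a v ->
  'D_(c *: v) f a = c *: 'D_v f a.
Proof.
move=> fv.
pose g (s : R) := f (s *: v + a).
have g0 : f a = g 0 by rewrite /g scale0r add0r.
have dg : derivable g 0 1 by apply: derivable_line; rewrite scale0r add0r.
have dg' : differentiable g 0 by exact/derivable1_diffP.
have -> : 'D_v f a = 'D_1 g 0 by rewrite derive_line scale0r add0r.
have -> : 'D_(c *: v) f a = 'D_c g 0.
  have Q : (fun h : R => h^-1 *: ((f \o shift a) (h *: (c *: v)) - f a)) =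
           (fun h => h^-1 *: ((g \o shift 0) (h *: c) - g 0)).
    by apply/funext => h; rewrite /g /= scale0r add0r addr0 scalerA.
  by rewrite /derive Q.
rewrite !deriveE // -linearZ; congr ('d g 0 _).
by rewrite -[RHS]/(c * 1) mulr1.
Qed.

End line.

Lemma mvt_line (R : realType) (E : normedModType R) (f : E -> R) a v :
  (forall t : R, 0 <= t <= 1 -> derivable f (t *: v + a) v) ->
  exists2 t : R, 0 <= t <= 1 & f (v + a) - f a = 'D_v f (t *: v + a).
Proof.
move=> fd; pose g (s : R) := f (s *: v + a).
have dg (t : R) : 0 <= t <= 1 -> is_derive t 1 g ('D_v f (t *: v + a)).
  by move=> /fd/derivable_line dg; split=> //; rewrite derive_line.
have [|||c cI] := @MVT_segment R g (fun t => 'D_v f (t *: v + a)) 0 1.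
- exact: ler01.
- by move=> x; rewrite in_itv /= => /andP[x0 x1]; apply: dg; rewrite !ltW.
- apply: derivable_within_continuous => x; rewrite in_itv /= => xI.
  by have [] := dg x xI.
rewrite /g scale1r scale0r add0r subr0 mulr1 => ->.
by exists c => //; move: cI; rewrite in_itv.
Qed.

(** Both endpoints vary near x, unlike in ordinary differentiability. This is what makes f minus its
    linear part a map with small Lipschitz constant, as the fixed point argument needs. *)
Definition strict_diff (R : realType) (E F : normedModType R) (f : E -> F) x
    (L : E -> F) : Prop :=
  forall e : R, 0 < e -> exists2 d : R, 0 < d &
    forall y z, ball x d y -> ball x d z ->
      `|f z - f y - L (z - y)| <= e * `|z - y|.

Section strict.
Variables (R : realType) (m : nat).
Local Notation V := 'rV[R]_m.
Local Notation eb i := (delta_mx 0 i : V).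

(** The corners of a staircase from y to z whose k-th edge changes only coordinate k. *)
Definition pathpt (y z : V) (k : nat) : V :=
  \row_i (if (i < k)%N then z 0 i else y 0 i).

Lemma pathpt0 y z : pathpt y z 0 = y.
Proof. by apply/rowP => i; rewrite mxE. Qed.

Lemma pathptm y z : pathpt y z m = z.
Proof. by apply/rowP => i; rewrite mxE ltn_ord. Qed.

Lemma pathptS y z (k : 'I_m) :
  pathpt y z k.+1 = (z 0 k - y 0 k) *: eb k + pathpt y z k.
Proof.
apply/rowP => i; rewrite !mxE eqxx /= ltnS leq_eqVlt.
case: (ltngtP i k) => [ik|ik|/val_inj ->]; rewrite ?eqxx ?mulr1 ?subrK //=.
  by rewrite (_ : (i == k) = false) ?mulr0 ?add0r //; apply/eqP => e; rewrite e ltnn in ik.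
by rewrite (_ : (i == k) = false) ?mulr0 ?add0r //; apply/eqP => e; rewrite e ltnn in ik.
Qed.

Lemma rV_ballP (x y : V) (d : R) : 0 < d ->
  ball x d y <-> forall i, `|x 0 i - y 0 i| < d.
Proof.
move=> d0; split=> [[_ H] i|H]; first exact: H.
by split=> // i j; rewrite ord1; exact: H.
Qed.

Lemma mx_norm_le (p q : nat) (M : 'M[R]_(p, q)) (e : R) : 0 <= e ->
  (forall i j, `|M i j| <= e) -> `|M| <= e.
Proof.
move=> e0 H; rewrite [leLHS]/Num.Def.normr/= mx_normrE.
by apply: bigmax_le => // -[i j] _; exact: H.
Qed.

Lemma mx_norm_coord (p q : nat) (M : 'M[R]_(p, q)) i j : `|M i j| <= `|M|.
Proof.
rewrite [leRHS]/Num.Def.normr/= mx_normrE.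
exact: (le_bigmax _ (fun ij : 'I_p * 'I_q => `|M ij.1 ij.2|) (i, j)).
Qed.

Lemma convex_ball1 (x y z d t : R) : 0 <= t <= 1 ->
  `|x - y| < d -> `|x - z| < d -> `|x - (t * (z - y) + y)| < d.
Proof.
move=> /andP[t0 t1] yd zd.
have -> : x - (t * (z - y) + y) = (1 - t) * (x - y) + t * (x - z) by ring.
apply: le_lt_trans (ler_normD _ _) _; rewrite !normrM.
rewrite (ger0_norm t0) (@ger0_norm _ (1 - t)) ?subr_ge0 //.
(* Strictness comes from the term with factor t, so t = 0, where the point is y itself, is treated
   apart. *)
have [-> |tn0] := eqVneq t 0; first by rewrite subr0 mul1r mul0r addr0.
have tp : 0 < t by rewrite lt_def tn0.
apply: (@le_lt_trans _ _ ((1 - t) * d + t * `|x - z|)).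
  by rewrite lerD2r; apply: ler_wpM2l; rewrite ?subr_ge0 // ltW.
by rewrite -ltrBrDl -[X in _ < X - _]mul1r -mulrBl opprB addrCA subrr addr0 ltr_pM2l.
Qed.

(** The increment telescopes along the staircase; on each edge the mean value theorem gives a
    partial derivative at a point of the ball, close to its value at x by continuity. *)
Lemma C1_strict_real (f : V -> R) (O : set V) x : open O -> O x -> Ck 1 O f ->
  strict_diff f x (fun v => \sum_i v 0 i *: 'D_(eb i) f x).
Proof.
move=> oO Ox [fc fd] e e0.
(* The error is shared among m edges; [m.+1] keeps [e'] positive when m = 0. *)
pose e' := e / m.+1%:R.
have e'0 : 0 < e' by rewrite divr_gt0.
have : \forall y \near x, O y /\ forall i, `|'D_(eb i) f x - 'D_(eb i) f y| <= e'.
  near=> y; split; first by near: y; exact: open_nbhs_nbhs.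
  near: y; apply: filter_forall => i.
  have [_ [/(_ x Ox) + _]] := fd (eb i).
  by move=> /cvgrPdist_le /(_ e' e'0).
move=> /nbhs_ballP [d /= d0 H]; exists d => // y z yd zd.
have step (k : 'I_m) : `|f (pathpt y z k.+1) - f (pathpt y z k) -
    (z - y) 0 k *: 'D_(eb k) f x| <= e' * `|z - y|.
  rewrite pathptS; set s := z 0 k - y 0 k; set p := pathpt y z k.
  have inb (t : R) : 0 <= t <= 1 -> ball x d (t *: (s *: eb k) + p).
    move=> t01; apply/rV_ballP => // i; rewrite !mxE eqxx /=.
    have yi := (rV_ballP _ _ d0).1 yd i; have zi := (rV_ballP _ _ d0).1 zd i.
    have [E|ik] := eqVneq i k.
      rewrite /s -E ltnn mulr1. exact: convex_ball1.
    by rewrite !mulr0 add0r; case: ifP.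
  have [t /= t01|t t01 ->] := @mvt_line _ _ f p (s *: eb k).
    by have [Oq _] := H _ (inb t t01); have [+ _] := fd (s *: eb k); exact.
  have [Oq Hq] := H _ (inb t t01).
  rewrite deriveZdir; last by have [+ _] := fd (eb k); exact.
  rewrite (_ : (z - y) 0 k = s) ?mxE // -scalerBr normrM mulrC.
  apply: ler_pM => //; first by rewrite distrC.
  by apply: le_trans (mx_norm_coord (z - y) 0 k); rewrite !mxE.
have -> : f z - f y = \sum_(k < m) (f (pathpt y z k.+1) - f (pathpt y z k)).
  rewrite -[RHS](@big_mkord _ _ _ m xpredT
    (fun k => f (pathpt y z k.+1) - f (pathpt y z k))).
  by rewrite (telescope_sumr (fun k => f (pathpt y z k))) // pathptm pathpt0.
rewrite -sumrB; apply: le_trans (ler_norm_sum _ _ _) _.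
apply: le_trans (ler_sum _ (fun k _ => step k)) _.
rewrite sumr_const card_ord -mulr_natr mulrAC.
apply: ler_wpM2r => //.
by rewrite /e' mulrAC ler_pdivrMr // ler_pM2l // ler_nat.
Unshelve. all: by end_near. Qed.

Lemma C1_strict_mx (p q : nat) (f : V -> 'M[R]_(p, q)) (O : set V) x :
  open O -> O x -> Ck 1 O f ->
  strict_diff f x (fun v => \sum_i v 0 i *: 'D_(eb i) f x).
Proof.
move=> oO Ox cf e e0.
have cfij i j := (Ck_mxP 1 f oO).1 cf i j.
have H i j := C1_strict_real oO Ox (cfij i j) e0.
(* Phrasing the estimate for all small positive radii lets the filter produce one radius common to
   the finitely many entries. *)
have : \forall d \near 0^'+, forall i j, forall y z, ball x d y -> ball x d z ->
    `|f z i j - f y i j - \sum_k (z - y) 0 k *: 'D_(eb k) (fun y => f y i j) x|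
    <= e * `|z - y|.
  apply: filter_forall => i; apply: filter_forall => j.
  have [d d0 Hd] := H i j.
  near=> d' => y z yd zd; apply: Hd; [apply: le_ball yd|apply: le_ball zd];
    by near: d'; exact: nbhs_right_le.
move=> Hn; have [d [d0 Hd]] : exists d : R, 0 < d /\
    forall i j, forall y z, ball x d y -> ball x d z ->
    `|f z i j - f y i j - \sum_k (z - y) 0 k *: 'D_(eb k) (fun y => f y i j) x|
    <= e * `|z - y|.
  near (0 : R)^'+ => d; exists d; split; first by near: d; exact: nbhs_right_gt.
  by near: d.
exists d => // y z yd zd; apply: mx_norm_le => [|i j].
  by rewrite mulr_ge0 // ltW.
rewrite !mxE summxE.
apply: le_trans (Hd i j y z yd zd); rewrite le_eqVlt; apply/orP; left.
apply/eqP; congr (`|_ - _|); apply: eq_bigr => k _.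
rewrite !mxE; congr (_ * _); rewrite derive_mx ?mxE //.
by have [_ /(_ (eb k))[+ _]] := cf; exact.
Unshelve. all: by end_near. Qed.

Lemma linear_rV_sum (F : normedModType R) (L : V -> F) : linear L ->
  L = (fun v => \sum_i v 0 i *: L (eb i)).
Proof.
move=> Llin.
pose LL : {linear V -> F} := HB.pack L (GRing.isLinear.Build _ _ _ _ _ Llin).
apply/funext => v; rewrite [v in LHS]row_sum_delta -[L]/(LL : V -> F).
by rewrite linear_sum; apply: eq_bigr => i _; rewrite linearZ.
Qed.

Lemma continuous_linear_rV (F : normedModType R) (L : V -> F) : linear L ->
  continuous L.
Proof.
move=> Llin; rewrite (linear_rV_sum Llin) => x.
have [+ _] : Ck 0 setT (fun v : V => \sum_i v 0 i *: L (eb i)).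
  apply: Ck_sum => [|i]; first exact: openT.
  apply: Ck_scale; [exact: openT|split=> // y _; exact: coord_continuous|].
  exact: Ck_cst.
exact.
Qed.

Lemma sum_scale_linear (F : normedModType R) (w : 'I_m -> F) :
  linear (fun v : V => \sum_i v 0 i *: w i).
Proof.
move=> a u v; rewrite scaler_sumr -big_split; apply: eq_bigr => i _ /=.
by rewrite !mxE scalerDl scalerA.
Qed.

Lemma differentiable_rV (F : normedModType R) (f : V -> F) x (L : V -> F) :
  linear L ->
  (forall e : R, 0 < e -> exists2 d : R, 0 < d &
     forall z, ball x d z -> `|f z - f x - L (z - x)| <= e * `|z - x|) ->
  differentiable f x /\ 'd f x = L :> (V -> F).
Proof.
move=> Llin sd.
pose LL : {linear V -> F} := HB.pack L (GRing.isLinear.Build _ _ _ _ _ Llin).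
have cL : continuous LL by exact: continuous_linear_rV.
have H : f \o shift x = cst (f x) + LL +o_ (0 : V) id.
  apply/eqaddoP => e e0; have [d d0 Hd] := sd e e0.
  have nb : \forall v \near (0 : V), `|v| < d.
    by apply/nbhs_normP; exists d => //= w; rewrite /= sub0r normrN.
  near=> v; rewrite /= -![(_ + _ : _ -> _) _]/(_ + _) -![(- _ : _ -> _) _]/(- _).
  rewrite /= opprD addrA.
  have -> : f (v + x) - cst (f x) v - LL v = f (v + x) - f x - L (v + x - x).
    by rewrite addrK.
  apply: le_trans (Hd _ _) _.
    rewrite -ball_normE /= opprD addrCA subrr addr0 normrN.
    by near: v.
  by rewrite addrK.
have dE := diff_unique cL H.
split=> //; apply/diff_locallyP; rewrite dE; split=> //.
Unshelve. all: by end_near. Qed.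

Lemma strict_diff_differentiable (F : normedModType R) (f : V -> F) x
    (L : V -> F) : linear L -> strict_diff f x L ->
  differentiable f x /\ 'd f x = L :> (V -> F).
Proof.
move=> Llin sd; apply: differentiable_rV => // e e0.
have [d d0 Hd] := sd e e0; exists d => // z zd.
by apply: Hd => //; exact: ballxx.
Qed.

Lemma C1_differentiable_real (f : V -> R) (O : set V) x :
  open O -> O x -> Ck 1 O f -> differentiable f x.
Proof.
move=> oO Ox /(C1_strict_real oO Ox).
by move=> /(strict_diff_differentiable (sum_scale_linear _))[].
Qed.

Lemma C1_differentiable_mx (p q : nat) (f : V -> 'M[R]_(p, q)) (O : set V) x :
  open O -> O x -> Ck 1 O f -> differentiable f x.
Proof.
move=> oO Ox /(C1_strict_mx oO Ox).
by move=> /(strict_diff_differentiable (sum_scale_linear _))[].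
Qed.

Lemma derive_rV_sum (F : normedModType R) (f : V -> F) x v :
  differentiable f x -> 'D_v f x = \sum_i v 0 i *: 'D_(eb i) f x.
Proof.
move=> df; rewrite deriveE // (linear_rV_sum (L := 'd f x)) /=; last exact: linearP.
by apply: eq_bigr => i _; rewrite deriveE.
Qed.

End strict.

Section comp.
Variables (R : realType) (E : normedModType R) (m : nat) (F : normedModType R).

(** Only the outer map has to be differentiable: restricted to the line through x, the inner one is
    a differentiable curve. *)
Lemma derive_line_comp (f : E -> 'rV[R]_m) (g : 'rV[R]_m -> F) x v :
  derivable f x v -> differentiable g (f x) ->
  is_derive x v (g \o f) ('D_('D_v f x) g (f x)).
Proof.
move=> df dg.
pose f' (s : R) := f (s *: v + x).
have f'0 : f' 0 = f x by rewrite /f' scale0r add0r.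
have df' : differentiable f' 0.
  by apply/derivable1_diffP/derivable_line; rewrite scale0r add0r.
have dg' : differentiable g (f' 0) by rewrite f'0.
have dgf : differentiable (g \o f') 0 by exact: differentiable_comp.
split.
  have /derivable1_diffP := dgf.
  by rewrite /derivable (line_quotient (g \o f)) scale0r add0r.
have -> : 'D_v (g \o f) x = 'D_1 (g \o f') 0.
  by rewrite (derive_line (g \o f)) scale0r add0r.
rewrite deriveE // diff_comp //= f'0 deriveE //; congr ('d g (f x) _).
by rewrite -deriveE // derive_line scale0r add0r.
Qed.

Definition C1diff := forall (g : 'rV[R]_m -> F) O x, open O -> O x ->
  Ck 1 O g -> differentiable g x.

(** Induction on k: the derivative of the composite along v is the sum of the coordinates of the
    derivative of f times the partial derivatives of g taken at f, and each factor is of class one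
    less. *)
Lemma Ck_comp k (O : set E) (O' : set 'rV[R]_m) (f : E -> 'rV[R]_m)
    (g : 'rV[R]_m -> F) : C1diff -> open O -> open O' ->
  (forall x, O x -> O' (f x)) -> Ck k O f -> Ck k O' g -> Ck k O (g \o f).
Proof.
move=> C1 oO oO' fO; elim: k g => [|k IH] g Hf Hg.
  split=> // x Ox; apply: continuous_comp; first by have [+ _] := Hf; exact.
  by have [+ _] := Hg; apply; exact: fO.
have Hg1 : Ck 1 O' g by exact: Ck_le Hg.
have dg y : O' y -> differentiable g y by move=> O'y; exact: C1 Hg1.
split=> [x Ox|v].
  apply: continuous_comp; first by have [+ _] := Hf; exact.
  by have [+ _] := Hg; apply; exact: fO.
have [_ /(_ v)[fv cfv]] := Hf.
have D x (Ox : O x) := derive_line_comp (fv x Ox) (dg _ (fO _ Ox)).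
split=> [x /D[] //|].
apply: (@Ck_ext _ _ _ _ _ (fun x => \sum_i ('D_v f x) 0 i *:
   'D_(delta_mx 0 i) g (f x))) => //.
  by move=> x Ox; have [_ ->] := D x Ox; rewrite [RHS]derive_rV_sum //; exact: dg (fO _ Ox).
apply: Ck_sum => // i; apply: Ck_scale => //.
  by have /(Ck_mxP k _ oO) := cfv; apply.
by apply: (IH ('D_(delta_mx 0 i) g));
  [exact: CkW Hf|have [_ /(_ (delta_mx 0 i))[_]] := Hg].
Qed.

End comp.

Lemma C1diff_real (R : realType) m : C1diff m R.
Proof. by move=> g O x; exact: C1_differentiable_real. Qed.

Lemma C1diff_mx (R : realType) m p q : C1diff m 'M[R]_(p, q).
Proof. by move=> g O x; exact: C1_differentiable_mx. Qed.

(** Precomposition with an affine map leaves the difference quotients literally the same, so no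
    chain rule is involved and E' and F may be arbitrary normed spaces. *)
Lemma Ck_affine_pre (R : realType) (E E' F : normedModType R) k (O : set E')
    (l : {linear E -> E'}) (a : E') (f : E' -> F) :
  continuous l -> Ck k O f ->
  Ck k [set x | O (l x + a)] (fun x => f (l x + a)).
Proof.
move=> cl; have cla x : {for x, continuous (fun x => l x + a)}.
  by apply: (@continuousD _ _ _ l (cst a)); [exact: cl|exact: cst_continuous].
elim: k f => [|k IH] f [fc fd].
  split=> // x Ox; apply: (@continuous_comp _ _ _ (fun x => l x + a) f) => //.
  exact: fc.
split=> [x Ox|v].
  by apply: (@continuous_comp _ _ _ (fun x => l x + a) f) => //; exact: fc.
have Q x : (fun h : R => h^-1 *: (((fun x => f (l x + a)) \o shift x) (h *: v)
     - f (l x + a))) =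
   (fun h => h^-1 *: ((f \o shift (l x + a)) (h *: l v) - f (l x + a))).
  by apply/funext => h /=; rewrite linearP addrA.
have [fv cfv] := fd (l v); split.
  by move=> x /fv; rewrite /derivable Q.
have -> : (fun x => 'D_v (fun x0 => f (l x0 + a)) x) =
   (fun x => 'D_(l v) f (l x + a)).
  by apply/funext => x; rewrite /derive Q.
exact: (IH ('D_(l v) f)).
Qed.

Lemma near_openP (T : topologicalType) (x : T) (P : T -> Prop) :
  (\forall y \near x, P y) -> exists O, [/\ open O, O x & forall y, O y -> P y].
Proof. by rewrite /prop_near1 nbhsE => -[ O [oO Ox] H]; exists O. Qed.

(* Differentiability of C^1 maps is only available for real- and matrix-valued
   ones, where it is proved coordinatewise by the mean value theorem. *)
Class C1space (R : realType) (F : normedModType R) : Prop :=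
  c1space : forall m, C1diff m F.

#[global] Instance C1space_real (R : realType) : C1space R.
Proof. by move=> m; exact: C1diff_real. Qed.

#[global] Instance C1space_mx (R : realType) p q : C1space 'M[R]_(p, q).
Proof. by move=> m; exact: C1diff_mx. Qed.

(** Smoothness of the germ: the open set is hidden, so that it can shrink freely when functions are
    combined or changed away from x. *)
Definition smooth_at (R : realType) (E F : normedModType R) (f : E -> F) x :=
  exists O, [/\ open O, O x & smooth_on O f].

Section smooth_at.
Variables (R : realType) (E F : normedModType R).
Implicit Types (f g : E -> F) (x : E) (O : set E).

Lemma smooth_atW O f x : open O -> O x -> smooth_on O f -> smooth_at f x.
Proof. by move=> oO Ox Of; exists O. Qed.

Lemma smooth_on_at O f : (forall x, O x -> smooth_at f x) -> smooth_on O f.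
Proof.
move=> H k; apply/CkP => x /H[ O' [_ O'x /(_ k)]]; apply: Ck_sub.
by move=> y ->.
Qed.

Lemma smooth_at_nbhs f x : smooth_at f x -> \forall y \near x, smooth_at f y.
Proof.
move=> [ O [oO Ox Of]]; near=> y; exists O; split=> //.
by near: y; exact: open_nbhs_nbhs.
Unshelve. all: by end_near. Qed.

Lemma smooth_at_near f g x : (\near x, f x = g x) -> smooth_at f x ->
  smooth_at g x.
Proof.
move=> fg [ O [oO Ox Of]].
have : \forall y \near x, O y /\ f y = g y.
  near=> y; split; first by near: y; exact: open_nbhs_nbhs.
  by near: y.
move=> /near_openP -[ O' [oO' O'x H]].
exists O'; split=> // k; apply: (@Ck_ext _ _ _ _ _ f) => //.
  by move=> y /H[].
by apply: Ck_sub (Of k) => y /H[].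
Unshelve. all: by end_near. Qed.

Lemma smooth_at_continuous f x : smooth_at f x -> {for x, continuous f}.
Proof. by move=> [ O [oO Ox /(_ 0%N)[+ _]]]; apply. Qed.

Lemma smooth_at_derivable f x v : smooth_at f x -> derivable f x v.
Proof. by move=> [ O [oO Ox /(_ 1%N)[_ /(_ v)[+ _]]]]; apply. Qed.

Lemma smooth_at_derive f x v : smooth_at f x -> smooth_at ('D_v f) x.
Proof.
by move=> [ O [oO Ox Of]]; exists O; split=> // k; have [_ /(_ v)[]] := Of k.+1.
Qed.

Lemma smooth_at_cst (c : F) x : smooth_at (fun=> c) x.
Proof. by exists setT; split=> // [|k]; [exact: openT|exact: Ck_cst]. Qed.

Lemma smooth_at_add f g x : smooth_at f x -> smooth_at g x ->
  smooth_at (fun y => f y + g y) x.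
Proof.
move=> [ O [oO Ox Of]] [ O' [oO' O'x O'g]]; exists (O `&` O'); split=> //.
  exact: openI.
have oI : open (O `&` O') by exact: openI.
move=> k; apply: Ck_add => //.
  by apply: Ck_sub (Of k) => y [].
by apply: Ck_sub (O'g k) => y [].
Qed.

Lemma smooth_at_scale (h : E -> R) f x : smooth_at h x -> smooth_at f x ->
  smooth_at (fun y => h y *: f y) x.
Proof.
move=> [ O [oO Ox Of]] [ O' [oO' O'x O'g]]; exists (O `&` O'); split=> //.
  exact: openI.
have oI : open (O `&` O') by exact: openI.
move=> k; apply: Ck_scale => //.
  by apply: Ck_sub (Of k) => y [].
by apply: Ck_sub (O'g k) => y [].
Qed.

Lemma smooth_at_sum (I : Type) (r : seq I) (f : I -> E -> F) x :
  (forall i, smooth_at (f i) x) ->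
  smooth_at (fun y => \sum_(i <- r) f i y) x.
Proof.
move=> H; elim: r => [|i r IH].
  rewrite (_ : (fun _ => _) = fun=> 0); first exact: smooth_at_cst.
  by apply/funext => y; rewrite big_nil.
rewrite (_ : (fun _ => _) = fun y => f i y + \sum_(j <- r) f j y).
  exact: smooth_at_add.
by apply/funext => y; rewrite big_cons.
Qed.

Lemma smooth_at_linear (l : {linear E -> F}) x : continuous l -> smooth_at l x.
Proof.
move=> cl; exists setT; split=> //; first exact: openT.
move=> [|k]; first by split=> // y _; exact: cl.
split=> [y _|v]; first exact: cl.
have dl y : differentiable l y by exact: linear_differentiable.
split=> [y _|]; first exact: diff_derivable.
have -> : (fun y => 'D_v l y) = fun=> l v.
  by apply/funext => y; rewrite deriveE // diff_lin.
exact: Ck_cst.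
Qed.

End smooth_at.

Section smooth_at_more.
Variables (R : realType) (E : normedModType R).

Lemma smooth_at_id (x : E) : smooth_at id x.
Proof. by apply: (@smooth_at_linear _ _ _ idfun) => y; exact: cvg_id. Qed.

Lemma smooth_at_mul (f g : E -> R) x : smooth_at f x -> smooth_at g x ->
  smooth_at (fun y => f y * g y) x.
Proof. exact: smooth_at_scale. Qed.

Lemma smooth_at_mxP p q (f : E -> 'M[R]_(p, q)) x :
  smooth_at f x <-> forall i j, smooth_at (fun y => f y i j) x.
Proof.
split=> [[ O [oO Ox Of]] i j|H].
  by exists O; split=> // k; have /(Ck_mxP k _ oO) := Of k; apply.
have : \forall y \near x, forall i j, smooth_at (fun y => f y i j) y.
  apply: filter_forall => i; apply: filter_forall => j.
  exact: smooth_at_nbhs.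
move=> /near_openP -[ O [oO Ox HO]]; exists O; split=> // k.
apply/(Ck_mxP k _ oO) => i j.
by move: k; apply: smooth_on_at => y Oy; exact: HO.
Qed.

Lemma smooth_at_mulmx p q r (f : E -> 'M[R]_(p, q)) (g : E -> 'M[R]_(q, r)) x :
  smooth_at f x -> smooth_at g x -> smooth_at (fun y => f y *m g y) x.
Proof.
move=> /smooth_at_mxP Hf /smooth_at_mxP Hg; apply/smooth_at_mxP => i j.
rewrite (_ : (fun _ => _) = fun y => \sum_k f y i k * g y k j); last first.
  by apply/funext => y; rewrite mxE.
by apply: smooth_at_sum => k; apply: smooth_at_mul.
Qed.

Lemma smooth_at_affine (E' F : normedModType R) (l : {linear E -> E'}) a
    (f : E' -> F) x : continuous l -> smooth_at f (l x + a) ->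
  smooth_at (fun y => f (l y + a)) x.
Proof.
move=> cl [ O [oO Ox Of]]; exists [set y | O (l y + a)]; split=> //.
  apply: (@open_comp _ _ (fun y => l y + a)) => // y _.
  by apply: (@continuousD _ _ _ l (cst a)); [exact: cl|exact: cst_continuous].
by move=> k; exact: Ck_affine_pre.
Qed.

Lemma smooth_at_comp m (F : normedModType R) `{C1 : C1space R F}
  (f : E -> 'rV[R]_m) (g : 'rV[R]_m -> F) x : smooth_at f x -> smooth_at g (f x) ->
  smooth_at (g \o f) x.
Proof.
move=> sf [ O' [oO' O'fx Og]].
have : \forall y \near x, smooth_at f y /\ O' (f y).
  near=> y; split; first by near: y; exact: smooth_at_nbhs.
  near: y; apply: (smooth_at_continuous sf); exact: open_nbhs_nbhs.
move=> /near_openP -[ O [oO Ox HO]]; exists O; split=> // k.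
apply: (@Ck_comp _ _ _ _ _ O O') => //; first by move=> y /HO[].
by move: k; apply: smooth_on_at => y /HO[].
Unshelve. all: by end_near. Qed.

End smooth_at_more.

Section smooth_at_rV.
Variable R : realType.

Lemma smooth_at_differentiable m (F : normedModType R) `{C1 : C1space R F}
  (g : 'rV[R]_m -> F) x : smooth_at g x -> differentiable g x.
Proof. by move=> [ O [oO Ox Og]]; exact: C1 (Og 1%N). Qed.

Lemma smooth_at_differentiable1 (F : normedModType R) (g : R -> F) x :
  smooth_at g x -> differentiable g x.
Proof. by move=> sg; apply/derivable1_diffP; exact: smooth_at_derivable. Qed.

(** Since the direction varies with the point, the derivative is expanded in coordinates, with
    smooth coefficients and fixed directions. *)
Lemma smooth_at_derive_var m (F : normedModType R) `{C1 : C1space R F}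
  (g : 'rV[R]_m -> F) (X : 'rV[R]_m -> 'rV[R]_m) x :
  smooth_at g x -> smooth_at X x -> smooth_at (fun t => 'D_(X t) g t) x.
Proof.
move=> sg sX.
apply: (@smooth_at_near _ _ _ (fun t => \sum_i X t 0 i *: 'D_(delta_mx 0 i) g t)).
  have := smooth_at_nbhs sg; apply: filterS => t /smooth_at_differentiable dg.
  by rewrite [RHS]derive_rV_sum.
apply: smooth_at_sum => i; apply: smooth_at_scale; last exact: smooth_at_derive.
by move: sX => /smooth_at_mxP; apply.
Qed.

End smooth_at_rV.

(** * Smoothness of sine and cosine *)

Section trig.
Variable R : realType.

Lemma derive_cosE (v x : R) : derivable (@cos R) x v /\ 'D_v (@cos R) x = - v * sin x.
Proof.
have d : differentiable (@cos R) x by apply/derivable1_diffP.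
split; first exact: diff_derivable.
rewrite -[v in LHS]mulr1 -[v * 1]/(v *: 1) deriveZdir; last exact: diff_derivable.
by rewrite derive_val /GRing.scale /= mulrN mulNr.
Qed.

Lemma derive_sinE (v x : R) : derivable (@sin R) x v /\ 'D_v (@sin R) x = v * cos x.
Proof.
have d : differentiable (@sin R) x by apply/derivable1_diffP.
split; first exact: diff_derivable.
rewrite -[v in LHS]mulr1 -[v * 1]/(v *: 1) deriveZdir; last exact: diff_derivable.
by rewrite derive_val.
Qed.

(** The two are treated at once because each one's derivative is a multiple of the other. *)
Lemma Ck_cos_sin k : Ck k setT (@cos R) /\ Ck k setT (@sin R).
Proof.
elim: k => [|k [IHc IHs]].
  by split; split=> // x _; [exact: continuous_cos|exact: continuous_sin].
split; (split=> [x _|v]).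
- exact: continuous_cos.
- split=> [x _|]; first by have [] := derive_cosE v x.
  have -> : (fun x => 'D_v (@cos R) x) = fun x => - v * sin x.
    by apply/funext => x; have [] := derive_cosE v x.
  by apply: Ck_mul; [exact: openT|exact: Ck_cst|].
- exact: continuous_sin.
- split=> [x _|]; first by have [] := derive_sinE v x.
  have -> : (fun x => 'D_v (@sin R) x) = fun x => v * cos x.
    by apply/funext => x; have [] := derive_sinE v x.
  by apply: Ck_mul; [exact: openT|exact: Ck_cst|].
Qed.

Lemma smooth_at_cos (x : R) : smooth_at (@cos R) x.
Proof. by exists setT; split=> // [|k]; [exact: openT|have [] := Ck_cos_sin k]. Qed.

Lemma smooth_at_sin (x : R) : smooth_at (@sin R) x.
Proof. by exists setT; split=> // [|k]; [exact: openT|have [] := Ck_cos_sin k]. Qed.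

End trig.

(** Joins completeness to the normed module structure of matrices, as Banach's theorem asks. *)
HB.instance Definition _ (R : realType) (m n : nat) :=
  Complete.on 'M[R]_(m, n).

(** * Differentiable right inverses of submersions between coordinate spaces *)

Section right_inverse.
Variables (R : realType) (m k : nat).

Lemma contraction_closed_ball (T : 'rV[R]_k -> 'rV[R]_k) (r : R) : 0 <= r ->
  (forall z, `|z| <= r -> `|T z| <= r) ->
  (forall y z, `|y| <= r -> `|z| <= r -> `|T z - T y| <= 2^-1 * `|z - y|) ->
  exists2 z, `|z| <= r & T z = z.
Proof.
move=> r0 Tr Tc.
pose U := [set z : 'rV[R]_k | `|z| <= r].
have TU : {homo T : x / U x >-> U x} by move=> z; exact: Tr.
have U0 : U !=set0 by exists 0; rewrite /U /= normr0.
have cU : closed U.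
  have -> : U = closed_ball_ (fun x : 'rV[R]_k => `|x|) 0 r.
    by apply/seteqP; split=> z; rewrite /U /closed_ball_ /= sub0r normrN.
  exact: closed_closed_ball_.
have [] := @banach_fixed_point R 'rV[R]_k U [fun of mkfun TU] _ cU U0.
  have h0 : 0 <= 2^-1 :> R by rewrite invr_ge0.
  exists (NngNum h0); split=> /=; first by rewrite invf_lt1 // ltr1n.
  by move=> [y z] [/= yU zU]; exact: Tc.
by move=> z zU zE; exists z.
Qed.

(** Let A be a linear right inverse of the differential at p and h(z) = f(A z + p). By strict
    differentiability h differs from the identity by a map of small Lipschitz constant, so z - (h(z)
    - y) is a contraction, whose fixed point solves h(z) = y. *)
Lemma right_inverse_differentiable (f : 'rV[R]_m -> 'rV[R]_k) p :
  smooth_at f p -> (forall w, exists v, 'D_v f p = w) ->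
  exists g : 'rV[R]_k -> 'rV[R]_m,
    [/\ g (f p) = p, differentiable g (f p) & \forall y \near f p, f (g y) = y].
Proof.
move=> sf surj; have df : differentiable f p by exact: smooth_at_differentiable.
have [a aE] := choice (fun i : 'I_k => surj (delta_mx 0 i)).
pose A (z : 'rV[R]_k) : 'rV[R]_m := \sum_i z 0 i *: a i.
have Alin : linear A by exact: sum_scale_linear.
pose AA : {linear 'rV[R]_k -> 'rV[R]_m} :=
  HB.pack A (GRing.isLinear.Build _ _ _ _ _ Alin).
have cA : continuous AA by exact: continuous_linear_rV.
pose L (v : 'rV[R]_m) := \sum_i v 0 i *: 'D_(delta_mx 0 i) f p.
have LA z : L (A z) = z.
  have -> : L (A z) = 'D_(A z) f p by rewrite [RHS]derive_rV_sum.
  rewrite deriveE // /A linear_sum.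
  rewrite [RHS]row_sum_delta; apply: eq_bigr => i _.
  by rewrite linearZ /= -deriveE // aE.
have [ O [oO Op Of]] := sf.
have sd := C1_strict_mx oO Op (Of 1%N).
have [K K0 AK] := linear_lipschitz cA.
pose h z := f (A z + p).
have h0 : h 0 = f p by rewrite /h -[A]/(AA : _ -> _) linear0 add0r.
have hs (e : R) : 0 < e -> exists2 d : R, 0 < d & forall y z, `|y| < d -> `|z| < d ->
    `|h z - h y - (z - y)| <= e * `|z - y|.
  move=> e0; have [d d0 Hd] := sd (e / K) (divr_gt0 e0 K0).
  exists (d / K) => [|y z yd zd]; first exact: divr_gt0.
  have inb w : `|w| < d / K -> ball p d (A w + p).
    rewrite -ball_normE /= opprD addrCA subrr addr0 normrN ltr_pdivlMr // mulrC.
    exact: le_lt_trans (AK w).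
  have := Hd _ _ (inb _ yd) (inb _ zd).
  have -> : A z + p - (A y + p) = A (z - y).
    by rewrite opprD addrACA subrr addr0 -[A]/(AA : _ -> _) linearB.
  rewrite -/(L _) LA => /le_trans; apply.
  by rewrite mulrAC ler_pdivrMr // -mulrA ler_pM2l // mulrC; exact: AK.
have h2 : 0 < 2^-1 :> R by rewrite invr_gt0.
have [d d0 Hd] := hs _ h2.
pose r := d / 2.
have r0 : 0 < r by rewrite divr_gt0.
have rd (z : 'rV[R]_k) : `|z| <= r -> `|z| < d.
  by move=> /le_lt_trans; apply; rewrite /r ltr_pdivrMr // ltr_pMr // ltr1n.
(* The existential stands outside the implication so that choice yields a total function; far from
   [f p] its value is an irrelevant 0. *)
have fix_ y : exists z, `|y - f p| <= r / 2 -> `|z| <= r /\ h z = y.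
  have [yr|_] := boolP (`|y - f p| <= r / 2); last by exists 0.
  have [||z zr zE] := @contraction_closed_ball (fun z => z - (h z - y)) r (ltW r0).
  - move=> z zr.
    have -> : z - (h z - y) = - (h z - h 0 - (z - 0)) + (y - f p).
      by rewrite h0; apply/rowP => i; rewrite !mxE; ring.
    apply: le_trans (ler_normD _ _) _; rewrite normrN.
    have := Hd 0 z; rewrite normr0 => /(_ d0 (rd _ zr)) H1.
    have : 2^-1 * `|z - 0| <= r / 2 by rewrite subr0 mulrC ler_pM2r.
    by move: H1 yr; lra.
  - move=> y1 z y1r zr.
    have -> : z - (h z - y) - (y1 - (h y1 - y)) = - (h z - h y1 - (z - y1)).
      by apply/rowP => i; rewrite !mxE; ring.
    by rewrite normrN; apply: Hd; exact: rd.
  exists z => _; split=> //.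
  by move/eqP: zE; rewrite eq_sym -subr_eq0 opprB addrCA subrr addr0 subr_eq0 => /eqP.
have [zeta zetaP] := choice fix_.
have z0 : zeta (f p) = 0.
  have [|zr zE] := zetaP (f p); first by rewrite subrr normr0 divr_ge0 // ltW.
  have := Hd 0 (zeta _); rewrite normr0 => /(_ _ d0 (rd _ zr)).
  rewrite zE h0 subrr sub0r normrN !subr0 => H.
  by apply/eqP; rewrite -normr_le0; move: H; lra.
have dz : differentiable zeta (f p).
  have [//||+ _] := @differentiable_rV _ _ _ zeta (f p) id; last by [].
  move=> e e0; have e20 : 0 < e / 2 by rewrite divr_gt0.
  have [d' d'0 Hd'] := hs _ e20.
  (* The first bound puts y in the range where the fixed point exists; the second, with |zeta y| <=
     2 |y - f p|, puts [zeta y] within [d']. The same factor 2 explains [e / 2]. *)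
  exists (Num.min (r / 2) (d' / 2)).
    by rewrite lt_min !divr_gt0.
  move=> y; rewrite -ball_normE /= distrC lt_min => /andP[yr yd'].
  have [zr zE] := zetaP _ (ltW yr).
  have H1 : `|y - f p - zeta y| <= 2^-1 * `|zeta y|.
    have := Hd 0 (zeta _); rewrite normr0 => /(_ _ d0 (rd _ zr)).
    by rewrite zE h0 !subr0.
  have H2 : `|zeta y| <= 2 * `|y - f p|.
    have : `|zeta y| <= `|y - f p - zeta y| + `|y - f p|.
      rewrite -[X in X <= _](normrN) -{1}[- zeta y](addKr (y - f p)) addrC.
      exact: le_trans (ler_normB _ _) _.
    by move: H1; lra.
  have zd' : `|zeta y| < d' by apply: le_lt_trans H2 _; move: yd'; lra.
  have := Hd' 0 (zeta y); rewrite normr0 => /(_ d'0 zd').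
  rewrite zE h0 !subr0 z0 subr0 distrC => /le_trans; apply.
  by rewrite -mulrA ler_pM2l //; move: H2; lra.
exists (fun y => A (zeta y) + p); split.
- by rewrite z0 -[A]/(AA : _ -> _) linear0 add0r.
- apply: (@differentiableD _ _ _ (AA \o zeta) (cst p)) => //.
  by apply: differentiable_comp => //; exact: linear_differentiable.
- near=> y; have [|_ //] := zetaP y.
  rewrite distrC; near: y; apply/nbhs_ballP; exists (r / 2); first by rewrite /= divr_gt0.
  by move=> y; rewrite -ball_normE /= => /ltW.
Unshelve. all: by end_near. Qed.

End right_inverse.

(** * Maps between manifolds *)

Lemma differentiable_near (R : realType) (E F : normedModType R) (f g : E -> F) x :
  (\near x, f x = g x) -> differentiable f x -> differentiable g x.
Proof.
move=> fg /diff_locallyP[cf Hf]; have fgx : f x = g x by exact: nbhs_singleton fg.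
have sx : shift x @ (0 : E) --> x.
  rewrite -[X in _ --> X]add0r; apply: cvgD; [exact: cvg_id|exact: cvg_cst].
have fg0 : \forall h \near (0 : E), f (h + x) = g (h + x) by exact: sx fg.
have H : g \o shift x = cst (g x) + 'd f x +o_ (0 : E) id.
  apply/eqaddoP => e e0; have /eqaddoP /(_ e e0) := Hf.
  apply: filterS2 fg0 => h /= fgh.
  by rewrite -![(_ + _ : _ -> _) _]/(_ + _) -![(- _ : _ -> _) _]/(- _) /= fgh fgx.
by apply/diff_locallyP; rewrite (diff_unique cf H).
Qed.

Section manifold_calculus.
Variable R : realType.

(** The tangent vector of a plot in the preferred chart at its value. With E = R this is the
    velocity of a curve, and with [f \o cinv x] as plot it is the tangent map, so one chain rule
    serves all cases. *)
Definition dplot (E : normedModType R) m (M : manifold R m) (c : E -> M) t v :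
    'rV[R]_m := 'D_v (cmap (c t) \o c) t.

(** A chart has arbitrary values outside its domain, so differentiability of the coordinate
    expression means something only together with continuity of c at t, which keeps c inside the
    domain. *)
Definition pdiff (E : normedModType R) m (M : manifold R m) (c : E -> M) t :=
  {for t, continuous c} /\ differentiable (cmap (c t) \o c) t.

Definition psmooth (E : normedModType R) m (M : manifold R m) (c : E -> M) t :=
  {for t, continuous c} /\ forall x, cdom x (c t) -> smooth_at (cmap x \o c) t.

Definition mdiff m m' (M : manifold R m) (N : manifold R m') (f : M -> N) x :=
  pdiff (f \o cinv x) (cmap x x).

Definition msmooth m m' (M : manifold R m) (N : manifold R m') (f : M -> N) x :=
  psmooth (f \o cinv x) (cmap x x).

Definition fdiff m (M : manifold R m) (F : normedModType R) (f : M -> F) x :=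
  differentiable (f \o cinv x) (cmap x x).

Definition fsmooth m (M : manifold R m) (F : normedModType R) (f : M -> F) x :=
  smooth_at (f \o cinv x) (cmap x x).

Lemma cinvxx m (M : manifold R m) (x : M) : cinv x (cmap x x) = x.
Proof. by rewrite cmapK //; exact: cdom_mem. Qed.

Lemma nbhs_cdom m (M : manifold R m) (x y : M) : cdom x y ->
  \forall z \near y, cdom x z.
Proof. by move=> xy; apply: open_nbhs_nbhs; split=> //; exact: cdom_open. Qed.

Lemma open_chart m (M : manifold R m) (x : M) (U : set M) : open U ->
  open (cmap x @` (cdom x `&` U)).
Proof.
move=> oU; rewrite openE => _ [y [xy Uy] <-]; rewrite /interior /=.
have H1 : \forall t \near cmap x y, (cmap x @` cdom x) t.
  by apply: open_nbhs_nbhs; split; [exact: cimg_open|exists y].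
have H2 : \forall t \near cmap x y, U (cinv x t).
  by apply: (cinv_cont xy); rewrite cmapK //; apply: open_nbhs_nbhs.
apply: filterS2 H1 H2 => _ [z xz <-]; rewrite cmapK // => Uz.
by exists z.
Qed.

Lemma near_cinvK m (M : manifold R m) (T : topologicalType) (c : T -> M) t x :
  {for t, continuous c} -> cdom x (c t) ->
  \forall s \near t, cinv x (cmap x (c s)) = c s.
Proof.
move=> cc xc; have : \forall s \near t, cdom x (c s) by apply: cc; exact: nbhs_cdom.
by apply: filterS => s; exact: cmapK.
Qed.

Lemma smooth_transition m (M : manifold R m) (x y z : M) : cdom x z -> cdom y z ->
  smooth_at (cmap y \o cinv x) (cmap x z).
Proof.
move=> xz yz; apply: smooth_atW (transition_smooth x y).
  by apply: open_chart; exact: cdom_open.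
by exists z.
Qed.

Lemma psmooth_cinv m (M : manifold R m) (x y : M) : cdom x y ->
  psmooth (cinv x) (cmap x y).
Proof.
move=> xy; split=> [|z]; first exact: cinv_cont.
by rewrite cmapK // => zy; exact: smooth_transition.
Qed.

Section plots.
Variables (E : normedModType R) (m : nat) (M : manifold R m).
Implicit Types (c : E -> M) (t : E).

Lemma pdiff_near c c' t : (\near t, c t = c' t) -> pdiff c t ->
  pdiff c' t /\ dplot c' t = dplot c t.
Proof.
move=> cc' [ct dc]; have ctE : c t = c' t by exact: nbhs_singleton cc'.
have cc'' : \forall s \near t, (cmap (c t) \o c) s = (cmap (c t) \o c') s.
  by apply: filterS cc' => s /= ->.
split; first split; first exact: (near_eq_continuous cc' ct).
  by rewrite -ctE; exact: differentiable_near cc'' dc.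
apply/funext => v; rewrite /dplot -ctE; apply: near_eq_derive.
by apply: filterS cc'' => s ->.
Qed.

Lemma psmooth_fun (F : normedModType R) `{C1 : C1space R F} (f : M -> F) c t :
  psmooth c t -> fsmooth f (c t) -> smooth_at (f \o c) t.
Proof.
move=> [ct sc] sf; have cc := cdom_mem (c t).
apply: smooth_at_near (smooth_at_comp (sc _ cc) sf).
by have := near_cinvK ct cc; apply: filterS => s /= ->.
Qed.

Lemma psmooth_map m' (N : manifold R m') (f : M -> N) c t :
  psmooth c t -> msmooth f (c t) -> psmooth (f \o c) t.
Proof.
move=> [ct sc] [fc sf]; have cc := cdom_mem (c t).
have cK := near_cinvK ct cc.
split=> [|x xf].
  apply: near_eq_continuous (_ : {for t, continuous ((f \o cinv (c t)) \o (cmap (c t) \o c))}).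
    by apply: filterS cK => s /= ->.
  apply: continuous_comp; last exact: fc.
  exact: smooth_at_continuous (sc _ cc).
have := sf x; rewrite /= cinvxx => /(_ xf) sfx.
apply: smooth_at_near (smooth_at_comp (sc _ cc) sfx).
by apply: filterS cK => s /= ->.
Qed.

(** By continuity c stays in the chart domain near t, so [cinv \o cmap] may be inserted between f
    and c; what remains is the chain rule in coordinates. *)
Lemma pdiff_fun (F : normedModType R) (f : M -> F) c t v :
  pdiff c t -> fdiff f (c t) ->
  differentiable (f \o c) t /\ 'D_v (f \o c) t = dfun f (c t) (dplot c t v).
Proof.
move=> [ct dc] df; have cc := cdom_mem (c t).
have cK : \forall s \near t, ((f \o cinv (c t)) \o (cmap (c t) \o c)) s = (f \o c) s.
  by have := near_cinvK ct cc; apply: filterS => s /= ->.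
have dfc : differentiable ((f \o cinv (c t)) \o (cmap (c t) \o c)) t.
  exact: differentiable_comp.
split; first exact: differentiable_near dfc.
rewrite -(near_eq_derive v cK) deriveE // diff_comp //= /dfun /dplot.
by rewrite [RHS]deriveE // [in RHS]deriveE.
Qed.

Lemma pdiff_map m' (N : manifold R m') (f : M -> N) c t v :
  pdiff c t -> mdiff f (c t) ->
  pdiff (f \o c) t /\ dplot (f \o c) t v = tmap f (c t) (dplot c t v).
Proof.
move=> [ct dc] [fc]; rewrite /= cinvxx => df; have cc := cdom_mem (c t).
have cK := near_cinvK ct cc.
have [fcc Dfc] := @pdiff_fun _ (cmap (f (c t)) \o f) c t v (conj ct dc) df.
split=> //; split=> //.
apply: near_eq_continuous (_ : {for t, continuous ((f \o cinv (c t)) \o (cmap (c t) \o c))}).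
  by apply: filterS cK => s /= ->.
apply: continuous_comp; last exact: fc.
exact: differentiable_continuous.
Qed.

Lemma pdiff_reparam (E' : normedModType R) (h : E' -> E) c s v :
  pdiff c (h s) -> differentiable h s ->
  pdiff (c \o h) s /\ dplot (c \o h) s v = dplot c (h s) ('D_v h s).
Proof.
move=> [ct dc] dh.
have d2 : differentiable ((cmap (c (h s)) \o c) \o h) s by exact: differentiable_comp.
split; first split=> //.
  by apply: continuous_comp => //; exact: differentiable_continuous.
rewrite /dplot -[cmap ((c \o h) s) \o (c \o h)]/((cmap (c (h s)) \o c) \o h).
by rewrite deriveE // diff_comp //= [RHS]deriveE // deriveE.
Qed.

Lemma dplotD c t v w : pdiff c t -> dplot c t (v + w) = dplot c t v + dplot c t w.
Proof. by move=> [_ dc]; rewrite /dplot !deriveE // linearD. Qed.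

Lemma dplotZ c t (a : R) v : pdiff c t -> dplot c t (a *: v) = a *: dplot c t v.
Proof. by move=> [_ dc]; rewrite /dplot !deriveE // linearZ. Qed.

Lemma dplot_cst (y : M) t v : pdiff (fun _ => y) t /\ dplot (fun _ => y) t v = 0.
Proof.
split; last exact: (derive_cst (cmap y y)).
by split; [exact: cst_continuous|exact: differentiable_cst].
Qed.

(** Smooth transition maps reduce the condition for all charts around [c t] to a single one. *)
Lemma psmooth_of_plot x c t : {for t, continuous c} -> cdom x (c t) ->
  smooth_at (cmap x \o c) t -> psmooth c t.
Proof.
move=> ct xc sc; split=> // y yc.
apply: smooth_at_near (smooth_at_comp sc (smooth_transition xc yc)).
by have := near_cinvK ct xc; apply: filterS => s /= ->.
Qed.

Lemma psmooth_comp k (h : 'rV[R]_k -> M) (g : E -> 'rV[R]_k) t :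
  psmooth h (g t) -> smooth_at g t -> psmooth (h \o g) t.
Proof.
move=> [hc sh] sg; split=> [|x xh].
  by apply: continuous_comp => //; exact: smooth_at_continuous.
exact: (smooth_at_comp sg (sh _ xh)).
Qed.

End plots.

Section plots_rV.
Variables (k m : nat) (M : manifold R m).

Lemma psmooth_pdiff (c : 'rV[R]_k -> M) t : psmooth c t -> pdiff c t.
Proof.
move=> [ct sc]; split=> //; apply: smooth_at_differentiable.
exact/sc/cdom_mem.
Qed.

Lemma psmooth_pdiff1 (c : R -> M) t : psmooth c t -> pdiff c t.
Proof.
move=> [ct sc]; split=> //; apply: smooth_at_differentiable1.
exact/sc/cdom_mem.
Qed.

Lemma smooth_plot_at (O : set 'rV[R]_k) (c : 'rV[R]_k -> M) t : open O -> O t ->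
  smooth_plot O c -> psmooth c t.
Proof.
move=> oO Ot [cc sc].
apply: (@psmooth_of_plot _ _ _ (c t)); [exact: cc|exact: cdom_mem|].
have : \forall s \near t, O s /\ cdom (c t) (c s).
  near=> s; split; first by near: s; exact: open_nbhs_nbhs.
  by near: s; apply: (cc _ Ot); apply: nbhs_cdom; exact: cdom_mem.
move=> /near_openP[U [oU Ut HU]].
by apply: (@smooth_atW _ _ _ U) => // l; apply: Ck_sub (sc (c t) l) => s /HU.
Unshelve. all: by end_near. Qed.

Lemma smooth_plotP (O : set 'rV[R]_k) (c : 'rV[R]_k -> M) :
  (forall t, O t -> psmooth c t) -> smooth_plot O c.
Proof.
move=> H; split=> [t /H[]//|x]; apply: smooth_on_at => t [/H[_ sc] /= xc].
exact: sc.
Qed.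

End plots_rV.

Section maps.
Variables (m m' : nat) (M : manifold R m) (N : manifold R m').

Lemma msmooth_mdiff (f : M -> N) x : msmooth f x -> mdiff f x.
Proof. exact: psmooth_pdiff. Qed.

Lemma fsmooth_fdiff (F : normedModType R) `{C1 : C1space R F} (f : M -> F) x :
  fsmooth f x -> fdiff f x.
Proof. exact: smooth_at_differentiable. Qed.

Lemma tmapE (f : M -> N) x v : tmap f x v = dplot (f \o cinv x) (cmap x x) v.
Proof. by rewrite /dplot /= cinvxx. Qed.

Lemma tmapD (f : M -> N) x v w : mdiff f x ->
  tmap f x (v + w) = tmap f x v + tmap f x w.
Proof. by move=> df; rewrite !tmapE dplotD. Qed.

Lemma tmapZ (f : M -> N) x (a : R) v : mdiff f x ->
  tmap f x (a *: v) = a *: tmap f x v.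
Proof. by move=> df; rewrite !tmapE dplotZ. Qed.

Lemma dfunD (F : normedModType R) (f : M -> F) x v w : fdiff f x ->
  dfun f x (v + w) = dfun f x v + dfun f x w.
Proof. by move=> df; rewrite /dfun !deriveE // linearD. Qed.

Lemma dfunZ (F : normedModType R) (f : M -> F) x (a : R) v : fdiff f x ->
  dfun f x (a *: v) = a *: dfun f x v.
Proof. by move=> df; rewrite /dfun !deriveE // linearZ. Qed.

Lemma smooth_map_at (U : set M) (f : M -> N) x : open U -> U x ->
  smooth_map U f -> msmooth f x.
Proof.
move=> oU Ux [fc sf].
have xx := cdom_mem x.
have cf : {for cmap x x, continuous (f \o cinv x)}.
  by apply: continuous_comp; [exact: cinv_cont|rewrite cinvxx; exact: fc].
apply: (@psmooth_of_plot _ _ _ (f x)) => //; first by rewrite /= cinvxx; exact: cdom_mem.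
have : \forall y \near x, U y /\ cdom (f x) (f y).
  near=> y; split; first by near: y; exact: open_nbhs_nbhs.
  by near: y; apply: (fc _ Ux); apply: nbhs_cdom; exact: cdom_mem.
move=> /near_openP[V [oV Vx HV]].
apply: (@smooth_atW _ _ _ (cmap x @` (cdom x `&` V))).
- exact: open_chart.
- by exists x.
- move=> l; apply: Ck_sub (sf x (f x) l) => _ [y [xy /HV[Uy fy]] <-].
  by exists y.
Unshelve. all: by end_near. Qed.

Lemma smooth_fun_at (F : normedModType R) (U : set M) (f : M -> F) x :
  open U -> U x -> smooth_fun U f -> fsmooth f x.
Proof.
move=> oU Ux sf; apply: smooth_atW (sf x); first exact: open_chart.
by exists x => //; split=> //; exact: cdom_mem.
Qed.

Lemma smooth_funP (F : normedModType R) `{C1 : C1space R F} (U : set M) (f : M -> F) :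
  (forall x, U x -> fsmooth f x) -> smooth_fun U f.
Proof.
move=> H x; apply: smooth_on_at => _ [y [xy /H sf] <-].
by apply: psmooth_fun; [exact: psmooth_cinv|rewrite cmapK].
Qed.

End maps.

Section chain.
Variables (m1 m2 m3 : nat) (M1 : manifold R m1) (M2 : manifold R m2) (M3 : manifold R m3).

Lemma msmooth_comp (f : M1 -> M2) (g : M2 -> M3) x :
  msmooth f x -> msmooth g (f x) -> msmooth (g \o f) x.
Proof. by move=> sf sg; apply: psmooth_map sf _; rewrite /= cinvxx. Qed.

Lemma fsmooth_comp (F : normedModType R) `{C1 : C1space R F} (f : M1 -> M2)
  (g : M2 -> F) x : msmooth f x -> fsmooth g (f x) -> fsmooth (g \o f) x.
Proof. by move=> sf sg; apply: psmooth_fun sf _; rewrite /= cinvxx. Qed.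

Lemma tmap_comp (f : M1 -> M2) (g : M2 -> M3) x v :
  mdiff f x -> mdiff g (f x) ->
  mdiff (g \o f) x /\ tmap (g \o f) x v = tmap g (f x) (tmap f x v).
Proof.
move=> df dg; rewrite (tmapE (g \o f)) (tmapE f).
have dg' : mdiff g ((f \o cinv x) (cmap x x)) by rewrite /= cinvxx.
have [d E] := pdiff_map v df dg'; split; first exact: d.
by rewrite [LHS]E /= cinvxx.
Qed.

Lemma dfun_comp (F : normedModType R) (f : M1 -> M2)
  (g : M2 -> F) x v : mdiff f x -> fdiff g (f x) ->
  fdiff (g \o f) x /\ dfun (g \o f) x v = dfun g (f x) (tmap f x v).
Proof.
move=> df dg; rewrite tmapE.
have dg' : fdiff g ((f \o cinv x) (cmap x x)) by rewrite /= cinvxx.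
have [d E] := pdiff_fun v df dg'; split; first exact: d.
by rewrite [LHS]E /= cinvxx.
Qed.

Lemma tmap_near (f g : M1 -> M2) x : (\forall y \near x, f y = g y) -> mdiff f x ->
  mdiff g x /\ tmap f x = tmap g x.
Proof.
move=> fg df.
have fg' : \forall t \near cmap x x, (f \o cinv x) t = (g \o cinv x) t.
  have cx : cinv x @ cmap x x --> x.
    by rewrite -[X in _ --> X](cinvxx x); exact: cinv_cont (cdom_mem x).
  exact: (cx [set y | f y = g y] fg).
have [dg E] := pdiff_near fg' df; split=> //.
by apply/funext => v; rewrite !tmapE E.
Qed.

End chain.
End manifold_calculus.

(** * Lie algebras and tractor connections *)

Section derive_mulmx.
Variables (R : realType) (E : normedModType R) (p q r : nat).

Lemma derivable_mulmx (f : E -> 'M[R]_(p, q)) (g : E -> 'M[R]_(q, r)) x v :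
  derivable f x v -> derivable g x v ->
  derivable (fun y => f y *m g y) x v /\
  'D_v (fun y => f y *m g y) x = 'D_v f x *m g x + f x *m 'D_v g x.
Proof.
move=> df dg; have dfij := (derivable_mxP f x v).1 df.
have dgij := (derivable_mxP g x v).1 dg.
have H i j : is_derive x v (fun y => (f y *m g y) i j)
    (('D_v f x *m g x + f x *m 'D_v g x) i j).
  have -> : (fun y => (f y *m g y) i j) =
      \sum_(k < q) (fun y => f y i k * g y k j).
    by apply/funext => y; rewrite fct_sumE mxE.
  have d k : is_derive x v (fun y => f y i k * g y k j)
      ('D_v (fun y => f y i k) x * g x k j + f x i k * 'D_v (fun y => g y k j) x).
    exact: (@is_derive_scale _ _ _ (fun y => f y i k) (fun y => g y k j)).
  split; first by apply: derivable_sum => k; have [] := d k.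
  rewrite derive_sum; last by move=> k; have [] := d k.
  rewrite !mxE -big_split; apply: eq_bigr => k _ /=.
  by have [_ ->] := d k; rewrite !derive_mx // !mxE.
have D : derivable (fun y => f y *m g y) x v.
  by apply/derivable_mxP => i j; have [] := H i j.
split=> //; apply/matrixP => i j; rewrite derive_mx // [LHS]mxE.
by have [] := H i j.
Qed.

Lemma derive_mulmxl (A : 'M[R]_(p, q)) (g : E -> 'M[R]_(q, r)) x v :
  derivable g x v -> 'D_v (fun y => A *m g y) x = A *m 'D_v g x.
Proof.
move=> dg; have cA : derivable (fun=> A) x v by exact: derivable_cst.
have [_ ->] := derivable_mulmx cA dg.
by rewrite (derive_cst A) mul0mx add0r.
Qed.

Lemma derive_mulmxr (B : 'M[R]_(q, r)) (f : E -> 'M[R]_(p, q)) x v :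
  derivable f x v -> 'D_v (fun y => f y *m B) x = 'D_v f x *m B.
Proof.
move=> df; have cB : derivable (fun=> B) x v by exact: derivable_cst.
have [_ ->] := derivable_mulmx df cB.
by rewrite (derive_cst B) mulmx0 addr0.
Qed.

End derive_mulmx.

Lemma smooth_at_trmx (R : realType) (E : normedModType R) p q
  (f : E -> 'M[R]_(p, q)) x : smooth_at f x -> smooth_at (fun y => (f y)^T) x.
Proof.
move=> /smooth_at_mxP sf; apply/smooth_at_mxP => i j.
rewrite (_ : (fun _ => _) = fun y => f y j i) //.
by apply/funext => y; rewrite mxE.
Qed.

Section scalar_line.
Variables (R : realType) (m : nat).

Lemma smooth_at_line (v p : 'rV[R]_m) (t : R) :
  smooth_at (fun s : R => s *: v + p) t.
Proof.
apply: smooth_at_add; last exact: smooth_at_cst.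
by apply: smooth_at_scale; [exact: smooth_at_id|exact: smooth_at_cst].
Qed.

Lemma derive_lineE (v : 'rV[R]_m) (t : R) : 'D_1 (fun s : R => s *: v) t = v.
Proof.
have dI : derivable (@id R) t 1 by exact: derivable_id.
have dv : derivable (fun=> v : 'rV[R]_m) t 1 by exact: derivable_cst.
have [_ ->] := is_derive_scale dI dv.
by rewrite derive_id (derive_cst v) scale1r scaler0 addr0.
Qed.

Lemma smooth_at_coord (E : normedModType R) (h : R -> E) (i : 'I_m)
  (t : 'rV[R]_m) : smooth_at h (t 0 i) -> smooth_at (fun s : 'rV[R]_m => h (s 0 i)) t.
Proof.
move=> sh.
have cl : linear (fun s : 'rV[R]_m => s 0 i : R) by move=> a u v; rewrite !mxE.
pose l : {linear 'rV[R]_m -> R} := HB.pack (fun s : 'rV[R]_m => s 0 i)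
   (GRing.isLinear.Build _ _ _ _ _ cl).
have := @smooth_at_affine _ _ _ _ l 0 h t (@coord_continuous _ _ _ 0 i).
rewrite addr0 => /(_ sh).
by congr (smooth_at _ _); apply/funext => s; rewrite addr0.
Qed.

End scalar_line.

(** The last field holds for the isometries of a nondegenerate form, whose inverse is a conjugate of
    the transpose; it makes inversion visibly smooth. *)
Record mxgroup (R : realType) k (K : set 'M[R]_k) : Prop := MxGroup {
  mxgroup1 : K 1%:M;
  mxgroupM : forall a b, K a -> K b -> K (a *m b);
  mxgroupV : forall a, K a -> K (invmx a);
  mxgroupU : forall a, K a -> a \in unitmx;
  mxgroup_adj : exists A B, forall a, K a -> invmx a = A *m a^T *m B }.

Section lie_algebra.
Variables (R : realType) (k : nat) (K : set 'M[R]_k) (hK : mxgroup K).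

Lemma smooth_curve_at a t : smooth_curve K a -> smooth_at a t.
Proof. by move=> [sa _ _]; apply: smooth_atW sa => //; exact: openT. Qed.

Lemma smooth_curveP (a : R -> 'M[R]_k) : (forall t, smooth_at a t) ->
  (forall t, K (a t)) -> a 0 = 1%:M -> smooth_curve K a.
Proof. by move=> sa Ka a0; split=> //; apply: smooth_on_at => t _. Qed.

(** Products of curves give sums in the Lie algebra; the two lemmas that follow give scalar
    multiples and conjugates in the same way. *)
Lemma smooth_curveM a b : smooth_curve K a -> smooth_curve K b ->
  smooth_curve K (fun t => a t *m b t) /\
  derive1 (fun t => a t *m b t) 0 = derive1 a 0 + derive1 b 0.
Proof.
move=> Ha Hb; have [_ Ka a0] := Ha; have [_ Kb b0] := Hb.
have sa t := smooth_curve_at t Ha; have sb t := smooth_curve_at t Hb.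
split.
  apply: smooth_curveP => [t|t|]; first exact: smooth_at_mulmx.
    exact: mxgroupM.
  by rewrite a0 b0 mulmx1.
rewrite !derive1E.
have [_ ->] := derivable_mulmx (smooth_at_derivable (v := 1 : R) (sa 0))
  (smooth_at_derivable (v := 1 : R) (sb 0)).
by rewrite a0 b0 mulmx1 mul1mx.
Qed.

Lemma smooth_curveZ (c : R) a : smooth_curve K a ->
  smooth_curve K (fun t => a (c * t)) /\
  derive1 (fun t => a (c * t)) 0 = c *: derive1 a 0.
Proof.
move=> Ha; have [_ Ka a0] := Ha.
have cl : linear (fun t : R => c * t).
  by move=> x u v; rewrite mulrDr -[x *: u]/(x * u) mulrCA.
pose l : {linear R -> R} := HB.pack (fun t : R => c * t)
   (GRing.isLinear.Build _ _ _ _ _ cl).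
have lc : continuous l by move=> x; exact: mulrl_continuous.
split.
  apply: smooth_curveP => [t|t|]; last by rewrite mulr0.
    have := @smooth_at_affine _ _ _ _ l 0 a t lc (smooth_curve_at _ Ha).
    by congr (smooth_at _ _); apply/funext => s; rewrite addr0.
  exact: Ka.
rewrite !derive1E; have -> : (fun t => a (c * t)) = (fun t : R => a (t *: c + 0)).
  by apply/funext => t; rewrite addr0 mulrC.
rewrite (derive_line a) scale0r add0r -[c in LHS]mulr1 -[c * 1]/(c *: 1).
exact/deriveZdir/smooth_at_derivable/smooth_curve_at.
Qed.

Lemma smooth_curveJ b a : K b -> smooth_curve K a ->
  smooth_curve K (fun t => invmx b *m a t *m b) /\
  derive1 (fun t => invmx b *m a t *m b) 0 = invmx b *m derive1 a 0 *m b.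
Proof.
move=> Kb Ha; have [_ Ka a0] := Ha; have sa t := smooth_curve_at t Ha.
have sba t : smooth_at (fun t => invmx b *m a t) t.
  by apply: smooth_at_mulmx => //; exact: smooth_at_cst.
split.
  apply: smooth_curveP => [t|t|].
  - by apply: smooth_at_mulmx => //; exact: smooth_at_cst.
  - by apply: mxgroupM => //; apply: mxgroupM => //; exact: mxgroupV.
  - by rewrite a0 mulmx1 mulVmx //; exact: mxgroupU Kb.
rewrite !derive1E (derive_mulmxr b (smooth_at_derivable (v := 1 : R) (sba 0))).
by rewrite (derive_mulmxl _ (smooth_at_derivable (v := 1 : R) (sa 0))).
Qed.

Lemma lie_algD X Y : lie_alg K X -> lie_alg K Y -> lie_alg K (X + Y).
Proof.
by move=> [a Ha <-] [b Hb <-]; have [H E] := smooth_curveM Ha Hb; exists (fun t => a t *m b t).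
Qed.

Lemma lie_algZ c X : lie_alg K X -> lie_alg K (c *: X).
Proof.
by move=> [a Ha <-]; have [H E] := smooth_curveZ c Ha; exists (fun t => a (c * t)).
Qed.

Lemma smooth_at_invmx (E : normedModType R) (f : E -> 'M[R]_k) x :
  (\forall y \near x, K (f y)) -> smooth_at f x ->
  smooth_at (fun y => invmx (f y)) x.
Proof.
move=> Kf sf; have [A [B AB]] := mxgroup_adj hK.
apply: (@smooth_at_near _ _ _ (fun y => A *m (f y)^T *m B)).
  by apply: filterS Kf => y /AB.
apply: smooth_at_mulmx; last exact: smooth_at_cst.
by apply: smooth_at_mulmx; [exact: smooth_at_cst|exact: smooth_at_trmx].
Qed.

End lie_algebra.

Section reps.
Variables (R : realType) (k d : nat) (K : set 'M[R]_k) (hK : mxgroup K).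
Variable W : representation K d.

Lemma rho_at l (f : 'rV[R]_l -> 'M[R]_k) x :
  (\forall y \near x, K (f y)) -> smooth_at f x ->
  smooth_at (fun y => W (f y)) x.
Proof.
move=> Kf [ O [oO Ox Of]].
have : \forall y \near x, O y /\ K (f y).
  by near=> y; split; [near: y; exact: open_nbhs_nbhs|near: y].
move=> /near_openP[V [oV Vx HV]].
apply: (@smooth_atW _ _ _ V) => //; apply: rho_smooth => //; last by move=> t /HV[].
by move=> i; apply: Ck_sub (Of i) => y /HV[].
Unshelve. all: by end_near. Qed.

Lemma rho_curve a t : smooth_curve K a -> smooth_at (fun t => W (a t)) t.
Proof.
move=> Ha; have [_ Ka _] := Ha.
(* Smoothness of W is postulated for parameters in row vectors, so the real parameter is passed
   through ['rV[R]_1]. *)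
pose b (s : 'rV[R]_1) := W (a (s 0 0)).
have sb s : smooth_at b s.
  have Kn : \forall y \near s, K (a ((y : 'rV[R]_1) 0 0)).
    by apply: (@filterE _ (nbhs s) (nbhs_filter s)) => y; exact: Ka.
  apply: (rho_at Kn).
  by apply: smooth_at_coord; exact: smooth_curve_at Ha.
suff -> : (fun t => W (a t)) = b \o (fun s : R => s *: (delta_mx 0 0 : 'rV[R]_1) + 0).
  exact: smooth_at_comp (smooth_at_line _ _ _) (sb _).
by apply/funext => s; rewrite /b /= !mxE /= mulr1 addr0.
Qed.

Lemma drho_derive a : smooth_curve K a ->
  'D_1 (fun t => W (a t)) 0 = drho W ('D_1 a 0).
Proof. by move=> Ha; rewrite -!derive1E; exact: drhoE. Qed.

(** [drho] is specified only on velocities of curves in K, so additivity is the product rule for W(a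
    t) W(b t), not an assumption. *)
Lemma drhoD X Y : lie_alg K X -> lie_alg K Y ->
  drho W (X + Y) = drho W X + drho W Y.
Proof.
move=> [a Ha <-] [b Hb <-]; have [Hab E] := smooth_curveM hK Ha Hb.
have [_ Ka a0] := Ha; have [_ Kb b0] := Hb.
rewrite -E -!drhoE // !derive1E.
have -> : (fun t => W (a t *m b t)) = fun t => W (a t) *m W (b t).
  by apply/funext => t; rewrite rhoM.
have [_ ->] := derivable_mulmx (smooth_at_derivable (v := 1 : R) (rho_curve 0 Ha))
  (smooth_at_derivable (v := 1 : R) (rho_curve 0 Hb)).
by rewrite a0 b0 rho1 mulmx1 mul1mx.
Qed.

Lemma drhoZ c X : lie_alg K X -> drho W (c *: X) = c *: drho W X.
Proof.
move=> [a Ha <-]; have [Hc E] := smooth_curveZ c Ha.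
rewrite -E -!drhoE // !derive1E.
have -> : (fun t => W (a (c * t))) = (fun t : R => W (a (t *: c + 0))).
  by apply/funext => t; rewrite addr0 mulrC.
rewrite (derive_line (fun t => W (a t))) scale0r add0r -[c in LHS]mulr1 -[c * 1]/(c *: 1).
exact/deriveZdir/smooth_at_derivable/rho_curve.
Qed.

Lemma drhoJ b X : K b -> lie_alg K X ->
  drho W (invmx b *m X *m b) = W (invmx b) *m drho W X *m W b.
Proof.
move=> Kb [a Ha <-]; have [Hc E] := smooth_curveJ hK Kb Ha.
have [_ Ka a0] := Ha; have KVb := mxgroupV hK Kb.
rewrite -E -!drhoE // !derive1E.
have -> : (fun t => W (invmx b *m a t *m b)) = fun t => W (invmx b) *m W (a t) *m W b.
  by apply/funext => t; rewrite !rhoM //; exact: mxgroupM.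
rewrite derive_mulmxr ?derive_mulmxl //.
  by apply/smooth_at_derivable/rho_curve.
apply: smooth_at_derivable; apply: smooth_at_mulmx; first exact: smooth_at_cst.
exact: rho_curve.
Qed.

Lemma rhoKV b : K b -> W b *m W (invmx b) = 1%:M.
Proof.
move=> Kb; rewrite -rhoM ?mulmxV ?rho1 //; first exact: mxgroupU Kb.
exact: mxgroupV.
Qed.

End reps.

Section plots_more.
Variable R : realType.

Lemma dplot_cinv m (M : manifold R m) (x : M) v : dplot (cinv x) (cmap x x) v = v.
Proof.
rewrite /dplot cinvxx.
have H : \forall t \near cmap x x, (cmap x \o cinv x) t = t.
  have : \forall t \near cmap x x, (cmap x @` cdom x) t.
    apply: open_nbhs_nbhs; split; first exact: cimg_open.
    by exists x => //; exact: cdom_mem.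
  by apply: filterS => _ [y xy <-] /=; rewrite cmapK.
by rewrite (near_eq_derive v H) derive_id.
Qed.

Lemma tmap_id m (M : manifold R m) (x : M) v : tmap id x v = v.
Proof. by rewrite tmapE; exact: dplot_cinv. Qed.

Lemma near_cinv m (M : manifold R m) (x : M) (P : M -> Prop) :
  (\forall y \near x, P y) -> \forall t \near cmap x x, P (cinv x t).
Proof.
have cx : cinv x @ cmap x x --> x.
  by rewrite -[X in _ --> X](cinvxx x); exact: cinv_cont (cdom_mem x).
exact: (cx [set y | P y]).
Qed.

Lemma dplot_line k m (M : manifold R m) (c : 'rV[R]_k -> M) w :
  pdiff c 0 -> dplot (fun t : R => c (t *: w)) 0 1 = dplot c 0 w.
Proof.
move=> dc.
have d : differentiable (fun t : R => t *: w) 0.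
  apply: smooth_at_differentiable1; apply: smooth_at_scale; last exact: smooth_at_cst.
  exact: smooth_at_id.
have dc' : pdiff c ((fun t : R => t *: w) 0) by rewrite scale0r.
have [_ E] := pdiff_reparam (1 : R) dc' d.
by rewrite [LHS]E derive_lineE scale0r.
Qed.

Lemma tmap0 m m' (M : manifold R m) (N : manifold R m') (f : M -> N) x :
  tmap f x 0 = 0.
Proof. by rewrite /tmap derive0. Qed.

Lemma velocityE m (M : manifold R m) (c : R -> M) t : velocity c t = dplot c t 1.
Proof. by []. Qed.

(* The reparametrisation [e sin (t / e)] keeps the curve inside a given
   neighbourhood for all real times. *)
Lemma global_curve m (M : manifold R m) (x : M) (v : 'rV[R]_m) (U : set M) :
  open U -> U x -> exists c : R -> M,
    [/\ c 0 = x, forall t, U (c t), forall t, psmooth c t & dplot c 0 1 = v].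
Proof.
move=> oU Ux.
have : nbhs (cmap x x) (cmap x @` (cdom x `&` U)).
  apply: open_nbhs_nbhs; split; first exact: open_chart.
  by exists x => //; split=> //; exact: cdom_mem.
move=> /nbhs_ballP[r /= r0 rU].
(* As sine is bounded by 1, the coordinates move by at most e |v| < r; the summand 1 covers v =
   0. *)
pose e := r / (`|v| + 1).
have v1 : 0 < `|v| + 1 by rewrite ltr_wpDl.
have e0 : 0 < e by rewrite divr_gt0.
have en0 : e != 0 by rewrite gt_eqF.
pose chi (t : R) := e * sin (e^-1 *: t + 0).
have schi t : smooth_at chi t.
  apply: smooth_at_mul; first exact: smooth_at_cst.
  apply: (@smooth_at_affine _ _ _ _ ( *:%R e^-1)); last exact: smooth_at_sin.
  exact: scaler_continuous.
pose g (t : R) := chi t *: v + cmap x x.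
have sg t : smooth_at g t.
  apply: smooth_at_add; last exact: smooth_at_cst.
  by apply: smooth_at_scale => //; exact: smooth_at_cst.
have g0 : g 0 = cmap x x by rewrite /g /chi scaler0 addr0 sin0 mulr0 scale0r add0r.
have gU t : (cmap x @` (cdom x `&` U)) (g t).
  apply: rU; rewrite -ball_normE /= /g opprD addrCA subrr addr0 normrN normrZ.
  rewrite normrM (gtr0_norm e0) -mulrA.
  apply: (@le_lt_trans _ _ (e * `|v|)).
    rewrite ler_pM2l // -[X in _ <= X]mul1r; apply: ler_wpM2r => //; exact: sin_max.
  by rewrite /e mulrAC ltr_pdivrMr // ltr_pM2l // ltrDl.
have D0 : 'D_1 g 0 = v.
  have dchi : is_derive (0 : R) (1 : R) chi 1.
    split; first exact: smooth_at_derivable.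
    have -> : chi = fun t => e *: (fun s => sin (s *: e^-1 + 0)) t.
      by apply/funext => t; rewrite /chi; congr (_ * sin (_ + _)); exact: mulrC.
    have ds : derivable (fun s : R => sin (s *: e^-1 + 0)) 0 1.
      apply: (@derivable_line _ _ _ (@sin R) 0 e^-1 0).
      by have [] := derive_sinE e^-1 (0 *: e^-1 + 0 : R).
    rewrite (@deriveZ _ _ _ (fun s : R => sin (s *: e^-1 + 0)) e) //.
    rewrite (@derive_line _ _ _ (@sin R)).
    have [_ ->] := derive_sinE e^-1 (0 *: e^-1 + 0 : R).
    by rewrite scale0r addr0 cos0 mulr1 -[LHS]/(e * e^-1) mulfV.
  have dv : derivable (fun _ : R => v) 0 1 by exact: derivable_cst.
  have [dc1 dc2] := dchi.
  have [ds1 ds2] := is_derive_scale dc1 dv.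
  have dc : derivable (fun _ : R => cmap x x) 0 1 by exact: derivable_cst.
  rewrite (deriveD ds1 dc) ds2 dc2 (derive_cst v) (derive_cst (cmap x x)).
  by rewrite scale1r scaler0 !addr0.
exists (cinv x \o g); split.
- by rewrite /= g0 cinvxx.
- by move=> t; have [y [xy Uy] /= <-] := gU t; rewrite cmapK.
- move=> t; apply: psmooth_comp => //.
  by have [y [xy Uy] /= <-] := gU t; exact: psmooth_cinv.
- have pc : pdiff (cinv x) (g 0) by rewrite g0; apply: psmooth_pdiff; exact/psmooth_cinv/cdom_mem.
  have dg : differentiable g 0 by exact: smooth_at_differentiable1.
  have [_ E] := pdiff_reparam (1 : R) pc dg.
  by rewrite [LHS]E D0 g0 dplot_cinv.
Qed.

End plots_more.

(** * Principal bundles: the action, vertical vectors and local sections *)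

Section bundle.
Variables (R : realType) (k : nat) (P : set 'M[R]_k) (hP : mxgroup P).
Variables (dT dM : nat) (T : manifold R dT) (M : manifold R dM).
Variable B : principal_bundle P T M.

Lemma pact_at l (O : set 'rV[R]_l) (c : 'rV[R]_l -> T) a t : open O -> O t ->
  (forall s, O s -> [/\ psmooth c s, smooth_at a s & P (a s)]) ->
  psmooth (fun s => pact B (c s) (a s)) t.
Proof.
move=> oO Ot H; apply: (smooth_plot_at oO Ot); apply: pact_smooth => //.
- by apply: smooth_plotP => s /H[].
- by apply: smooth_on_at => s /H[].
- by move=> s /H[].
Qed.

Lemma pact_right u a : P a -> msmooth (fun w => pact B w a) u.
Proof.
move=> Pa; apply: (@pact_at _ (cmap u @` cdom u) (cinv u) (fun _ => a)).
- exact: cimg_open.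
- by exists u => //; exact: cdom_mem.
- move=> _ [y uy <-]; split=> //; first exact: psmooth_cinv.
  exact: smooth_at_cst.
Qed.

Lemma pact_curve u a t : smooth_curve P a -> psmooth (fun t : R => pact B u (a t)) t.
Proof.
move=> Ha; have [_ Pa _] := Ha.
pose b (s : 'rV[R]_1) := pact B u (a (s 0 0)).
have sb s : psmooth b s.
  apply: (@pact_at _ setT (fun _ => u)) => //; first exact: openT.
  move=> s' _; split=> //; last by apply: smooth_at_coord; exact: smooth_curve_at Ha.
  split; first exact: cst_continuous.
  by move=> x _; exact: smooth_at_cst.
suff -> : (fun t => pact B u (a t)) =
    b \o (fun s : R => s *: (delta_mx 0 0 : 'rV[R]_1) + 0).
  exact: psmooth_comp (sb _) (smooth_at_line _ _ _).
by apply/funext => s; rewrite /b /= !mxE /= mulr1 addr0.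
Qed.

Lemma pproj_msmooth u : msmooth (pproj B) u.
Proof. by apply: (smooth_map_at openT) => //; exact: pproj_smooth. Qed.

Lemma open_pproj (U : set M) : open U -> open (pproj B @^-1` U).
Proof.
move=> oU; apply: open_comp => // u _.
by have [c _] := pproj_smooth B; exact: c.
Qed.

(* The derivative of the plot (t0, t1) |-> s (proj (c t0)) g (c t1) along the
   diagonal is the sum of its two partial derivatives. *)
Lemma vertical_velocity u v : tmap (pproj B) u v = 0 ->
  exists2 a, smooth_curve P a & velocity (fun t => pact B u (a t)) 0 = v.
Proof.
move=> v0; have [U [s [g [[oU Ux] ss sg Hs Hu]]]] := ptriv B (pproj B u).
have oV := open_pproj oU.
have [c [c0 cU sc cv]] := global_curve v oV Ux.
have [Pgu uE] := Hu u Ux.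
have Pgc t : P (g (c t)) by have [] := Hu _ (cU t).
have sgc t : smooth_at (g \o c) t.
  by apply: psmooth_fun => //; apply: (smooth_fun_at oV (cU t)).
have spc t : psmooth (pproj B \o c) t.
  by apply: psmooth_map => //; exact: pproj_msmooth.
have sspc t : psmooth (s \o (pproj B \o c)) t.
  by apply: psmooth_map => //; exact: (smooth_map_at oU (cU t)).
pose a t := invmx (g u) *m g (c t).
have Ha : smooth_curve P a.
  apply: smooth_curveP => [t|t|].
  - by apply: smooth_at_mulmx => //; exact: smooth_at_cst.
  - by apply: mxgroupM => //; exact: mxgroupV.
  - by rewrite /a c0 mulVmx //; exact: mxgroupU Pgu.
exists a => //.
pose b (t : 'rV[R]_2) := pact B (s (pproj B (c (t 0 0)))) (g (c (t 0 1))).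
have sb t : psmooth b t.
  apply: (@pact_at _ setT (fun t => s (pproj B (c (t 0 0)))) (fun t => g (c (t 0 1)))) => //.
    exact: openT.
  move=> t' _; split=> //.
    split.
      apply: (@continuous_comp _ _ _ (fun t : 'rV[R]_2 => t 0 0) (s \o (pproj B \o c))).
        exact: coord_continuous.
      by have [] := sspc (t' 0 0).
    move=> x xx; apply: (@smooth_at_coord _ _ _ (cmap x \o (s \o (pproj B \o c))) 0).
    by have [_] := sspc (t' 0 0); apply.
  by apply: (@smooth_at_coord _ _ _ (g \o c) 1).
have pb : pdiff b 0 by exact: psmooth_pdiff.
pose e0 : 'rV[R]_2 := delta_mx 0 0; pose e1 : 'rV[R]_2 := delta_mx 0 1.
have D : dplot b 0 (e0 + e1) = dplot b 0 e0 + dplot b 0 e1 by exact: dplotD.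
rewrite -!dplot_line // in D.
have E01 : (fun t : R => b (t *: (e0 + e1))) = c.
  apply/funext => t; rewrite /b !mxE /= !(addr0, add0r) mulr1.
  by have [_ <-] := Hu _ (cU t).
have E0 : (fun t : R => b (t *: e0)) = (fun w => pact B w (g u)) \o (s \o (pproj B \o c)).
  by apply/funext => t; rewrite /b !mxE /= mulr1 mulr0 c0.
have E1 : (fun t : R => b (t *: e1)) = fun t => pact B u (a t).
  apply/funext => t; rewrite /b !mxE /= mulr1 mulr0 c0 [in RHS]uE pactM //; last first.
    by have [_ + _] := Ha; apply.
  by rewrite /a mulmxA mulmxV ?mul1mx //; exact: mxgroupU Pgu.
have D0 : dplot (fun t : R => b (t *: e0)) 0 1 = 0.
  rewrite E0.
  have [_ ->] := pdiff_map (1 : R) (psmooth_pdiff1 (sspc 0)) (msmooth_mdiff (pact_right _ Pgu)).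
  have ms : mdiff s ((pproj B \o c) 0) by apply/msmooth_mdiff/(smooth_map_at oU (cU 0)).
  have [_ ->] := pdiff_map (1 : R) (psmooth_pdiff1 (spc 0)) ms.
  have [_ ->] := pdiff_map (1 : R) (psmooth_pdiff1 (sc 0)) (msmooth_mdiff (pproj_msmooth _)).
  by rewrite cv c0 v0 !tmap0.
by move: D; rewrite D0 add0r E01 E1 cv velocityE => ->.
Qed.

(** The section of a trivialisation is translated by the fixed group element [g u], so that it
    passes through u. *)
Lemma local_section u : exists U (s : M -> T),
  [/\ open U, U (pproj B u), s (pproj B u) = u, forall y, U y -> msmooth s y
    & forall y, U y -> pproj B (s y) = y].
Proof.
have [U [s [g [[oU Ux] ss sg Hs Hu]]]] := ptriv B (pproj B u).
have [Pgu uE] := Hu u Ux.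
exists U, (fun y => pact B (s y) (g u)); split=> //.
- move=> y Uy; apply: (@msmooth_comp _ _ _ _ _ _ _ s (fun w => pact B w (g u))).
    exact: (smooth_map_at oU Uy).
  exact: pact_right.
- by move=> y Uy; rewrite pproj_act //; have [] := Hs y Uy.
Qed.

Lemma tmap_section (s : M -> T) U y v : open U -> U y -> msmooth s y ->
  (forall y, U y -> pproj B (s y) = y) ->
  tmap (pproj B) (s y) (tmap s y v) = v.
Proof.
move=> oU Uy ss sK.
have [_ <-] := tmap_comp v (msmooth_mdiff ss) (msmooth_mdiff (pproj_msmooth (s y))).
have N : \forall z \near y, id z = (pproj B \o s) z.
  by near=> z; rewrite /= sK //; near: z; exact: open_nbhs_nbhs.
have di : mdiff (id : M -> M) y by apply: psmooth_pdiff; exact/psmooth_cinv/cdom_mem.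
have [_ <-] := tmap_near N di; exact: tmap_id.
Unshelve. all: by end_near. Qed.

Lemma lift_exists u y : exists v, tmap (pproj B) u v = y.
Proof.
have [U [s [oU Ux su ss sK]]] := local_section u.
exists (tmap s (pproj B u) y).
by have := @tmap_section _ _ _ y oU Ux (ss _ Ux) sK; rewrite su.
Qed.

End bundle.

Lemma near_all (T : topologicalType) (x : T) (P : T -> Prop) :
  (forall y, P y) -> \forall y \near x, P y.
Proof. by move=> H; apply: (@filterE _ (nbhs x) (nbhs_filter x)). Qed.

Section charts.
Variable R : realType.

(** Undoes the change of coordinates in [vf_coord]: it brings a vector from the chart around x back
    to the preferred chart at y. *)
Lemma dplot_cinv_vf m (M : manifold R m) (x y : M) v : cdom x y ->
  dplot (cinv x) (cmap x y) ('D_v (cmap x \o cinv y) (cmap y y)) = v.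
Proof.
move=> xy; pose h := cmap x \o cinv y.
have hE : h (cmap y y) = cmap x y by rewrite /h /= cinvxx.
have sh : smooth_at h (cmap y y) by exact: smooth_transition (cdom_mem y) xy.
have pc : pdiff (cinv x) (h (cmap y y)).
  by rewrite hE; apply: psmooth_pdiff; exact: psmooth_cinv.
have dh : differentiable h (cmap y y) by exact: smooth_at_differentiable.
have [pch E] := pdiff_reparam v pc dh.
rewrite -[RHS](dplot_cinv y) -hE -E.
have N : \forall t \near cmap y y, (cinv x \o h) t = cinv y t.
  have : \forall t \near cmap y y, cdom x (cinv y t).
    by apply: near_cinv; exact: nbhs_cdom.
  by apply: filterS => t /=; exact: cmapK.
by have [_ ->] := pdiff_near N pch.
Qed.

Lemma dplot_chart (E : normedModType R) m (M : manifold R m) (c : E -> M) t x v :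
  pdiff c t -> cdom x (c t) -> differentiable (cmap x \o c) t ->
  dplot c t v = dplot (cinv x) (cmap x (c t)) ('D_v (cmap x \o c) t).
Proof.
move=> pc xc dc.
have px : pdiff (cinv x) ((cmap x \o c) t) by apply: psmooth_pdiff; exact: psmooth_cinv.
have [pcc <-] := pdiff_reparam v px dc.
have N : \forall s \near t, (cinv x \o (cmap x \o c)) s = c s.
  by have [ct _] := pc; exact: near_cinvK.
by have [_ ->] := pdiff_near N pcc.
Qed.

End charts.

(** * The tractor connection of a Cartan geometry *)

Section tractor.
Variables (R : realType) (k : nat) (G P G' : set 'M[R]_k).
Hypotheses (hP : mxgroup P) (hG' : mxgroup G') (PG' : P `<=` G').
Hypothesis lieG : lie_alg G `<=` lie_alg G'.
Variables (dT dM : nat) (T : manifold R dT) (M : manifold R dM).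
Variables (C : cartan_geometry G P T M) (d : nat) (W : representation G' d).
Implicit Types (f : T -> 'cV[R]_d) (u : T) (v : 'rV[R]_dT).

(** The tractor derivative along a vector of the total space, before any lift is chosen. It is
    linear in v, and the same formula can be compared on two bundles related by a map. *)
Definition tderiv f u v : 'cV[R]_d := dfun f u v + drho W (om C u v) *m f u.

Lemma section_smooth f u : tractor_section C W f -> fsmooth f u.
Proof. by move=> [sf _]; exact: (smooth_fun_at openT I). Qed.

Lemma om_lie u v : lie_alg G' (om C u v).
Proof. exact/lieG/om_in. Qed.

Lemma omD u v w : om C u (v + w) = om C u v + om C u w.
Proof. by have := om_linear C u 1 v w; rewrite !scale1r. Qed.

Lemma omZ u a v : om C u (a *: v) = a *: om C u v.
Proof.
have om0 : om C u 0 = 0.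
  by apply: (addrI (om C u 0)); rewrite -omD !addr0.
by have := om_linear C u a v 0; rewrite om0 !addr0.
Qed.

Lemma tderivD f u v w : fsmooth f u ->
  tderiv f u (v + w) = tderiv f u v + tderiv f u w.
Proof.
move=> sf; rewrite /tderiv omD (drhoD hG') ?mulmxDl; [|exact: om_lie|exact: om_lie].
rewrite dfunD; first exact: addrACA.
exact: fsmooth_fdiff.
Qed.

Lemma tderivZ f u a v : fsmooth f u -> tderiv f u (a *: v) = a *: tderiv f u v.
Proof.
move=> sf; rewrite /tderiv omZ (drhoZ W); last exact: om_lie.
rewrite dfunZ; first by rewrite scalerDr scalemxAl.
exact: fsmooth_fdiff.
Qed.

(** The product rule, with [om_fundamental] identifying a'(0). Equivariance of f is not assumed: the
    formula is used both to derive vanishing from equivariance and to derive equivariance from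
    vanishing. *)
Lemma derive_transport f u a : fsmooth f u -> smooth_curve P a ->
  let F := fun t : R => W (a t) *m f (pact C u (a t)) in
  derivable F 0 1 /\
  'D_1 F 0 = tderiv f u (velocity (fun t => pact C u (a t)) 0).
Proof.
move=> sf Ha F; have [sa Pa a0] := Ha.
have Ha' : smooth_curve G' a by split=> // t; exact/PG'/Pa.
rewrite /tderiv om_fundamental //.
have c0 : pact C u (a 0) = u by rewrite a0 pact1.
have pc : pdiff (fun t => pact C u (a t)) 0 by exact/psmooth_pdiff1/pact_curve.
have df : fdiff f ((fun t => pact C u (a t)) 0) by rewrite c0; exact: fsmooth_fdiff.
have [dfc fcE] := pdiff_fun (1 : R) pc df.
rewrite velocityE -[X in dfun f X _]c0 -fcE derive1E -drho_derive //.
have sW : smooth_at (fun t => W (a t)) 0 by exact: rho_curve.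
have dfc' : derivable (f \o (fun t => pact C u (a t))) 0 1 by exact: diff_derivable.
have [dF ->] := derivable_mulmx (smooth_at_derivable (v := 1 : R) sW) dfc'.
by split=> //; rewrite a0 rho1 mul1mx /= c0 addrC.
Qed.

Lemma tderiv_fundamental f u a : tractor_section C W f -> smooth_curve P a ->
  tderiv f u (velocity (fun t => pact C u (a t)) 0) = 0.
Proof.
move=> Hf Ha; have [_ Pa _] := Ha; have [_ ef] := Hf.
have [_ <-] := derive_transport (section_smooth u Hf) Ha.
have -> : (fun t => W (a t) *m f (pact C u (a t))) = fun=> f u.
  apply/funext => t /=; rewrite ef // mulmxA (rhoKV hG') ?mul1mx //; exact/PG'/Pa.
exact: (derive_cst (f u)).
Qed.

Lemma tderiv_vertical f u v : tractor_section C W f ->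
  tmap (pproj C) u v = 0 -> tderiv f u v = 0.
Proof.
move=> Hf /(vertical_velocity hP)[a Ha <-]; exact: tderiv_fundamental.
Qed.

(** Two lifts differ by a vertical vector, along which the derivative of an equivariant function
    vanishes. From here on any convenient lift may replace the one picked by [xget]. *)
Lemma tractor_connE xi f u v : tractor_section C W f ->
  tmap (pproj C) u v = xi (pproj C u) -> tractor_conn C W xi f u = tderiv f u v.
Proof.
move=> Hf vE; rewrite /tractor_conn; set w := xget _ _; rewrite -/(tderiv f u w).
have wE : tmap (pproj C) u w = xi (pproj C u).
  by apply: (@xgetPex _ 0 [set v | tmap (pproj C) u v = xi (pproj C u)]); exists v.
have mp : mdiff (pproj C) u by exact/msmooth_mdiff/pproj_msmooth.
have sf := section_smooth u Hf.
have -> : w = v + (-1) *: (v - w) by rewrite scaleN1r opprB addrCA subrr addr0.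
rewrite tderivD // tderivZ // (@tderiv_vertical _ _ (v - w)) ?scaler0 ?addr0 //.
by rewrite -scaleN1r tmapD // tmapZ // vE wE scaleN1r subrr.
Qed.

Lemma tractor_connP xi f u : tractor_section C W f ->
  exists2 v, tmap (pproj C) u v = xi (pproj C u) &
    tractor_conn C W xi f u = tderiv f u v.
Proof.
move=> Hf; have [v vE] := lift_exists C u (xi (pproj C u)).
by exists v => //; exact: tractor_connE.
Qed.

(** The right translate of a lift at u is a lift at the translated point; the equivariance of [om]
    and [drhoJ] then carry the algebraic term along. *)
Lemma tractor_conn_equivariant xi f u a : tractor_section C W f -> P a ->
  tractor_conn C W xi f (pact C u a) = W (invmx a) *m tractor_conn C W xi f u.
Proof.
move=> Hf Pa; have [_ ef] := Hf; have [v vE ->] := tractor_connP xi u Hf.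
pose r (w : T) := pact C w a.
have mr : mdiff r u by apply: msmooth_mdiff; exact: pact_right.
have mp w : mdiff (pproj C) w by exact/msmooth_mdiff/pproj_msmooth.
rewrite (@tractor_connE _ _ _ (tmap r u v)) //; last first.
  rewrite pproj_act //.
  have [_ <-] := tmap_comp v mr (mp (r u)).
  have -> : pproj C \o r = pproj C by apply/funext => w; exact: pproj_act.
  exact: vE.
rewrite /tderiv mulmxDr; congr (_ + _).
  have [_ <-] := dfun_comp v mr (fsmooth_fdiff (section_smooth (r u) Hf)).
  have -> : f \o r = fun w => W (invmx a) *m f w by apply/funext => w; exact: ef.
  rewrite /dfun; apply: (derive_mulmxl _ (g := f \o cinv u)).
  by apply: smooth_at_derivable; exact: section_smooth.
rewrite om_equivariant // (drhoJ hG') //; [|exact/PG'|exact: om_lie].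
by rewrite ef // -!mulmxA (mulmxA (W a)) (rhoKV hG') ?mul1mx //; exact: PG'.
Qed.

(** Smoothness of [drho] comes from linearity: [om C u] identifies the tangent space at u with the
    Lie algebra of G, so b(s) has smooth coordinates in a fixed finite basis. *)
Lemma smooth_drho (E : normedModType R) (u : T) (b : E -> 'M[R]_k) t :
  (\forall s \near t, lie_alg G (b s)) -> smooth_at b t ->
  smooth_at (fun s => drho W (b s)) t.
Proof.
move=> Gb sb.
(* The matrix of [om C u]. Its rows are independent because [om] is injective, so [pinvmx A]
   recovers coordinates from a Lie algebra element. *)
pose A : 'M[R]_(dT, k * k) := \matrix_i mxvec (om C u (delta_mx 0 i)).
have omE v : om C u v = \sum_i v 0 i *: om C u (delta_mx 0 i).
  have ol : linear (om C u) by exact: om_linear.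
  by rewrite {1}(linear_rV_sum ol).
have AE v : v *m A = mxvec (om C u v).
  rewrite omE linear_sum /=; apply/rowP => j; rewrite !mxE summxE.
  by apply: eq_bigr => i _; rewrite linearZ !mxE.
have fA : row_free A.
  apply: inj_row_free => v; rewrite AE => v0.
  apply: (@om_inj _ _ _ _ _ _ _ _ C u).
  have -> : om C u 0 = 0 by rewrite -[X in om C u X](scale0r 0) omZ scale0r.
  by rewrite -[om C u v]mxvecK v0 linear0.
apply: (@smooth_at_near _ _ _ (fun s => \sum_i (mxvec (b s) *m pinvmx A) 0 i *:
    drho W (om C u (delta_mx 0 i)))).
  apply: filterS Gb => s Gs; have [v vE] := om_surj C u Gs.
  rewrite -vE -AE -mulmxA mulmxVp // mulmx1 omE.
  (* [drho] is additive only on the Lie algebra, so membership is carried through the sum. *)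
  pose K (Y : 'M[R]_d) (X : 'M[R]_k) := lie_alg G' X /\ Y = drho W X.
  have om0 : om C u 0 = 0 by rewrite -[X in om C u X](scale0r 0) omZ scale0r.
  suff [] : K (\sum_i v 0 i *: drho W (om C u (delta_mx 0 i)))
     (\sum_i v 0 i *: om C u (delta_mx 0 i)) by [].
  elim/big_ind2: _ => [|X1 Y1 X2 Y2 [L1 ->] [L2 ->]|i _].
  - split; first by rewrite -om0; exact: om_lie.
    by rewrite -[X in drho W X](scale0r (om C u 0)) drhoZ ?scale0r //; exact: om_lie.
  - by split; [exact: (lie_algD hG')|rewrite (drhoD hG')].
  - by split; [exact/lie_algZ/om_lie|rewrite (drhoZ W) //; exact: om_lie].
apply: smooth_at_sum => i; apply: smooth_at_scale; last exact: smooth_at_cst.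
have sm : smooth_at (fun s => mxvec (b s) *m pinvmx A) t.
  apply: smooth_at_mulmx; last exact: smooth_at_cst.
  apply/smooth_at_mxP => i' j'; rewrite ord1; case/mxvec_indexP: j' => p q.
  rewrite (_ : (fun _ => _) = fun s => b s p q).
    by move: sb => /smooth_at_mxP; apply.
  by apply/funext => s; rewrite mxvecE.
by move: sm => /smooth_at_mxP; apply.
Qed.

(** [om_smooth] speaks of coordinate fields of one chart. The velocity of the plot is therefore
    expanded in the fixed chart around c(t), with smooth coefficients. *)
Lemma smooth_om (l : nat) (c : 'rV[R]_l -> T) (X : 'rV[R]_l -> 'rV[R]_l) t :
  psmooth c t -> smooth_at X t ->
  smooth_at (fun s => om C (c s) (dplot c s (X s))) t.
Proof.
move=> sc sX; have [ct sct] := sc; pose z := c t.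
have zz : cdom z (c t) by exact: cdom_mem.
have szc := sct _ zz.
have N : \forall s \near t, cdom z (c s) by apply: ct; exact: nbhs_cdom.
have Nz : \forall s \near t, smooth_at (cmap z \o c) s by exact: smooth_at_nbhs.
pose w s := 'D_(X s) (cmap z \o c) s.
pose omz i (r : 'rV[R]_dT) := om C (cinv z r) (dplot (cinv z) r (delta_mx 0 i)).
apply: (@smooth_at_near _ _ _ (fun s => \sum_i w s 0 i *: omz i (cmap z (c s)))).
  (* [psmooth] gives continuity at t only; nearby, c is recovered as [cinv z] of its smooth
     coordinates. *)
  have Nc : \forall s \near t, {for s, continuous c}.
    move: Nz N => /near_openP[U [oU Ut HU]] /near_openP[V [oV Vt HV]].
    have : \forall s \near t, \forall s' \near s, cinv z (cmap z (c s')) = c s'.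
      have cK : \forall s \near t, cinv z (cmap z (c s)) = c s by exact: near_cinvK.
      by exact: (near_join cK).
    have : \forall s \near t, U s /\ V s.
      near=> s; split; near: s; exact: open_nbhs_nbhs.
    apply: filterS2 => s [Us Vs] Ns.
    apply: near_eq_continuous (Ns) _.
    apply: (@continuous_comp _ _ _ (cmap z \o c) (cinv z)).
      exact: smooth_at_continuous (HU _ Us).
    exact: cinv_cont (HV _ Vs).
  apply: filterS3 Nz N Nc => s szs zs cs.
  have ps : psmooth c s by exact: psmooth_of_plot cs zs szs.
  rewrite (dplot_chart _ (psmooth_pdiff ps) zs (smooth_at_differentiable szs)).
  rewrite -/(w s) /omz cmapK //.
  have pz : pdiff (cinv z) (cmap z (c s)) by exact/psmooth_pdiff/psmooth_cinv.
  have dl : linear (dplot (cinv z) (cmap z (c s))) by move=> a x y; rewrite dplotD // dplotZ.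
  have ol : linear (om C (c s)) by exact: om_linear.
  have ll : linear (fun v => om C (c s) (dplot (cinv z) (cmap z (c s)) v)).
    by move=> a x y /=; rewrite dl ol.
  exact/esym/(congr1 (fun h => h (w s)) (linear_rV_sum ll)).
apply: smooth_at_sum => i; apply: smooth_at_scale.
  have sw : smooth_at w t by exact: smooth_at_derive_var.
  by move: sw => /smooth_at_mxP; apply.
apply: (smooth_at_comp szc (g := omz i)).
apply: smooth_atW (om_smooth C z (delta_mx 0 i)); first exact: cimg_open.
by exists (c t).
Unshelve. all: by end_near. Qed.

(** The chosen lifts need not depend smoothly on the point. Along a local section s the lift
    [tmap s xi] does, and equivariance spreads smoothness from the image of s to the whole preimage
    of U. *)
Lemma smooth_tractor_conn xi f u : tractor_section C W f -> smooth_vf setT xi ->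
  fsmooth (tractor_conn C W xi f) u.
Proof.
move=> Hf sxi; have [_ ef] := Hf.
set F := tractor_conn C W xi f.
have [U [s [g [[oU Ux] ss sg Hs Hu]]]] := ptriv C (pproj C u).
set x := pproj C u in Ux.
have oV := open_pproj C oU.
have sat y : U y -> msmooth s y by move=> Uy; exact: (smooth_map_at oU Uy).
have FE w : U (pproj C w) -> F w = W (invmx (g w)) *m (F \o s) (pproj C w).
  by move=> /Hu[Pg {1}->]; rewrite /F tractor_conn_equivariant.
have NV : \forall w \near u, U (pproj C w) by apply: open_nbhs_nbhs.
have sFs : fsmooth (F \o s) x.
  pose c := s \o cinv x; pose X := vf_coord x xi.
  have sX t : (cmap x @` cdom x) t -> smooth_at X t.
    move=> Ht; apply: smooth_atW (sxi x); rewrite setIT //.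
    exact: cimg_open.
  have sc : psmooth c (cmap x x) by exact: sat.
  have NU : \forall t \near cmap x x, (cmap x @` (cdom x `&` U)) t.
    apply: open_nbhs_nbhs; split; first exact: open_chart.
    by exists x => //; split=> //; exact: cdom_mem.
  apply: (@smooth_at_near _ _ _ (fun t => 'D_(X t) (f \o c) t +
     drho W (om C (c t) (dplot c t (X t))) *m (f \o c) t)).
    apply: filterS NU => _ [y [xy Uy] <-].
    have cE : c (cmap x y) = s y by rewrite /c /= cmapK.
    have XE : X (cmap x y) = 'D_(xi y) (cmap x \o cinv y) (cmap y y).
      by rewrite /X /vf_coord cmapK.
    have pcy : pdiff (cinv x) (cmap x y) by exact/psmooth_pdiff/psmooth_cinv.
    have sy : mdiff s (cinv x (cmap x y)) by rewrite (cmapK xy); exact: msmooth_mdiff (sat _ Uy).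
    have [pc dcE] := pdiff_map (X (cmap x y)) pcy sy.
    have fc : fdiff f (c (cmap x y)) by exact/fsmooth_fdiff/section_smooth.
    have [_ dfE] := pdiff_fun (X (cmap x y)) pc fc.
    have dcE' : dplot c (cmap x y) (X (cmap x y)) = tmap s y (xi y).
      by rewrite [LHS]dcE cmapK // XE dplot_cinv_vf.
    have lE : tmap (pproj C) (s y) (tmap s y (xi y)) = xi (pproj C (s y)).
      rewrite (tmap_section (xi y) oU Uy (sat _ Uy)); first by have [-> _] := Hs y Uy.
      by move=> y' /Hs[].
    rewrite [X in X + _]dfE dcE' /comp cE (cmapK xy).
    by rewrite /F (tractor_connE Hf lE).
  have XX : smooth_at X (cmap x x) by apply: sX; exists x => //; exact: cdom_mem.
  have sfc : smooth_at (f \o c) (cmap x x) by apply: psmooth_fun => //; exact: section_smooth.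
  apply: smooth_at_add; first exact: smooth_at_derive_var.
  apply: smooth_at_mulmx => //.
  apply: (smooth_drho u); first by apply: near_all => t; exact: om_in.
  exact: smooth_om.
have NVc : \forall t \near cmap u u, U (pproj C (cinv u t)).
  by apply: (near_cinv (P := fun w => U (pproj C w))).
apply: (@smooth_at_near _ _ _ (fun t => W (invmx (g (cinv u t))) *m
    ((F \o s) \o pproj C \o cinv u) t)).
  by apply: filterS NVc => t Ut; rewrite /= [RHS]FE.
apply: smooth_at_mulmx.
  have sgu : smooth_at (g \o cinv u) (cmap u u) by exact: (smooth_fun_at oV).
  have Pg : \forall t \near cmap u u, P ((g \o cinv u) t).
    by apply: filterS NVc => t /Hu[].
  apply: (@rho_at _ _ _ _ W _ (fun t => invmx (g (cinv u t)))).
    by apply: filterS Pg => t Pgt; exact/PG'/(mxgroupV hP).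
  refine (smooth_at_invmx hP Pg sgu).
exact: (fsmooth_comp (pproj_msmooth C u) sFs).
Qed.

Lemma sectionD f f' : tractor_section C W f -> tractor_section C W f' ->
  tractor_section C W (fun u => f u + f' u).
Proof.
move=> Hf Hf'; have [_ ef] := Hf; have [_ ef'] := Hf'; split.
  apply: smooth_funP => u _; apply: (@smooth_at_add _ _ _ (f \o cinv u) (f' \o cinv u));
    exact: section_smooth.
by move=> u a Pa; rewrite ef // ef' // mulmxDr.
Qed.

Lemma fsmooth_pproj (h : M -> R) u : smooth_fun setT h -> fsmooth (h \o pproj C) u.
Proof.
move=> sh; apply: fsmooth_comp; first exact: pproj_msmooth.
exact: (smooth_fun_at openT I).
Qed.

Lemma sectionZ (h : M -> R) f : smooth_fun setT h -> tractor_section C W f ->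
  tractor_section C W (fun u => h (pproj C u) *: f u).
Proof.
move=> sh Hf; have [_ ef] := Hf; split.
  apply: smooth_funP => u _.
  apply: (@smooth_at_scale _ _ _ ((h \o pproj C) \o cinv u) (f \o cinv u)).
    exact: fsmooth_pproj.
  exact: section_smooth.
by move=> u a Pa; rewrite ef // pproj_act // scalemxAr.
Qed.

Lemma tractor_section_conn xi f : tractor_section C W f -> smooth_vf setT xi ->
  tractor_section C W (tractor_conn C W xi f).
Proof.
move=> Hf sxi; split; last by move=> u a; exact: tractor_conn_equivariant.
by apply: smooth_funP => u _; exact: smooth_tractor_conn.
Qed.

Lemma tractor_conn_linear : linear_connection C W (tractor_conn C W).
Proof.
move=> xi eta h f f' sxi seta sh Hf Hf'; split.
- exact: tractor_section_conn.
- move=> u; have [v vE ->] := tractor_connP xi u Hf.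
  have [w wE ->] := tractor_connP eta u Hf.
  have mp : mdiff (pproj C) u by exact/msmooth_mdiff/pproj_msmooth.
  have sf := section_smooth u Hf.
  rewrite -tderivZ // -tderivD //; apply: tractor_connE => //.
  by rewrite tmapD // tmapZ // vE wE.
- move=> u; have [v vE ->] := tractor_connP xi u Hf.
  rewrite (tractor_connE Hf' vE) (tractor_connE (sectionD Hf Hf') vE) /tderiv.
  rewrite mulmxDr addrACA; congr (_ + _).
  by rewrite /dfun (@deriveD _ _ _ (f \o cinv u) (f' \o cinv u)) //;
    apply: smooth_at_derivable; exact: section_smooth.
- move=> u; have [v vE ->] := tractor_connP xi u Hf.
  rewrite (tractor_connE (sectionZ sh Hf) vE) /tderiv scalerDr addrA scalemxAr.
  congr (_ + _).
  have mp : mdiff (pproj C) u by exact/msmooth_mdiff/pproj_msmooth.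
  have hp : fdiff h (pproj C u) by apply: fsmooth_fdiff; exact: (smooth_fun_at openT I).
  have [_ E] := dfun_comp v mp hp; rewrite -vE -E.
  have d1 : derivable ((h \o pproj C) \o cinv u) (cmap u u) v.
    by apply: smooth_at_derivable; exact: fsmooth_pproj.
  have d2 : derivable (f \o cinv u) (cmap u u) v.
    by apply: smooth_at_derivable; exact: section_smooth.
  have [_] := is_derive_scale d1 d2.
  by rewrite /dfun /= cinvxx => <-.
Qed.

End tractor.

(** * Unitary groups *)

Section adjoint.
Variable R : realType.
Local Notation C := R[i].
Local Notation toC := (real_complex R).

Definition cadj m n (A : 'M[C]_(m, n)) : 'M[C]_(n, m) := (map_mx (@conjc R) A)^T.

Lemma cadjM m n p (A : 'M[C]_(m, n)) (B : 'M[C]_(n, p)) :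
  cadj (A *m B) = cadj B *m cadj A.
Proof. by rewrite /cadj map_mxM trmx_mul. Qed.

Lemma cadjK m n (A : 'M[C]_(m, n)) : cadj (cadj A) = A.
Proof. by apply/matrixP => i j; rewrite !mxE conjcK. Qed.

Lemma cadjD m n (A B : 'M[C]_(m, n)) : cadj (A + B) = cadj A + cadj B.
Proof. by rewrite /cadj map_mxD linearD. Qed.

Lemma cadjZ m n a (A : 'M[C]_(m, n)) : cadj (a *: A) = (a^*)%C *: cadj A.
Proof. by rewrite /cadj map_mxZ linearZ. Qed.

Lemma cadj1 n : cadj (1%:M : 'M[C]_n) = 1%:M.
Proof. by rewrite /cadj map_mx1 trmx1. Qed.

Lemma cadj_unit n (A : 'M[C]_n) : (cadj A \in unitmx) = (A \in unitmx).
Proof. by rewrite unitmx_tr map_unitmx. Qed.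

Lemma cadj_form_inj m (A B : 'M[C]_m) :
  (forall x y : 'cV[C]_m, (cadj y *m A *m x) 0 0 = (cadj y *m B *m x) 0 0) -> A = B.
Proof.
move=> H; apply/matrixP => i j.
have E (X : 'M[C]_m) : (cadj (delta_mx i 0 : 'cV[C]_m) *m X *m
    (delta_mx j 0 : 'cV[C]_m)) 0 0 = X i j.
  have -> : cadj (delta_mx i 0 : 'cV[C]_m) = delta_mx 0 i.
    rewrite /cadj map_delta_mx; exact: trmx_delta.
  by rewrite -mulmxA -colE -rowE !mxE.
by rewrite -!E H.
Qed.

Lemma mx_complexE m n (A : 'M[C]_(m, n)) :
  A = map_mx toC (map_mx (@complex.Re R) A) + 'i%C *: map_mx toC (map_mx (@complex.Im R) A).
Proof. by apply/matrixP => i j; rewrite !mxE -complexE. Qed.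

Lemma mx_complex_inj m n (A B A' B' : 'M[R]_(m, n)) :
  map_mx toC A + 'i%C *: map_mx toC B = map_mx toC A' + 'i%C *: map_mx toC B' ->
  A = A' /\ B = B'.
Proof.
move=> /matrixP H; split; apply/matrixP => i j; have := H i j; rewrite !mxE;
by simpc => -[].
Qed.

Section realify.
Variable N : nat.
Implicit Types (A B : 'M[C]_N) (X : 'cV[R]_(N + N)) (x : 'cV[C]_N).

Lemma cvecE X : cvec X = map_mx toC (usubmx X) + 'i%C *: map_mx toC (dsubmx X).
Proof. by apply/colP => i; rewrite !mxE; simpc. Qed.

Lemma cvec_inj : injective (@cvec R N).
Proof.
move=> X Y; rewrite !cvecE => /mx_complex_inj[u d].
by rewrite -(vsubmxK X) u d vsubmxK.
Qed.

Lemma rvecK x : cvec (rvec x) = x.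
Proof. by rewrite cvecE /rvec col_mxKu col_mxKd -mx_complexE. Qed.

Lemma cvecK X : rvec (cvec X) = X.
Proof. by apply: cvec_inj; rewrite rvecK. Qed.

Lemma cvecZ (r : R) X : cvec (r *: X) = r%:C *: cvec X.
Proof. by apply/colP => i; rewrite !mxE; simpc. Qed.

Lemma rvecZ (r : R) x : rvec (r%:C *: x) = r *: rvec x.
Proof. by apply: cvec_inj; rewrite rvecK cvecZ rvecK. Qed.

Lemma complex_mul_mx (a b : 'M[R]_N) (u v : 'cV[R]_N) :
  (map_mx toC a + 'i%C *: map_mx toC b) *m (map_mx toC u + 'i%C *: map_mx toC v) =
  map_mx toC (a *m u - b *m v) + 'i%C *: map_mx toC (b *m u + a *m v).
Proof.
rewrite map_mxB map_mxD !map_mxM mulmxDl !mulmxDr -!scalemxAl -!scalemxAr scalerA.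
rewrite -expr2 sqr_i scaleN1r scalerDr [X in _ + X = _]addrC [LHS]addrACA; congr (_ + _).
exact: addrC.
Qed.

Lemma cvec_realify B X : cvec (realify B *m X) = B *m cvec X.
Proof.
rewrite -{1}(vsubmxK X) /realify mul_block_col !cvecE col_mxKu col_mxKd mulNmx.
by rewrite [X in _ = X *m _](mx_complexE B) complex_mul_mx.
Qed.

Lemma mx_cvec_ext (M M' : 'M[R]_(N + N)) :
  (forall X, cvec (M *m X) = cvec (M' *m X)) -> M = M'.
Proof.
move=> H; apply/matrixP => i j.
have := cvec_inj (H (delta_mx j 0)).
by rewrite -!colE => /colP/(_ i); rewrite !mxE.
Qed.

Lemma realifyM A B : realify (A *m B) = realify A *m realify B.
Proof. by apply: mx_cvec_ext => X; rewrite -mulmxA !cvec_realify mulmxA. Qed.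

Lemma realify1 : realify (1%:M : 'M[C]_N) = 1%:M.
Proof. by apply: mx_cvec_ext => X; rewrite cvec_realify !mul1mx. Qed.

Lemma realifyD A B : realify (A + B) = realify A + realify B.
Proof.
apply: mx_cvec_ext => X; rewrite cvec_realify !mulmxDl !cvecE.
rewrite !(linearD (@usubmx _ N N 1)) !(linearD (@dsubmx _ N N 1)) !map_mxD scalerDr addrACA -!cvecE.
by rewrite !cvec_realify !cvecE.
Qed.

Lemma realifyZ (r : R) A : realify (r%:C *: A) = r *: realify A.
Proof.
by apply: mx_cvec_ext => X; rewrite cvec_realify -!scalemxAl cvecZ cvec_realify.
Qed.

Lemma realify_unit A : A \in unitmx -> realify A \in unitmx.
Proof.
move=> uA; have := realifyM A (invmx A); rewrite mulmxV // realify1 => /esym.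
by move=> /mulmx1_unit[].
Qed.

Lemma realifyV A : A \in unitmx -> realify (invmx A) = invmx (realify A).
Proof.
move=> uA; rewrite -[LHS]mulmx1 -(mulmxV (realify_unit uA)) mulmxA -realifyM.
by rewrite mulVmx // realify1 mul1mx.
Qed.

(** Over the complex numbers, conjugation by the unipotent block matrix T makes the realification
    block triangular, with A and its conjugate on the diagonal. *)
Lemma det_realify A : (\det (realify A))%:C = \det A * (\det A)^*%C.
Proof.
pose r := map_mx toC (map_mx (@complex.Re R) A).
pose s := map_mx toC (map_mx (@complex.Im R) A).
have AE : A = r + 'i%C *: s by exact: mx_complexE.
have AcE : map_mx (@conjc R) A = r - 'i%C *: s.
  by apply/matrixP => i j; rewrite !mxE; case: (A i j) => x y; simpc.
have -> : (\det (realify A))%:C = \det (block_mx r (- s) s r).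
  by rewrite -det_map_mx map_block_mx map_mxN.
pose T : 'M[C]_(N + N) := block_mx 1%:M ('i%C)%:M 0 1%:M.
pose T' : 'M[C]_(N + N) := block_mx 1%:M (- 'i%C)%:M 0 1%:M.
have H : T *m block_mx r (- s) s r *m T' = block_mx A 0 s (map_mx (@conjc R) A).
  rewrite /T /T' !mulmx_block !mul0mx !mulmx0 !mul1mx !mulmx1 !add0r !addr0.
  rewrite !mul_scalar_mx !mul_mx_scalar AcE [in RHS]AE; congr block_mx.
    rewrite scalerDr scalerA mulNr -expr2 sqr_i opprK scale1r scaleNr.
    by rewrite addrA addrK addNr.
  by rewrite scaleNr addrC.
have := congr1 determinant H; rewrite !det_mulmx det_lblock det_map_mx.
by rewrite /T /T' !det_ublock !det1 !mul1r !mulr1.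
Qed.

Lemma Re_dot (X Y : 'cV[R]_(N + N)) :
  complex.Re ((cadj (cvec Y) *m cvec X) 0 0) = (Y^T *m X) 0 0.
Proof.
have ReS (I : finType) (F : I -> C) :
    complex.Re (\sum_i F i) = \sum_i complex.Re (F i).
  by apply: (big_morph (@complex.Re R)) => // -[a b] [c d].
rewrite -{2}(vsubmxK X) -{2}(vsubmxK Y) tr_col_mx mul_row_col !mxE ReS -big_split.
by apply: eq_bigr => i _; rewrite !mxE /=; simpc; ring.
Qed.

End realify.
End adjoint.

Section real_form.
Variables (R : realType) (N : nat) (h : 'M[R[i]]_N) (r : nat).
Hypothesis hs : herm_signature h r.
Local Notation C := R[i].

(** Hermitian symmetry is inherited from the real diagonal matrix to which the signature hypothesis
    makes h congruent. *)
Lemma herm_adj_h : cadj h = h.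
Proof.
have [B uB HB] := hs; have [D DE] : exists D, D = cadj B *m h *m B by eexists.
have DD : cadj D = D.
  rewrite DE /cadj HB; apply/matrixP => i j; rewrite !mxE.
  have [->|ij] := eqVneq j i; last by rewrite !mulr0n conjc0.
  by rewrite !mulr1n; case: ifP => _; rewrite ?rmorphN ?rmorph1.
have uA : cadj B \in unitmx by rewrite cadj_unit.
have E : h = invmx (cadj B) *m D *m invmx B.
  by rewrite DE -!mulmxA mulmxV // mulmx1 mulKmx.
have aV (X : 'M[C]_N) : cadj (invmx X) = invmx (cadj X).
  by rewrite /cadj map_invmx trmx_inv.
by rewrite E !cadjM DD !aV cadjK mulmxA.
Qed.

Lemma herm_h_unit : h \in unitmx.
Proof.
have [B uB HB] := hs.
have : \det (diag_mx (\row_(i < N) (if (i < r)%N then 1 else -1)) : 'M[C]_N) != 0.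
  rewrite det_diag; apply/prodf_neq0 => i _; rewrite mxE.
  by case: ifP; rewrite ?oppr_eq0 oner_eq0.
by rewrite -HB !det_mulmx !mulf_eq0 !negb_or unitmxE unitfE => /andP[/andP[]].
Qed.

Lemma herm_swap x y : herm h y x = (herm h x y)^*%C.
Proof.
have -> : (herm h x y)^*%C = cadj (cadj y *m h *m x) 0 0.
  by rewrite {1}/cadj [RHS]mxE [RHS]mxE.
rewrite !cadjM cadjK herm_adj_h mulmxA. reflexivity.
Qed.

Lemma herm_addl x x' y : herm h (x + x') y = herm h x y + herm h x' y.
Proof. by rewrite /herm mulmxDr mxE. Qed.

Lemma herm_scalel a x y : herm h (a *: x) y = a * herm h x y.
Proof. by rewrite /herm -scalemxAr mxE. Qed.

Lemma herm_addr x y y' : herm h x (y + y') = herm h x y + herm h x y'.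
Proof. by rewrite !(herm_swap _ x) herm_addl rmorphD. Qed.

Lemma herm_scaler a x y : herm h x (a *: y) = (a^*)%C * herm h x y.
Proof. by rewrite !(herm_swap _ x) herm_scalel rmorphM. Qed.

Definition isometries : set 'M[C]_N := [set B | cadj B *m h *m B = h].

Lemma isometryP B :
  (forall x y, herm h (B *m x) (B *m y) = herm h x y) <-> isometries B.
Proof.
have E x y : herm h (B *m x) (B *m y) = (cadj y *m (cadj B *m h *m B) *m x) 0 0.
  by rewrite -[LHS]/((cadj (B *m y) *m h *m (B *m x)) 0 0) cadjM !mulmxA.
split=> [H|H x y]; last by rewrite E H.
by apply: cadj_form_inj => x y; rewrite -E H.
Qed.

Lemma isometryM A B : isometries A -> isometries B -> isometries (A *m B).
Proof.
move=> /isometryP HA /isometryP HB; apply/isometryP => x y.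
by rewrite -!mulmxA HA HB.
Qed.

Lemma isometry_unit B : isometries B -> B \in unitmx.
Proof.
move=> HB; have := herm_h_unit; rewrite -{1}HB !unitmx_mul.
by move=> /andP[_].
Qed.

Lemma isometryV B : isometries B -> isometries (invmx B).
Proof.
move=> HB; have uB := isometry_unit HB; move/isometryP: HB => HB; apply/isometryP => x y.
by rewrite -HB !mulmxA mulmxV // !mul1mx.
Qed.

Lemma isometry_det B : isometries B -> \det B * (\det B)^*%C = 1.
Proof.
move=> HB; have := congr1 determinant HB; rewrite !det_mulmx det_tr det_map_mx.
have h0 : \det h != 0 by rewrite -unitfE -unitmxE herm_h_unit.
move=> E; apply: (mulfI h0); rewrite mulr1 -[RHS]E; ring.
Qed.

Lemma isometry_SO B : isometries B -> SOgroup h (realify B).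
Proof.
move=> HB; split=> [x y|].
  by rewrite !cvec_realify; move/isometryP: HB => ->.
by apply: (@complexI R); rewrite det_realify isometry_det.
Qed.

(** Exhibits [realify h] as the Gram matrix of the real form, so that SO(V) becomes a matrix
    equation. *)
Lemma Re_herm X Y :
  complex.Re (herm h (cvec X) (cvec Y)) = (Y^T *m realify h *m X) 0 0.
Proof.
by rewrite -[herm _ _ _]/((cadj (cvec Y) *m h *m cvec X) 0 0) -!mulmxA -cvec_realify Re_dot.
Qed.

Lemma tr_form_inj m (A B : 'M[R]_m) :
  (forall x y : 'cV[R]_m, (y^T *m A *m x) 0 0 = (y^T *m B *m x) 0 0) -> A = B.
Proof.
move=> H; apply/matrixP => i j.
have E (X : 'M[R]_m) :
    ((delta_mx i 0 : 'cV[R]_m)^T *m X *m (delta_mx j 0 : 'cV[R]_m)) 0 0 = X i j.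
  by rewrite trmx_delta -mulmxA -colE -rowE !mxE.
by rewrite -!E H.
Qed.

Lemma SO_form A : SOgroup h A -> A^T *m realify h *m A = realify h.
Proof.
move=> [HA _]; apply: tr_form_inj => x y.
by rewrite -Re_herm -HA Re_herm trmx_mul !mulmxA.
Qed.

Lemma SO_unit A : SOgroup h A -> A \in unitmx.
Proof. by move=> [_ dA]; rewrite unitmxE dA unitr1. Qed.

(** Solves the isometry equation for the inverse; it supplies the field [mxgroup_adj]. *)
Lemma SO_inv A : SOgroup h A ->
  invmx A = invmx (realify h) *m A^T *m realify h.
Proof.
move=> HA; have uA := SO_unit HA; have uh := realify_unit herm_h_unit.
apply: (can_inj (mulmxK uA)); rewrite mulVmx //.
by rewrite -!mulmxA (mulmxA A^T) SO_form // mulVmx.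
Qed.

Lemma SO_group1 : SOgroup h 1%:M.
Proof. by split=> [x y|]; rewrite ?mul1mx ?det1. Qed.

Lemma SO_groupM A B : SOgroup h A -> SOgroup h B -> SOgroup h (A *m B).
Proof.
move=> [HA dA] [HB dB]; split=> [x y|]; last by rewrite det_mulmx dA dB mulr1.
by rewrite -!mulmxA HA HB.
Qed.

Lemma SO_groupV A : SOgroup h A -> SOgroup h (invmx A).
Proof.
move=> HA; have uA := SO_unit HA; have [HA' dA] := HA.
split=> [x y|]; last by rewrite det_inv dA invr1.
by rewrite -HA' !mulmxA mulmxV // !mul1mx.
Qed.

Lemma SO0_sub A : SO0group h A -> SOgroup h A.
Proof. exact: connected_component_sub. Qed.

Lemma SO0_1 : SO0group h 1%:M.
Proof. exact/connected_component_refl/SO_group1. Qed.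

Lemma connected_SO0 (S : set 'M[R]_(N + N)) A B : connected S ->
  S `<=` SOgroup h -> S A -> SO0group h A -> S B -> SO0group h B.
Proof.
move=> cS SO SA HA SB; apply: (connected_component_trans HA).
exact: (connected_component_max SA SO cS).
Qed.

Lemma translate_connected (A : 'M[R]_(N + N)) (S : set 'M[R]_(N + N)) :
  connected S -> connected ((fun X : 'M[R]_(N + N) => A *m X) @` S).
Proof.
move=> cS; apply: connected_continuous_connected => //.
apply: continuous_subspaceT => X; apply: smooth_at_continuous.
apply: (@smooth_at_mulmx _ _ _ _ _ (fun=> A) id); first exact: smooth_at_cst.
exact: smooth_at_id.
Qed.

(** The translate of the component by A is connected, lies in SO(V) and contains A. *)
Lemma SO0_M A B : SO0group h A -> SO0group h B -> SO0group h (A *m B).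
Proof.
move=> HA HB.
have cS : connected ((fun X : 'M[R]_(N + N) => A *m X) @` SO0group h).
  exact/translate_connected/component_connected.
apply: (connected_SO0 cS _ _ HA).
- move=> _ [X HX <-]; apply: SO_groupM; exact: SO0_sub.
- by exists 1%:M; [exact: SO0_1|rewrite mulmx1].
- by exists B.
Qed.

Lemma SO0_V A : SO0group h A -> SO0group h (invmx A).
Proof.
move=> HA.
have cS : connected ((fun X : 'M[R]_(N + N) => invmx A *m X) @` SO0group h).
  exact/translate_connected/component_connected.
apply: (connected_SO0 cS _ _ SO0_1).
- move=> _ [X HX <-]; apply: SO_groupM; last exact: SO0_sub.
  exact/SO_groupV/SO0_sub.
- by exists A => //; rewrite mulVmx //; exact/SO_unit/SO0_sub.
- by exists 1%:M; [exact: SO0_1|rewrite mulmx1].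
Qed.

Lemma SO0_mxgroup : mxgroup (SO0group h).
Proof.
split.
- exact: SO0_1.
- exact: SO0_M.
- exact: SO0_V.
- by move=> a /SO0_sub/SO_unit.
- by exists (invmx (realify h)), (realify h) => a /SO0_sub/SO_inv.
Qed.

Lemma SO0_path (g : R -> 'M[R]_(N + N)) : (forall t, smooth_at g t) ->
  (forall t, SOgroup h (g t)) -> SO0group h (g 0) -> forall t, SO0group h (g t).
Proof.
move=> sg Sg g0 t.
have cS : connected (g @` setT).
  apply: connected_continuous_connected.
    by apply/connected_intervalP => x y _ _ z _.
  by apply: continuous_subspaceT => x; exact: smooth_at_continuous.
apply: (connected_SO0 cS _ _ g0).
- by move=> _ [s _ <-].
- by exists 0.
- by exists t.
Qed.

End real_form.

(** * The unit circle and the curves that it generates *)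

Section cis.
Variable R : realType.
Local Notation C := R[i].

Definition cis (t : R) : C := cos t +i* sin t.

Lemma cis0 : cis 0 = 1.
Proof. by rewrite /cis cos0 sin0. Qed.

Lemma cisD s t : cis (s + t) = cis s * cis t.
Proof. by rewrite /cis cosD sinD; simpc; congr (_ +i* _); rewrite addrC mulrC. Qed.

Lemma cis_conj t : (cis t)^*%C = cis (- t).
Proof. by rewrite /cis cosN sinN. Qed.

Lemma cis_unit t : (cis t)^*%C * cis t = 1.
Proof. by rewrite cis_conj -cisD addNr cis0. Qed.

Lemma cis_neq0 t : cis t != 0.
Proof. by apply/eqP => c0; have /eqP := cis_unit t; rewrite c0 mulr0 eq_sym oner_eq0. Qed.

Lemma cisX t n : cis t ^+ n = cis (n%:R * t).
Proof.
elim: n => [|n IH]; first by rewrite expr0 mul0r cis0.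
by rewrite exprS IH -cisD mulrSr mulrDl mul1r addrC.
Qed.

Lemma cis_surj (z : C) : z^*%C * z = 1 -> exists t, z = cis t.
Proof.
case: z => x y; simpc => -[]; rewrite ?mulNr ?opprK => xy _.
have x1 : -1 <= x <= 1.
  rewrite -ler_norml -(@expr_le1 _ 2) // real_normK ?num_real // expr2 -xy lerDl.
  by rewrite -expr2 sqr_ge0.
have sE : sin (acos x) = `|y|.
  rewrite sin_acos // -sqrtr_sqr; congr Num.sqrt.
  by rewrite -xy !expr2; ring.
have cE : cos (acos x) = x by rewrite acosK // in_itv.
have [y0|y0] := leP 0 y.
  by exists (acos x); rewrite /cis cE sE ger0_norm.
by exists (- acos x); rewrite /cis cosN sinN cE sE ltr0_norm // opprK.
Qed.

Lemma polar (z : C) : z != 0 -> exists r t : R, 0 < r /\ z = r%:C * cis t.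
Proof.
move=> z0; have n0 : 0 < `|z| by rewrite normr_gt0.
have zE := sqr_normc z.
have nE : `|z| = (complex.Re `|z|)%:C by rewrite RRe_real // normr_real.
set r := complex.Re `|z| in nE.
have r0 : 0 < r by rewrite -ltcR -nE.
have rn0 : r%:C != 0 by rewrite -nE gt_eqF.
have zr1 (rc : C) : rc^*%C = rc -> `|z| = rc -> rc != 0 ->
    (z / rc)^*%C * (z / rc) = 1.
  move=> rcc rcE rc0; rewrite rmorphM fmorphV /= rcc.
  rewrite rcE expr2 in zE; have -> : z^*%C / rc * (z / rc) = z * z^*%C / (rc * rc) by field.
  by rewrite -zE divff // mulf_neq0.
have [|t tE] := @cis_surj (z / r%:C); first exact: zr1 (conjc_real r) nE rn0.
by exists r, t; split=> //; rewrite -tE mulrC divfK.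
Qed.

Section rcis.
Variable N : nat.

Lemma realify_cis t (B : 'M[C]_N) :
  realify (cis t *: B) = cos t *: realify B + sin t *: realify ('i%C *: B).
Proof.
have -> : cis t = (cos t)%:C + (sin t)%:C * 'i%C by rewrite /cis; simpc.
by rewrite scalerDl -scalerA realifyD !realifyZ.
Qed.

Lemma smooth_at_lin (f : R -> R) (c t : R) : smooth_at f (c * t) ->
  smooth_at (fun t => f (c * t)) t.
Proof.
move=> sf; have := @smooth_at_affine _ R R R ( *:%R c) 0 f t (@scaler_continuous _ _ c).
rewrite addr0 => /(_ sf).
have -> : (fun y : R => f (c *: y + 0)) = (fun t => f (c * t)) => //.
by apply/funext => s; rewrite addr0.
Qed.

Lemma smooth_rcis (c : R) (B : 'M[C]_N) (t : R) :
  smooth_at (fun t : R => realify (cis (c * t) *: B)) t.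
Proof.
have -> : (fun t => realify (cis (c * t) *: B)) =
   fun t => cos (c * t) *: realify B + sin (c * t) *: realify ('i%C *: B).
  by apply/funext => s; exact: realify_cis.
apply: smooth_at_add; apply: smooth_at_scale; try exact: smooth_at_cst.
  exact/smooth_at_lin/smooth_at_cos.
exact/smooth_at_lin/smooth_at_sin.
Qed.

Lemma derive_rcis (c : R) (B : 'M[C]_N) :
  'D_1 (fun t : R => realify (cis (c * t) *: B)) 0 = c *: realify ('i%C *: B).
Proof.
have dlin (f : R -> R) df : (forall v x, derivable f x v /\ 'D_v f x = v * df x) ->
    is_derive (0 : R) (1 : R) (fun t => f (c * t)) (c * df 0).
  move=> Hf; have -> : (fun t => f (c * t)) = (fun t : R => f (t *: c + 0)).
    by apply/funext => s; rewrite addr0 mulrC.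
  have [d1 d2] := Hf c (0 *: c + 0 : R); split; first exact: derivable_line.
  by rewrite derive_line d2 scale0r add0r.
have -> : (fun t => realify (cis (c * t) *: B)) =
   fun t => cos (c * t) *: realify B + sin (c * t) *: realify ('i%C *: B).
  by apply/funext => s; exact: realify_cis.
have [dc1 dc2] : is_derive (0 : R) (1 : R) (fun t => cos (c * t)) (c * - sin 0).
  apply: (dlin (@cos R) (fun x => - sin x)) => v x.
  by have [? ->] := derive_cosE v x; rewrite mulrN mulNr.
have [ds1 ds2] : is_derive (0 : R) (1 : R) (fun t => sin (c * t)) (c * cos 0).
  by apply: (dlin (@sin R) (@cos R)) => v x; have [? ->] := derive_sinE v x.
have k1 : derivable (fun=> realify B) (0 : R) 1 by exact: derivable_cst.
have k2 : derivable (fun=> realify ('i%C *: B)) (0 : R) 1 by exact: derivable_cst.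
have [a1 a2] := is_derive_scale dc1 k1.
have [b1 b2] := is_derive_scale ds1 k2.
rewrite (deriveD a1 b1) a2 b2 dc2 ds2 (derive_cst (realify B)) (derive_cst (realify ('i%C *: B))).
by rewrite sin0 cos0 oppr0 mulr0 mulr1 scale0r !scaler0 !addr0 add0r.
Qed.

End rcis.
End cis.

(** * Quasi-reflections and the identity component *)

Section unitary_connected.
Variables (R : realType) (N : nat) (h : 'M[R[i]]_N) (r : nat).
Hypothesis hs : herm_signature h r.
Local Notation C := R[i].
Local Notation herm := (herm h).

(** For a non-null, this multiplies a by w and fixes the orthogonal complement of a. *)
Definition quasi_reflection (a : 'cV[C]_N) (w : C) : 'M[C]_N :=
  1%:M + ((w - 1) / herm a a) *: (a *m (cadj a *m h)).

Lemma mul_col_form (a b x : 'cV[C]_N) : a *m (cadj b *m h) *m x = herm x b *: a.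
Proof. by rewrite -mulmxA [X in a *m X]mx11_scalar mul_mx_scalar. Qed.

Lemma quasi_reflectionE a w x : quasi_reflection a w *m x =
  x + ((w - 1) / herm a a * herm x a) *: a.
Proof. by rewrite mulmxDl mul1mx -scalemxAl mul_col_form scalerA. Qed.

Lemma quasi_reflection_isometry a w : herm a a != 0 -> w^*%C * w = 1 ->
  isometries h (quasi_reflection a w).
Proof.
move=> a0 w1; apply/isometryP => x y.
rewrite !quasi_reflectionE !(herm_addl, herm_scalel).
rewrite !(herm_addr hs, herm_scaler hs) !rmorphM fmorphV rmorphB rmorph1 /=.
rewrite -!(herm_swap hs).
set s := herm a a in a0 *; set p := herm x a; set q := herm a y.
transitivity (herm x y + (w^*%C * w - 1) / s * q * p); first by field.
by rewrite w1 subrr !mul0r addr0.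
Qed.

Lemma quasi_reflection_SO0 a w : herm a a != 0 -> w^*%C * w = 1 ->
  SO0group h (realify (quasi_reflection a w)).
Proof.
move=> a0 /cis_surj[t ->].
pose K := (herm a a)^-1 *: (a *m (cadj a *m h)).
pose g s := realify (quasi_reflection a (cis s)).
have gE s : g s = realify (1%:M - K) + realify (cis (1 * s) *: K).
  rewrite -realifyD mul1r /g /quasi_reflection /K; congr realify.
  rewrite -addrA; congr (_ + _).
  by rewrite -scalerA scalerBl scale1r addrC.
have sg s : smooth_at g s.
  have -> : g = fun s => realify (1%:M - K) + realify (cis (1 * s) *: K).
    by apply/funext.
  by apply: smooth_at_add; [exact: smooth_at_cst|exact: smooth_rcis].
apply: (SO0_path sg) => [s|].
  exact/(isometry_SO hs)/quasi_reflection_isometry/cis_unit.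
by rewrite /g /quasi_reflection cis0 subrr mul0r scale0r addr0 realify1; exact: SO0_1.
Qed.

(** Vectors of equal norm with non-null difference are exchanged by a quasi-reflection along that
    difference, as in the Cartan-Dieudonne theorem; over the complex numbers w has to be adjusted to
    the phase of <e, f>. *)
Lemma quasi_reflection_map e f (eps : C) : eps^*%C = eps ->
  herm e e = eps -> herm f f = eps -> herm (f - e) (f - e) != 0 ->
  exists2 w, w^*%C * w = 1 & quasi_reflection (f - e) w *m e = f.
Proof.
move=> er ee ff; have hB x y z : herm x (y - z) = herm x y - herm x z.
  by rewrite (herm_addr hs) -scaleN1r (herm_scaler hs) rmorphN1 mulN1r.
have hBl x y z : herm (x - y) z = herm x z - herm y z.
  by rewrite herm_addl -scaleN1r herm_scalel mulN1r.
set c := herm e f.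
have cE : herm f e = c^*%C by rewrite (herm_swap hs).
have sE : herm (f - e) (f - e) = eps *+ 2 - c - c^*%C.
  by rewrite hB !hBl ee ff cE -/c; ring.
rewrite sE => s0; set s := eps *+ 2 - c - c^*%C in s0 *.
have ce0 : c - eps != 0.
  apply: contra s0; rewrite subr_eq0 => /eqP cE'.
  by rewrite /s cE' er; apply/eqP; ring.
have cce0 : c^*%C - eps != 0.
  by apply: contra ce0 => /eqP H; rewrite -conjc_eq0 rmorphB /= er H.
(* Solves (w - 1)/s * <e, f - e> = 1, where <e, f - e> = c - eps. It has modulus 1 because it equals
   minus the quotient of the conjugate of c - eps by c - eps. *)
exists (1 + s / (c - eps)).
  have -> : 1 + s / (c - eps) = - ((c^*%C - eps) / (c - eps)) by rewrite /s; field.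
  rewrite rmorphN rmorphM fmorphV !rmorphB /= conjcK er; field.
  by rewrite ce0 cce0.
rewrite quasi_reflectionE sE -/s hB ee -/c.
have -> : (1 + s / (c - eps) - 1) / s * (c - eps) = 1 by field; rewrite s0 ce0.
by rewrite scale1r addrC subrK.
Qed.

Lemma herm_basis : exists e : 'I_N -> 'cV[C]_N,
  [/\ forall i j, i != j -> herm (e i) (e j) = 0,
      forall i, herm (e i) (e i) = 1 \/ herm (e i) (e i) = -1 &
      forall A : 'M[C]_N, (forall i, A *m e i = e i) -> A = 1%:M].
Proof.
have [B uB HB] := hs; exists (fun i => col i B).
have E i j : herm (col i B) (col j B) = (cadj B *m h *m B) j i.
  rewrite -[LHS]/((cadj (col j B) *m h *m col i B) 0 0) !colE cadjM.
  have -> : cadj (delta_mx j 0 : 'cV[C]_N) = delta_mx 0 j.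
    rewrite /cadj map_delta_mx; exact: trmx_delta.
  by rewrite !mulmxA -colE -!mulmxA -rowE !mxE.
split=> [i j ij|i|A HA].
- by rewrite E [cadj _]/cadj HB !mxE eq_sym (negbTE ij).
- rewrite E [cadj _]/cadj HB !mxE eqxx mulr1n.
  by case: ifP => _; [left|right].
- apply: (can_inj (mulmxK uB)); rewrite mul1mx; apply/matrixP => i j.
  by have /colP/(_ i) := HA j; rewrite colE mulmxA -!colE !mxE.
Qed.
End unitary_connected.

Section unitary_SO0.
Variables (R : realType) (N : nat) (h : 'M[R[i]]_N) (r : nat).
Hypothesis hs : herm_signature h r.
Local Notation C := R[i].

(** The orthogonal basis vectors are brought back to themselves one at a time by quasi-reflections
    that keep the earlier ones fixed. *)
Lemma isometry_SO0 B : isometries h B -> SO0group h (realify B).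
Proof.
have [e [e_orth e_norm e_gen]] := herm_basis hs.
(* The first m basis vectors are already fixed, and d bounds the number of those left. *)
suff H (d m : nat) : (N <= m + d)%N -> forall B, isometries h B ->
    (forall i : 'I_N, (i < m)%N -> B *m e i = e i) -> SO0group h (realify B).
  by move=> HB; apply: (H N 0%N).
elim: d m => [|d IH] m Nm {}B HB fixB.
  rewrite (e_gen B) ?realify1; first exact: SO0_1.
  by move=> i; apply: fixB; apply: leq_trans (ltn_ord i) _; rewrite addn0 in Nm.
have [Nm'|mN] := leqP N m.
  rewrite (e_gen B) ?realify1; first exact: SO0_1.
  by move=> i; apply: fixB; exact: leq_trans (ltn_ord i) Nm'.
pose k := Ordinal mN.
have neqk (i : 'I_N) : (i < m)%N -> i != k.
  by move=> im; apply/eqP => ik; rewrite ik ltnn in im.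
have [eps [eE er e0]] : exists eps : C,
    [/\ herm h (e k) (e k) = eps, eps^*%C = eps & eps != 0].
  exists (herm h (e k) (e k)); split=> //.
    by case: (e_norm k) => ->; rewrite ?rmorphN rmorph1.
  by case: (e_norm k) => ->; rewrite ?oppr_eq0 oner_eq0.
have step A : isometries h A -> (forall i : 'I_N, (i < m)%N -> A *m e i = e i) ->
    herm h (A *m e k - e k) (A *m e k - e k) != 0 -> SO0group h (realify A).
  move=> HA fixA s0; have HA' := (isometryP _ _).2 HA.
  have [w w1 wE] := quasi_reflection_map hs er eE (etrans (HA' _ _) eE) s0.
  set Q := quasi_reflection _ _ _ in wE.
  have HQ : isometries h Q by exact: (quasi_reflection_isometry hs s0 w1).
  have uQ := isometry_unit hs HQ.
  (* A fixes [e i] and preserves the form, so [e i] is orthogonal to [A *m e k] as well as to [e k],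
     hence to their difference. *)
  have fixQ (i : 'I_N) : (i < m)%N -> Q *m e i = e i.
    move=> im; rewrite quasi_reflectionE; set z := herm h (e i) _.
    suff -> : z = 0 by rewrite mulr0 scale0r addr0.
    rewrite /z (herm_addr hs) -scaleN1r (herm_scaler hs) -{1}(fixA i im) HA'.
    by rewrite e_orth ?neqk // mulr0 addr0.
  have -> : A = Q *m (invmx Q *m A) by rewrite mulmxA mulmxV // mul1mx.
  rewrite realifyM; apply: SO0_M; first exact: (quasi_reflection_SO0 hs s0 w1).
  apply: (IH m.+1); first by rewrite addSnnS.
    exact: (isometryM (isometryV hs HQ) HA).
  move=> i; rewrite ltnS leq_eqVlt => /orP[/eqP im|im].
    have -> : i = k by exact: val_inj.
    by rewrite -mulmxA -wE mulmxA mulVmx // mul1mx.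
  by rewrite -mulmxA (fixA i im) -{1}(fixQ i im) mulmxA mulVmx // mul1mx.
(* If f - e is null, with f = B e, then f + e is not, as the two norms add up to 4 eps. Composing B
   with the reflection that sends e to -e replaces one vector by the other up to sign. *)
have [s0|s0] := eqVneq (herm h (B *m e k - e k) (B *m e k - e k)) 0; last exact: step.
pose Q := quasi_reflection h (e k) (-1).
have ek0 : herm h (e k) (e k) != 0 by rewrite eE.
have w1 : (-1 : C)^*%C * -1 = 1 by rewrite rmorphN1 mulrNN mulr1.
have HQ : isometries h Q by exact: (quasi_reflection_isometry hs ek0 w1).
have uQ := isometry_unit hs HQ.
have Qek : Q *m e k = - e k.
  rewrite quasi_reflectionE eE.
  have -> : (-1 - 1) / eps * eps = - 2%:R :> C by rewrite divfK //; ring.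
  by rewrite scaleNr scaler_nat mulr2n opprD addrA subrr add0r.
have fixQ (i : 'I_N) : (i < m)%N -> Q *m e i = e i.
  by move=> im; rewrite quasi_reflectionE (e_orth _ _ (neqk _ im)) mulr0 scale0r addr0.
have -> : B = B *m Q *m invmx Q by rewrite -mulmxA mulmxV // mulmx1.
rewrite realifyM; apply: SO0_M; last first.
  by rewrite realifyV //; apply: SO0_V; exact: (quasi_reflection_SO0 hs ek0 w1).
apply: step.
- exact: (isometryM HB HQ).
- by move=> i im; rewrite -mulmxA fixQ // fixB.
- rewrite -mulmxA Qek mulmxN.
  move: s0; set f := B *m e k.
  have ff : herm h f f = eps by rewrite ((isometryP _ _).2 HB).
  have hD a b c d' : herm h (a + b) (c + d') =
     herm h a c + herm h a d' + herm h b c + herm h b d'.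
    by rewrite herm_addl !(herm_addr hs) addrA.
  have hN x y : herm h (- x) y = - herm h x y by rewrite -scaleN1r herm_scalel mulN1r.
  have hN' x y : herm h x (- y) = - herm h x y.
    by rewrite -scaleN1r (herm_scaler hs) rmorphN1 mulN1r.
  rewrite !hD !(hN, hN') ff eE => s0.
  apply: contraNneq e0 => s1.
  have : eps *+ 4 = 0.
    by rewrite -[RHS](addr0 0) -{1}s0 -s1; ring.
  by move/eqP; rewrite mulrn_eq0.
Qed.

Lemma SU_SO0 A : SUgroup h A -> SO0group h A.
Proof. by move=> [B [-> /isometryP HB _]]; exact: isometry_SO0. Qed.

Lemma SU_mxgroup : mxgroup (SUgroup h).
Proof.
have [g1 gM gV gU [X [Y XY]]] := SO0_mxgroup hs.
split.
- by exists 1%:M; rewrite realify1 det1; split=> // x y; rewrite !mul1mx.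
- move=> _ _ [A [-> HA dA]] [B [-> HB dB]]; exists (A *m B).
  rewrite realifyM det_mulmx dA dB mulr1; split=> // x y.
  by rewrite -!mulmxA HA HB.
- move=> _ [A [-> /isometryP HA dA]]; exists (invmx A).
  have uA := isometry_unit hs HA.
  rewrite realifyV // det_inv dA invr1; split=> //.
  by apply/isometryP; exact: (isometryV hs HA).
- by move=> a /SU_SO0/gU.
- by exists X, Y => a /SU_SO0/XY.
Qed.

Section parabolic.
Variables (v0 : 'cV[C]_N) (v0_neq0 : v0 != 0).

Lemma P_eigen a z : Pgroup h v0 a -> cvec (a *m rvec v0) = z *: v0 -> z != 0.
Proof.
move=> [/(mxgroupU SU_mxgroup) ua _] E; apply/eqP => z0.
move: E; rewrite z0 scale0r => E; move/eqP: v0_neq0; apply.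
rewrite -(rvecK v0) -(mulKmx ua (rvec v0)) -[a *m _]cvecK E.
have -> : rvec (0 : 'cV[C]_N) = 0.
  by apply: cvec_inj; rewrite rvecK; apply/colP => i; rewrite !mxE.
by rewrite mulmx0; apply/colP => i; rewrite !mxE.
Qed.

Lemma P_mxgroup : mxgroup (Pgroup h v0).
Proof.
have [g1 gM gV gU [X [Y XY]]] := SU_mxgroup.
have E a z : cvec (a *m rvec v0) = z *: v0 -> SUgroup h a ->
    exists B, [/\ a = realify B, isometries h B & B *m v0 = z *: v0].
  move=> Ea [B [aE /isometryP HB _]]; exists B; split=> //.
  by rewrite -Ea aE cvec_realify rvecK.
split.
- by split=> //; exists 1; rewrite mul1mx rvecK scale1r.
- move=> a b [Ga [z Ea]] [Gb [w Eb]]; split; first exact: gM.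
  have [A [aE _ Av]] := E _ _ Ea Ga; have [B [bE _ Bv]] := E _ _ Eb Gb.
  exists (w * z); rewrite aE bE -realifyM cvec_realify rvecK -mulmxA Bv.
  by rewrite -scalemxAr Av scalerA.
- move=> a Pa; have [Ga [z Ea]] := Pa; split; first exact: gV.
  have z0 := P_eigen Pa Ea.
  have [A [aE HA Av]] := E _ _ Ea Ga; have uA := isometry_unit hs HA.
  exists z^-1; rewrite aE -realifyV // cvec_realify rvecK.
  by rewrite -{1}[v0](scale1r) -(mulVf z0) -scalerA -Av -scalemxAr mulKmx.
- by move=> a [/gU].
- by exists X, Y => a [/XY].
Qed.

Lemma Pt_mxgroup : mxgroup (Ptgroup h v0).
Proof.
have [g1 gM gV gU [X [Y XY]]] := SO0_mxgroup hs.
have rv0 : rvec v0 != 0.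
  apply: contra_neq v0_neq0 => E; rewrite -(rvecK v0) E.
  by apply/colP => i; rewrite !mxE.
split.
- by split=> //; exists 1; rewrite mul1mx scale1r.
- move=> a b [Ga [z Ea]] [Gb [w Eb]]; split; first exact: gM.
  by exists (w * z); rewrite -mulmxA Eb -scalemxAr Ea scalerA.
- move=> a [Ga [z Ea]]; split; first exact: gV.
  have ua := gU _ Ga.
  have z0 : z != 0.
    apply: contra_neq rv0 => z0; rewrite -(mulKmx ua (rvec v0)) Ea z0.
    by rewrite scale0r mulmx0.
  exists z^-1.
  by rewrite -{1}[rvec v0]scale1r -(mulVf z0) -scalerA -Ea -scalemxAr mulKmx.
- by move=> a [/gU].
- by exists X, Y => a [/XY].
Qed.

Lemma Pt_of_real b (t : R) : SUgroup h b -> cvec (b *m rvec v0) = t%:C *: v0 ->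
  Ptgroup h v0 b.
Proof.
move=> Gb E; split; first exact: SU_SO0.
by exists t; rewrite -[LHS]cvecK E rvecZ.
Qed.

End parabolic.

(** Sylvester's determinant identity: one block matrix is made triangular in two ways. *)
Lemma det_1DZmul m (c : C) (A : 'M[C]_(N, m)) (B : 'M[C]_(m, N)) :
  \det (1%:M + c *: (A *m B)) = \det (1%:M + c *: (B *m A)).
Proof.
pose M := block_mx (1%:M : 'M[C]_m) (- B) (c *: A) (1%:M : 'M[C]_N).
transitivity (\det M).
  have : block_mx 1%:M 0 (- (c *: A)) 1%:M *m M =
      block_mx 1%:M (- B) 0 (1%:M + c *: (A *m B)).
    rewrite mulmx_block !mul1mx !mul0mx !mulmx1 !addr0 addNr mulNmx mulmxN opprK.
    by rewrite -scalemxAl addrC.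
  move/(congr1 determinant); rewrite det_mulmx det_lblock det_ublock !det1.
  by rewrite !mul1r.
have : block_mx 1%:M B 0 1%:M *m M =
    block_mx (1%:M + c *: (B *m A)) 0 (c *: A) 1%:M.
  by rewrite mulmx_block !mul1mx !mul0mx !mulmx1 !add0r addNr -scalemxAr.
move/(congr1 determinant); rewrite det_mulmx det_ublock det_lblock !det1.
by rewrite !mul1r mulr1.
Qed.

End unitary_SO0.

(** * The circle in P attached to a null vector and a dual null vector *)

Section null_line.
Variables (R : realType) (n r : nat) (h : 'M[R[i]]_n.+2).
Hypotheses (n_gt0 : (0 < n)%N) (hs : herm_signature h r).
Local Notation C := R[i].
Variable v0 : 'cV[C]_n.+2.
Hypotheses (v0_neq0 : v0 != 0) (v0_null : herm h v0 v0 = 0).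

Lemma null_dual : exists w, herm h w w = 0 /\ herm h w v0 = 1.
Proof.
have [j vj] : exists j, (cadj v0 *m h) 0 j != 0.
  apply/existsP; apply: contraNT v0_neq0; rewrite negb_exists => /forallP H.
  have E : cadj v0 *m h = 0.
    by apply/rowP => j; rewrite !mxE; have := H j; rewrite negbK mxE => /eqP.
  have : cadj v0 = 0 by rewrite -(mulmxK (herm_h_unit hs) (cadj v0)) E mul0mx.
  by move=> /(congr1 (@cadj R _ _)); rewrite cadjK /cadj map_mx0 trmx0 => ->.
have [y yv] : exists y, herm h y v0 = 1.
  exists (((cadj v0 *m h) 0 j)^-1 *: delta_mx j 0).
  rewrite herm_scalel -[herm h _ _]/((cadj v0 *m h *m delta_mx j 0) 0 0) -colE.
  by rewrite [X in _ * X]mxE mulVf.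
(* With c half the norm of y, hence real, y - c v0 has norm 2c - c - c = 0 and still pairs to 1 with
   v0. *)
have [c c2] : exists c, herm h y y = c + c.
  exists (herm h y y / 2%:R).
  have h2 : (2%:R : C) != 0 by rewrite pnatr_eq0.
  by rewrite -mulrDl -mulr2n -[_ *+ 2]mulr_natr mulfK.
have cc : c^*%C = c.
  have : (herm h y y)^*%C = herm h y y by rewrite -(herm_swap hs).
  rewrite c2 rmorphD /= => E.
  have h2 : (2%:R : C) != 0 by rewrite pnatr_eq0.
  by apply: (mulIf h2); rewrite mulr_natr [c * _]mulr_natr !mulr2n.
exists (y - c *: v0); split; last first.
  by rewrite herm_addl -scaleNr herm_scalel v0_null mulr0 addr0.
have vy : herm h v0 y = 1 by rewrite (herm_swap hs y) yv rmorph1.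
rewrite -scaleNr herm_addl !(herm_addr hs) !herm_scalel !(herm_scaler hs).
rewrite v0_null yv vy rmorphN /= cc.
rewrite c2; ring.
Qed.

Variable w : 'cV[C]_n.+2.
Hypotheses (w_null : herm h w w = 0) (wv : herm h w v0 = 1).

Let vw : herm h v0 w = 1.
Proof. by rewrite (herm_swap hs w) wv rmorph1. Qed.

(** The orthogonal projection onto the hyperbolic plane spanned by v0 and w. The matrices
    [null_mx a b] below act by a on this plane and by b on its complement. *)
Definition null_proj : 'M[C]_n.+2 := v0 *m (cadj w *m h) + w *m (cadj v0 *m h).

Lemma null_projE x : null_proj *m x = herm h x w *: v0 + herm h x v0 *: w.
Proof. by rewrite mulmxDl !mul_col_form. Qed.

Lemma null_proj_v0 : null_proj *m v0 = v0.
Proof. by rewrite null_projE vw v0_null scale1r scale0r addr0. Qed.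

Lemma null_proj_idem : null_proj *m null_proj = null_proj.
Proof.
rewrite {2}/null_proj mulmxDr !mulmxA null_proj_v0 null_projE w_null wv.
by rewrite scale0r scale1r add0r -!mulmxA.
Qed.

Lemma null_proj_adj : cadj null_proj *m h = h *m null_proj.
Proof.
rewrite /null_proj cadjD !cadjM !cadjK (herm_adj_h hs) mulmxDl mulmxDr addrC.
by rewrite !mulmxA.
Qed.

Definition null_mx (a b : C) : 'M[C]_n.+2 := b *: (1%:M - null_proj) + a *: null_proj.

Lemma null_mxM a b a' b' : null_mx a b *m null_mx a' b' = null_mx (a * a') (b * b').
Proof.
have pQ : null_proj *m (1%:M - null_proj) = 0.
  by rewrite mulmxBr mulmx1 null_proj_idem subrr.
have Qp : (1%:M - null_proj) *m null_proj = 0.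
  by rewrite mulmxBl mul1mx null_proj_idem subrr.
have QQ : (1%:M - null_proj) *m (1%:M - null_proj) = 1%:M - null_proj.
  by rewrite mulmxBl mul1mx pQ subr0.
rewrite /null_mx mulmxDl !mulmxDr -!scalemxAl -!scalemxAr pQ Qp QQ null_proj_idem.
by rewrite !scaler0 addr0 add0r !scalerA.
Qed.

Lemma null_mx1 : null_mx 1 1 = 1%:M.
Proof. by rewrite /null_mx !scale1r subrK. Qed.

Lemma null_mx_v0 a b : null_mx a b *m v0 = a *: v0.
Proof.
rewrite /null_mx mulmxDl -!scalemxAl mulmxBl mul1mx null_proj_v0 subrr.
by rewrite scaler0 add0r.
Qed.

Lemma null_mx_isometry a b : a^*%C * a = 1 -> b^*%C * b = 1 ->
  isometries h (null_mx a b).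
Proof.
move=> a1 b1; have E : cadj (null_mx a b) *m h = h *m null_mx a^*%C b^*%C.
  have E1 : cadj (1%:M - null_proj) *m h = h *m (1%:M - null_proj).
    rewrite -scaleN1r cadjD cadj1 cadjZ rmorphN1 !scaleN1r mulmxBl mulmxBr.
    by rewrite mul1mx mulmx1 null_proj_adj.
  rewrite /null_mx cadjD !cadjZ mulmxDl -!scalemxAl E1 null_proj_adj.
  by rewrite [RHS]mulmxDr !scalemxAr.
by rewrite /isometries /= E -mulmxA null_mxM a1 b1 null_mx1 mulmx1.
Qed.

(** After b is factored out, the rest is the identity plus a multiple of a rank two projection;
    Sylvester's identity turns it into a 2 by 2 determinant, where the Gram block of v0 and w
    becomes the identity. *)
Lemma det_null_mx a b : b != 0 -> \det (null_mx a b) = b ^+ n * a ^+ 2.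
Proof.
move=> b0.
have -> : null_mx a b = b *: (1%:M + (a / b - 1) *: null_proj).
  have -> : b *: (1%:M + (a / b - 1) *: null_proj) = b *: 1%:M + (a - b) *: null_proj.
    by rewrite [LHS]scalerDr scalerA mulrBr mulr1 mulrCA mulfV // mulr1.
  by rewrite /null_mx scalerBr scalerBl -addrA [- _ + _]addrC.
have pE : null_proj = row_mx v0 w *m col_mx (cadj w *m h) (cadj v0 *m h).
  by rewrite mul_row_col.
rewrite detZ pE det_1DZmul mul_col_row.
have f11 (x y : 'cV[C]_n.+2) : cadj x *m h *m y = (herm h y x)%:M by rewrite [LHS]mx11_scalar.
rewrite !f11 vw v0_null w_null wv.
have -> : block_mx (1 : C)%:M (0 : C)%:M (0 : C)%:M (1 : C)%:M = 1%:M :> 'M[C]_(1 + 1).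
  by rewrite !raddf0 -scalar_mx_block.
rewrite scalemx1 -raddfD /= addrC subrK det_scalar.
have -> : b ^+ n.+2 = b ^+ n * (b * b) by rewrite -addn2 exprD expr2.
by rewrite !exprS expr0 !mulr1 -mulrA; congr (_ * _); field.
Qed.

(* The angular speed that gives [null_mx (cis t) (cis (ang * t))]
   determinant one. *)
Let ang : R := - (2%:R / n%:R).

Definition circle_curve (t : R) := realify (null_mx (cis t) (cis (ang * t))).

Lemma circle_curve_SU t : SUgroup h (circle_curve t).
Proof.
exists (null_mx (cis t) (cis (ang * t))); split=> //.
  by apply/isometryP; apply: null_mx_isometry; exact: cis_unit.
rewrite det_null_mx ?cis_neq0 // !cisX -cisD.
have n0 : n%:R != 0 :> R by rewrite pnatr_eq0 -lt0n.
have -> : n%:R * (ang * t) + 2%:R * t = 0 by rewrite /ang; field.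
exact: cis0.
Qed.

Lemma circle_curve_v0 t : cvec (circle_curve t *m rvec v0) = cis t *: v0.
Proof. by rewrite cvec_realify rvecK null_mx_v0. Qed.

Lemma circle_curveD s t : circle_curve (s + t) = circle_curve s *m circle_curve t.
Proof. by rewrite /circle_curve -realifyM null_mxM -!cisD mulrDr. Qed.

Lemma circle_curveE : circle_curve =
  fun t => realify (cis (ang * t) *: (1%:M - null_proj)) + realify (cis (1 * t) *: null_proj).
Proof. by apply/funext => t; rewrite /circle_curve /null_mx realifyD mul1r. Qed.

Lemma smooth_circle_curve : smooth_curve (Pgroup h v0) circle_curve.
Proof.
apply: smooth_curveP => [t|t|].
- by rewrite circle_curveE; apply: smooth_at_add; exact: smooth_rcis.
- by split; [exact: circle_curve_SU|exists (cis t); exact: circle_curve_v0].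
- by rewrite /circle_curve mulr0 !cis0 null_mx1 realify1.
Qed.

(** Both i and E'(0) act by i on the hyperbolic plane; on the complement they act by i and by [ang]
    times i. The difference thus generates rotations of the complement with speed [1 - ang], and
    these fix v0. *)
Let real_curve (t : R) := realify (null_mx 1 (cis ((1 - ang) * t))).

Lemma circle_curve_complement : exists2 a, smooth_curve (Ptgroup h v0) a &
  derive1 a 0 = realify ('i%C)%:M - derive1 circle_curve 0.
Proof.
have rE : real_curve = fun t =>
    realify (cis ((1 - ang) * t) *: (1%:M - null_proj)) + realify null_proj.
  by apply/funext => s; rewrite /real_curve /null_mx realifyD scale1r.
exists real_curve.
  have isom t : isometries h (null_mx 1 (cis ((1 - ang) * t))).
    apply: null_mx_isometry; last exact: cis_unit.
    by rewrite rmorph1 mulr1.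
  apply: smooth_curveP => [t|t|].
  - by rewrite rE; apply: smooth_at_add; [exact: smooth_rcis|exact: smooth_at_cst].
  - split; first exact: (isometry_SO0 hs).
    exists 1; apply: cvec_inj.
    by rewrite cvec_realify cvecZ rvecK null_mx_v0.
  - by rewrite /real_curve mulr0 cis0 null_mx1 realify1.
have d c B : derivable (fun t : R => realify (cis (c * t) *: B) : 'M[R]_(n.+2 + n.+2)) 0 1.
  by apply: smooth_at_derivable; exact: smooth_rcis.
have dr : derive1 real_curve 0 = (1 - ang) *: realify ('i%C *: (1%:M - null_proj)).
  rewrite derive1E rE; have dc : derivable (fun _ : R => realify null_proj) 0 1.
    exact: derivable_cst.
  rewrite (deriveD (d (1 - ang) (1%:M - null_proj)) dc) derive_rcis.
  by rewrite (derive_cst (realify null_proj)) addr0.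
have de : derive1 circle_curve 0 = ang *: realify ('i%C *: (1%:M - null_proj)) +
    realify ('i%C *: null_proj).
  rewrite derive1E circle_curveE.
  rewrite (deriveD (d ang (1%:M - null_proj)) (d 1 null_proj)).
  have e2 := derive_rcis 1 null_proj; rewrite scale1r in e2.
  exact: (congr2 +%R (derive_rcis ang (1%:M - null_proj)) e2).
apply: etrans dr _; apply: etrans (congr1 (fun X => realify ('i%C)%:M - X) (esym de)).
have -> : ('i%C)%:M = 'i%C *: (1%:M - null_proj) + 'i%C *: null_proj :> 'M[C]_n.+2.
  by rewrite -scalerDr subrK scalemx1.
move: ang ('i%C *: (1%:M - null_proj)) ('i%C *: null_proj) => b X Y.
by rewrite realifyD scalerBl scale1r opprD addrACA subrr addr0.
Qed.

End null_line.

(** * The Fefferman space *)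

Lemma fsmooth_continuous (R : realType) m (M : manifold R m) (F : normedModType R)
  (f : M -> F) x : fsmooth f x -> {for x, continuous f}.
Proof.
move=> sf; have xx := cdom_mem x.
apply: (@near_eq_continuous _ _ ((f \o cinv x) \o cmap x)).
  have := nbhs_cdom xx; apply: filterS => y xy /=; by rewrite cmapK.
apply: continuous_comp; first exact: cmap_cont.
exact: smooth_at_continuous.
Qed.

(** * Complex line bundles: nonzero vectors and scalings *)

Section line_bundle_calculus.
Variables (R : realType) (m : nat) (M : manifold R m) (L : line_bundle M).
Local Notation C := R[i].

Lemma lproj_msmooth (e : L) : msmooth (@lproj _ _ _ L) e.
Proof. by apply: (smooth_map_at openT) => //; exact: lproj_smooth. Qed.

Lemma open_lproj (U : set M) : open U -> open (@lproj _ _ _ L @^-1` U).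
Proof.
move=> oU; apply: open_comp => // e _.
by have [c _] := lproj_smooth L; exact: c.
Qed.

Lemma nonzero_lscale (e : L) z : z != 0 -> nonzero e -> nonzero (lscale z e).
Proof.
move=> z0 e0; rewrite /nonzero /= lscaleA mul0r => E; apply: e0.
have := congr1 (lscale z^-1) E; rewrite !lscaleA mulr0 mulVf // lscale1.
by [].
Qed.

Lemma open_nonzero : open (@nonzero R m M L).
Proof.
rewrite openE => e e0; rewrite /interior.
have [U [s [t [[oU Ux] ss [st1 st2] Hs Ht]]]] := ltriv L (lproj e).
have oV := open_lproj oU.
have te0 : t e != 0.
  apply/eqP => te; apply: e0; have eE := Ht e Ux.
  by rewrite te in eE; rewrite {1}eE lscaleA mul0r -eE.
have ne e' : U (lproj e') -> t e' != 0 -> nonzero e'.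
  move=> Ue' te' E; have [_ tE] := Hs _ Ue'.
  have eE := Ht e' Ue'.
  have e1 : lscale 0 e' = lscale 0 (s (lproj e')) by rewrite {1}eE lscaleA mul0r.
  by move: te'; rewrite -[X in t X]E e1 tE eqxx.
have NU : \forall e' \near e, U (lproj e') by apply: open_nbhs_nbhs.
have c1 := fsmooth_continuous (smooth_fun_at oV (Ux : (@lproj _ _ _ L @^-1` U) e) st1).
have c2 := fsmooth_continuous (smooth_fun_at oV (Ux : (@lproj _ _ _ L @^-1` U) e) st2).
have nz (x : R) : x != 0 -> \forall y \near x, y != 0.
  by move=> x0; apply: open_nbhs_nbhs; split=> //; exact: open_neq.
(* Smoothness of the fibre coordinate is given for its real and imaginary parts, so whichever is
   nonzero at e is followed. *)
have [r0|r0] := eqVneq (complex.Re (t e)) 0.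
  have i0 : complex.Im (t e) != 0.
    by apply: contra_neq te0; move: r0; case: (t e) => x y /= -> ->.
  have := c2 _ (nz _ i0); apply: filterS2 NU => e' Ue' /= te'.
  by apply: ne => //; apply: contra_neq te' => ->.
have := c1 _ (nz _ r0); apply: filterS2 NU => e' Ue' /= te'.
by apply: ne => //; apply: contra_neq te' => ->.
Qed.

(** The complex scalar is written as a pair of reals so that the orbit is a plot; [unit_point] below
    is the scalar 1. *)
Definition scaling_plot (e : L) (a : 'rV[R]_2) : L := lscale (a 0 0 +i* a 0 1) e.

Lemma psmooth_cst (E : normedModType R) k (N : manifold R k) (x : N) (t : E) :
  psmooth (fun=> x) t.
Proof. by split=> [|y _]; [exact: cst_continuous|exact: smooth_at_cst]. Qed.

Lemma lscale_at l (O : set 'rV[R]_l) z c t : open O -> O t ->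
  (forall s, O s -> [/\ psmooth c s, smooth_at (fun s => complex.Re (z s)) s
     & smooth_at (fun s => complex.Im (z s)) s]) ->
  psmooth (fun s => lscale (z s) (c s) : L) t.
Proof.
move=> oO Ot H; apply: (smooth_plot_at oO Ot); apply: lscale_smooth => //.
  by split; apply: smooth_on_at => s /H[].
by apply: smooth_plotP => s /H[].
Qed.

Lemma smooth_at_ent (i : 'I_2) (a : 'rV[R]_2) : smooth_at (fun a : 'rV[R]_2 => a 0 i) a.
Proof. by apply: (@smooth_at_coord _ _ _ (@id R)); exact: smooth_at_id. Qed.

Lemma psmooth_scaling e a : psmooth (scaling_plot e) a.
Proof.
apply: (@lscale_at _ setT) => //; first exact: openT.
by move=> s _; split; [exact: psmooth_cst|exact: smooth_at_ent|exact: smooth_at_ent].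
Qed.

Lemma lscale_msmooth z e : msmooth (fun e' : L => lscale z e') e.
Proof.
apply: (@lscale_at _ (cmap e @` cdom e) (fun=> z) (cinv e)).
- exact: cimg_open.
- by exists e => //; exact: cdom_mem.
- move=> _ [y ey <-]; split; [exact: psmooth_cinv|exact: smooth_at_cst|exact: smooth_at_cst].
Qed.

Lemma psmooth_coord k (N : manifold R k) (c : R -> N) (i : 'I_2) (a : 'rV[R]_2) :
  (forall t, psmooth c t) -> psmooth (fun a : 'rV[R]_2 => c (a 0 i)) a.
Proof.
move=> sc; split.
  apply: (@continuous_comp _ _ _ (fun t : 'rV[R]_2 => t 0 i) c).
    exact: coord_continuous.
  by have [] := sc (a 0 i).
move=> x xx; apply: (@smooth_at_coord _ _ _ (cmap x \o c) i).
by have [_] := sc (a 0 i); apply.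
Qed.

Definition unit_point : 'rV[R]_2 := delta_mx 0 0.

(** A curve with velocity v is split into its base part and its fibre coordinate, run with
    independent times. The base part has zero velocity; the fibre part is a curve of multiples of e,
    as e is nonzero. *)
Lemma vertical_scaling (e : L) v : nonzero e -> tmap (@lproj _ _ _ L) e v = 0 ->
  exists w, dplot (scaling_plot e) unit_point w = v.
Proof.
move=> e0 v0; have [U [s [t [[oU Ux] ss [st1 st2] Hs Ht]]]] := ltriv L (lproj e).
have oV := open_lproj oU.
have [c [c0 cU sc cv]] := global_curve v oV Ux.
have te0 : t e != 0.
  apply/eqP => te; apply: e0; have eE := Ht e Ux.
  by rewrite te in eE; rewrite {1}eE lscaleA mul0r -eE.
have stc1 a : smooth_at (fun a => complex.Re (t (c a))) a.
  apply: (@psmooth_fun _ _ _ _ _ _ (fun e => complex.Re (t e)) c) => //.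
  exact: (smooth_fun_at oV (cU a)).
have stc2 a : smooth_at (fun a => complex.Im (t (c a))) a.
  apply: (@psmooth_fun _ _ _ _ _ _ (fun e => complex.Im (t e)) c) => //.
  exact: (smooth_fun_at oV (cU a)).
have spc a : psmooth (@lproj _ _ _ L \o c) a.
  by apply: psmooth_map => //; exact: lproj_msmooth.
have sspc a : psmooth (s \o (@lproj _ _ _ L \o c)) a.
  by apply: psmooth_map => //; exact: (smooth_map_at oU (cU a)).
pose b (a : 'rV[R]_2) : L := lscale (t (c (a 0 1))) (s (lproj (c (a 0 0)))).
have sb a : psmooth b a.
  apply: (@lscale_at _ setT (fun a => t (c (a 0 1))) (fun a => s (lproj (c (a 0 0))))) => //.
    exact: openT.
  move=> a' _; split.
  - exact: (@psmooth_coord _ _ (s \o (@lproj _ _ _ L \o c))).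
  - exact: (@smooth_at_coord _ _ _ (fun a => complex.Re (t (c a)))).
  - exact: (@smooth_at_coord _ _ _ (fun a => complex.Im (t (c a)))).
have pb : pdiff b 0 by exact: psmooth_pdiff.
pose d0 : 'rV[R]_2 := delta_mx 0 0; pose d1 : 'rV[R]_2 := delta_mx 0 1.
have D : dplot b 0 (d0 + d1) = dplot b 0 d0 + dplot b 0 d1 by exact: dplotD.
rewrite -!dplot_line // in D.
have E01 : (fun a : R => b (a *: (d0 + d1))) = c.
  apply/funext => a; rewrite /b !mxE /= !(addr0, add0r) mulr1.
  by rewrite -Ht //; exact: cU.
have E0 : (fun a : R => b (a *: d0)) =
    (fun e' : L => lscale (t e) e') \o (s \o (@lproj _ _ _ L \o c)).
  by apply/funext => a; rewrite /b !mxE /= mulr1 mulr0 c0.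
pose rho (a : R) : 'rV[R]_2 :=
  \row_i (if i == 0 then complex.Re (t (c a) / t e) else complex.Im (t (c a) / t e)).
have rhoE a : (rho a) 0 0 +i* (rho a) 0 1 = t (c a) / t e.
  by rewrite !mxE /=; case: (t (c a) / t e).
have E1 : (fun a : R => b (a *: d1)) = scaling_plot e \o rho.
  apply/funext => a; rewrite /b /scaling_plot /= rhoE !mxE /= mulr1 mulr0 c0.
  transitivity (lscale (t (c a) / t e) (lscale (t e) (s (lproj e)))).
    by rewrite lscaleA divfK.
  by rewrite -Ht.
have D0 : dplot (fun a : R => b (a *: d0)) 0 1 = 0.
  rewrite E0.
  have [_ ->] := pdiff_map (1 : R) (psmooth_pdiff1 (sspc 0))
    (msmooth_mdiff (lscale_msmooth (t e) _)).
  have ms : mdiff s ((@lproj _ _ _ L \o c) 0) by apply/msmooth_mdiff/(smooth_map_at oU (cU 0)).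
  have [_ ->] := pdiff_map (1 : R) (psmooth_pdiff1 (spc 0)) ms.
  have [_ ->] := pdiff_map (1 : R) (psmooth_pdiff1 (sc 0)) (msmooth_mdiff (lproj_msmooth _)).
  by rewrite cv c0 v0 !tmap0.
have srho a : smooth_at rho a.
  have [p [q pqE]] : exists p q, (t e)^-1 = p +i* q.
    by case: (t e)^-1 => p q; exists p, q.
  apply/smooth_at_mxP => i j; rewrite ord1.
  have -> : (fun a => rho a 0 j) = if j == 0
      then fun a => complex.Re (t (c a)) * p + complex.Im (t (c a)) * - q
      else fun a => complex.Re (t (c a)) * q + complex.Im (t (c a)) * p.
    apply/funext => a'; rewrite mxE pqE; case tE: (t (c a')) => [x y].
    by case: ifP => _ /=; rewrite tE /=; ring.
  by case: ifP => _; apply: smooth_at_add; apply: smooth_at_mul => //; exact: smooth_at_cst.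
have rho0 : rho 0 = unit_point.
  apply/rowP => i; rewrite !mxE c0 divff //=.
  by case: i => [[|[|//]] Hi].
exists ('D_1 rho 0).
have pl : pdiff (scaling_plot e) (rho 0) by apply: psmooth_pdiff; exact: psmooth_scaling.
have [_ Er] := pdiff_reparam (1 : R) pl (smooth_at_differentiable1 (srho 0)).
by move: D; rewrite D0 add0r E01 E1 cv Er rho0 => ->.
Qed.

End line_bundle_calculus.

Arguments unit_point {R}.

Section same_fibre.
Variables (R : realType) (k : nat) (P : set 'M[R]_k) (hP : mxgroup P).
Variables (dT dM : nat) (T : manifold R dT) (M : manifold R dM).
Variable B : principal_bundle P T M.

Lemma same_fibre u u' : pproj B u = pproj B u' ->
  exists2 a, P a & u' = pact B u a.
Proof.
move=> uu'; have [U [s [g [[oU Ux] ss sg Hs Hu]]]] := ptriv B (pproj B u).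
have [Pg uE] := Hu u Ux.
have [Pg' uE'] : P (g u') /\ u' = pact B (s (pproj B u')) (g u').
  by apply: Hu; rewrite -uu'.
have PV := mxgroupV hP Pg; have PM := mxgroupM hP PV Pg'.
exists (invmx (g u) *m g u') => //.
have -> : pact B u (invmx (g u) *m g u') = pact B (s (pproj B u)) (g u').
  rewrite {1}uE pactM // mulmxA mulmxV ?mul1mx //; exact: mxgroupU Pg.
by rewrite uu'.
Qed.

Lemma fibre_nonempty x : exists u, pproj B u = x.
Proof.
have [U [s [g [[oU Ux] _ _ Hs _]]]] := ptriv B x.
by exists (s x); have [] := Hs x Ux.
Qed.

End same_fibre.

(** * The space of real lines as a quotient of nonzero vectors *)

Section real_lines_calculus.
Variables (R : realType) (n : nat) (M : manifold R n.*2.+1) (L : line_bundle M).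
Variables (Mt : manifold R n.*2.+2) (F : real_lines L Mt).
Local Notation C := R[i].

Lemma fq_msmooth (e : L) : nonzero e -> msmooth (fq F) e.
Proof. by move=> e0; apply: (smooth_map_at (open_nonzero L) e0); exact: fq_smooth. Qed.

Lemma fq_scale (e : L) (t : R) : t != 0 -> nonzero e -> fq F (lscale t%:C e) = fq F e.
Proof.
move=> t0 e0; apply/esym/fq_eq => //; last by exists t.
by apply: nonzero_lscale => //; rewrite fmorph_eq0.
Qed.

(* [fproj] inherits differentiability from [lproj] through a local right
   inverse of the submersion [fq]. *)
Lemma fproj_mdiff y : mdiff (fproj F) y.
Proof.
have [e e0 <-] := fq_surj F y.
have ee := cdom_mem e; have fe := cdom_mem (fq F e).
have [fc fs] := fq_msmooth e0.
pose f := cmap (fq F e) \o fq F \o cinv e.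
have sf : smooth_at f (cmap e e) by apply: fs; rewrite /= cinvxx.
have [g [gE dg gK]] := right_inverse_differentiable sf (fq_submersion F e0).
have fE : f (cmap e e) = cmap (fq F e) (fq F e) by rewrite /f /= cinvxx.
have cg : {for f (cmap e e), continuous g} by exact: differentiable_continuous.
have Ng : \forall z \near f (cmap e e), nonzero (cinv e (g z)) /\
    cdom (fq F e) (fq F (cinv e (g z))).
  have N1 : \forall t \near cmap e e, nonzero (cinv e t).
    apply: (near_cinv (P := @nonzero R _ M L)); apply: open_nbhs_nbhs; split=> //.
    exact: open_nonzero.
  have N2 : \forall t \near cmap e e, cdom (fq F e) (fq F (cinv e t)).
    have fc' : (fq F \o cinv e) @ cmap e e --> fq F e.
      have fcE : (fq F \o cinv e) (cmap e e) = fq F e by rewrite /= cinvxx.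
      by rewrite -[X in _ --> X]fcE; exact: fc.
    exact: (fc' _ (nbhs_cdom fe)).
  have N : \forall t \near cmap e e, nonzero (cinv e t) /\ cdom (fq F e) (fq F (cinv e t)).
    by apply: filterS2 N1 N2.
  rewrite -gE in N; exact: (cg _ N).
have NE : \forall z \near cmap (fq F e) (fq F e),
    (@lproj _ _ _ L \o cinv e \o g) z = (fproj F \o cinv (fq F e)) z.
  rewrite -fE; apply: filterS2 gK Ng => z fz [nz cz] /=.
  by rewrite -(fproj_fq F nz) -{2}fz /f /= cmapK.
have pl : pdiff (@lproj _ _ _ L \o cinv e) (g (f (cmap e e))).
  by rewrite gE; exact: msmooth_mdiff (lproj_msmooth e).
have [pg _] := pdiff_reparam 0 pl dg.
rewrite fE in pg; exact: (pdiff_near NE pg).1.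
Qed.

(** Real multiples of e span the same real line, so [fq] is constant along the real direction of
    scaling; only the imaginary component survives. *)
Lemma dplot_fq_scaling (e : L) w : nonzero e ->
  dplot (fq F \o scaling_plot e) unit_point w =
  w 0 1 *: dplot (fq F \o scaling_plot e) unit_point (delta_mx 0 1).
Proof.
move=> e0.
have ce : scaling_plot e unit_point = e by rewrite /scaling_plot !mxE /= lscale1.
have pf : pdiff (fq F \o scaling_plot e) unit_point.
  apply: psmooth_pdiff; apply: psmooth_map; first exact: psmooth_scaling.
  by rewrite ce; exact: fq_msmooth.
have wE : w = w 0 0 *: delta_mx 0 0 + w 0 1 *: delta_mx 0 1.
  rewrite {1}[w]row_sum_delta !big_ord_recl big_ord0 addr0.
  by congr (_ + w 0 _ *: delta_mx 0 _); exact: val_inj.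
rewrite {1}wE dplotD // !dplotZ //.
suff -> : dplot (fq F \o scaling_plot e) unit_point (delta_mx 0 0) = 0.
  by rewrite scaler0 add0r.
pose h (t : R) : 'rV[R]_2 := t *: delta_mx 0 0 + unit_point.
have sh t : smooth_at h t by exact: smooth_at_line.
have h0 : h 0 = unit_point by rewrite /h scale0r add0r.
have dh : 'D_1 h 0 = delta_mx 0 0.
  rewrite /h; have d1 : derivable (fun t : R => t *: (delta_mx 0 0 : 'rV[R]_2)) 0 1.
    apply: smooth_at_derivable; apply: smooth_at_scale; last exact: smooth_at_cst.
    exact: smooth_at_id.
  have d2 : derivable (fun=> unit_point : 'rV[R]_2) (0 : R) 1 by exact: derivable_cst.
  by rewrite (deriveD d1 d2) derive_lineE (derive_cst unit_point) addr0.
have ph : pdiff (fq F \o scaling_plot e) (h 0) by rewrite h0.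
have [pr Er] := pdiff_reparam (1 : R) ph (smooth_at_differentiable1 (sh 0)).
rewrite -dh -h0 -Er.
have N : \forall t \near (0 : R), ((fq F \o scaling_plot e) \o h) t = fq F e.
  have : \forall t \near (0 : R), t + 1 != 0.
    have c : (fun t : R => t + 1) @ (0 : R) --> (1 : R).
      rewrite -[X in _ --> X]add0r; apply: cvgD; [exact: cvg_id|exact: cvg_cst].
    apply: (c [set x | x != 0]); apply: open_nbhs_nbhs; split; first exact: open_neq.
    exact: oner_neq0.
  apply: filterS => t t1; rewrite /= /scaling_plot /h !mxE /= !mulr1 !mulr0 addr0.
  exact: fq_scale.
have [_ <-] := pdiff_near N pr.
by have [_ ->] := dplot_cst (fq F e) (0 : R) (1 : R).
Qed.

End real_lines_calculus.

(** * Comparison of the two geometries along j *)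

Section fefferman.
Variables (R : realType) (p q n r : nat).
Hypothesis n_gt0 : (0 < n)%N.
Variables (h : 'M[R[i]]_n.+2) (v0 : 'cV[R[i]]_n.+2).
Hypotheses (hs : herm_signature h r) (v0_neq0 : v0 != 0).
Hypothesis v0_null : herm h v0 v0 = 0.
Variable w : 'cV[R[i]]_n.+2.
Hypotheses (w_null : herm h w w = 0) (wv : herm h w v0 = 1).
Variables (M : manifold R n.*2.+1) (S : cr_structure M p q).
Variables (E1 Em1 : line_bundle M).
Variables (ev : line_duality Em1 E1) (D : canonical_duality S E1).
Variables (dG : nat) (GG : manifold R dG).
Variable C : cartan_geometry (SUgroup h) (Pgroup h v0) GG M.
Variables (beta : GG -> Em1) (C_beta : tautological_iso ev D C beta).
Variables (Mt : manifold R n.*2.+2) (F : real_lines Em1 Mt).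
Variables (dGt : nat) (GGt : manifold R dGt).
Variable Ct : cartan_geometry (SO0group h) (Ptgroup h v0) GGt Mt.
Variables (j : GG -> GGt) (Ct_ext : fefferman_extension C F Ct beta j).
Variables (d : nat) (W : representation (SO0group h) d).

Local Notation E := (circle_curve h v0 w).

Let hP := P_mxgroup hs v0_neq0.
Let hPt := Pt_mxgroup hs v0_neq0.
Let hSO := SO0_mxgroup hs.

Lemma P_SO0 : Pgroup h v0 `<=` SO0group h.
Proof. by move=> a [Ga _]; exact: (SU_SO0 hs Ga). Qed.

Lemma Pt_SO0 : Ptgroup h v0 `<=` SO0group h.
Proof. by move=> a []. Qed.

Lemma lie_SU_SO0 : lie_alg (SUgroup h) `<=` lie_alg (SO0group h).
Proof.
move=> X [a [sa Ga a0] aX]; exists a => //; split=> // t; exact: (SU_SO0 hs (Ga t)).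
Qed.

Lemma circle_P : smooth_curve (Pgroup h v0) E.
Proof. exact: (smooth_circle_curve n_gt0 hs v0_null w_null wv). Qed.

Lemma beta_msmooth u : msmooth beta u.
Proof. by apply: (smooth_map_at openT) => //; exact: (beta_smooth C_beta). Qed.

Lemma j_msmooth u : msmooth j u.
Proof. by apply: (smooth_map_at openT) => //; exact: (j_smooth Ct_ext). Qed.

Lemma fq_beta_msmooth u : msmooth (fq F \o beta) u.
Proof.
by apply: msmooth_comp; [exact: beta_msmooth|exact/fq_msmooth/(beta_nonzero C_beta)].
Qed.

Lemma fproj_beta u : fproj F (fq F (beta u)) = pproj C u.
Proof. by rewrite fproj_fq ?(beta_proj C_beta) //; exact: (beta_nonzero C_beta). Qed.

Lemma beta_circle u t : beta (pact C u (E t)) = lscale (cis t) (beta u).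
Proof.
have [_ PE _] := circle_P.
by apply: (beta_equivariant C_beta) => //; exact: (circle_curve_v0 hs v0_null wv).
Qed.

Definition circle_velocity u : 'rV[R]_dG := velocity (fun t => pact C u (E t)) 0.

Lemma tmap_beta_circle u : tmap beta u (circle_velocity u) =
  dplot (scaling_plot (beta u)) unit_point (delta_mx 0 1).
Proof.
have [_ PE E0] := circle_P.
have pc : pdiff (fun t => pact C u (E t)) 0 by exact/psmooth_pdiff1/(pact_curve C u 0 circle_P).
have c0 : (fun t => pact C u (E t)) 0 = u by rewrite E0 pact1.
have mb : mdiff beta ((fun t => pact C u (E t)) 0) by exact/msmooth_mdiff/beta_msmooth.
have [_ H] := pdiff_map (1 : R) pc mb.
rewrite /circle_velocity velocityE -{1}c0 -H.
pose rho (t : R) : 'rV[R]_2 := cos t *: delta_mx 0 0 + sin t *: delta_mx 0 1.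
have -> : beta \o (fun t => pact C u (E t)) = scaling_plot (beta u) \o rho.
  apply/funext => t /=; rewrite beta_circle /scaling_plot /rho !mxE /=.
  by rewrite !mulr1 !mulr0 addr0 add0r.
have s1 t : smooth_at (fun t : R => cos t *: (delta_mx 0 0 : 'rV[R]_2)) t.
  by apply: smooth_at_scale; [exact: smooth_at_cos|exact: smooth_at_cst].
have s2 t : smooth_at (fun t : R => sin t *: (delta_mx 0 1 : 'rV[R]_2)) t.
  by apply: smooth_at_scale; [exact: smooth_at_sin|exact: smooth_at_cst].
have srho : smooth_at rho 0 by exact: smooth_at_add.
have rho0 : rho 0 = unit_point by rewrite /rho cos0 sin0 scale1r scale0r addr0.
have drho : 'D_1 rho 0 = delta_mx 0 1.
  rewrite /rho (deriveD (smooth_at_derivable (s1 0)) (smooth_at_derivable (s2 0))).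
  have k1 : derivable (fun=> delta_mx 0 0 : 'rV[R]_2) (0 : R) 1 by exact: derivable_cst.
  have k2 : derivable (fun=> delta_mx 0 1 : 'rV[R]_2) (0 : R) 1 by exact: derivable_cst.
  have [dc dcE] := derive_cosE 1 (0 : R); have [ds dsE] := derive_sinE 1 (0 : R).
  have [_ ->] := is_derive_scale dc k1; have [_ ->] := is_derive_scale ds k2.
  rewrite dcE dsE (derive_cst (delta_mx 0 0 : 'rV[R]_2)) (derive_cst (delta_mx 0 1 : 'rV[R]_2)).
  by rewrite sin0 cos0 mulr0 mulr1 scale0r !scaler0 !add0r addr0 scale1r.
have pl : pdiff (scaling_plot (beta u)) (rho 0) by exact/psmooth_pdiff/psmooth_scaling.
have [_ ->] := pdiff_reparam (1 : R) pl (smooth_at_differentiable1 srho).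
by rewrite drho rho0.
Qed.

(** Lift x to y on E(-1,0), and the projection of y on M to v on GG. The error y - d beta(v) is
    vertical, hence an infinitesimal scaling: [fq] kills its real part, and a multiple of the circle
    velocity supplies its imaginary part. *)
Lemma fq_beta_submersion u x : exists v, tmap (fq F \o beta) u v = x.
Proof.
have b0 : nonzero (beta u) by exact: (beta_nonzero C_beta).
have mb : mdiff beta u by exact/msmooth_mdiff/beta_msmooth.
have mf : mdiff (fq F) (beta u) by exact/msmooth_mdiff/fq_msmooth.
have mlp : mdiff (@lproj _ _ _ Em1) (beta u) by exact/msmooth_mdiff/lproj_msmooth.
have [y yE] := fq_submersion F b0 x.
have [v vE] := lift_exists C u (tmap (@lproj _ _ _ Em1) (beta u) y).
have bp : @lproj _ _ _ Em1 \o beta = pproj C.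
  by apply/funext => u' /=; exact: (beta_proj C_beta).
have bv : tmap (@lproj _ _ _ Em1) (beta u) (tmap beta u v) = tmap (pproj C) u v.
  by have [_ <-] := tmap_comp v mb mlp; rewrite bp.
have [z zE] : exists z, dplot (scaling_plot (beta u)) unit_point z =
    y + (-1) *: tmap beta u v.
  apply: vertical_scaling => //.
  by rewrite tmapD // tmapZ // bv vE scaleN1r subrr.
have scb : scaling_plot (beta u) unit_point = beta u.
  by rewrite /scaling_plot !mxE /= lscale1.
have fqs z' : dplot (fq F \o scaling_plot (beta u)) unit_point z' =
    tmap (fq F) (beta u) (dplot (scaling_plot (beta u)) unit_point z').
  have ps : pdiff (scaling_plot (beta u)) unit_point by exact/psmooth_pdiff/psmooth_scaling.
  have mf' : mdiff (fq F) (scaling_plot (beta u) unit_point) by rewrite scb.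
  by have [_ ->] := pdiff_map z' ps mf'; rewrite scb.
exists (v + z 0 1 *: circle_velocity u).
have [_ ->] := tmap_comp (v + z 0 1 *: circle_velocity u) mb mf.
rewrite tmapD // tmapZ // tmap_beta_circle tmapD // tmapZ // -fqs -dplot_fq_scaling //.
by rewrite fqs zE tmapD // tmapZ // yE scaleN1r addrCA subrr addr0.
Qed.

Lemma tmap_pproj_j u v :
  tmap (pproj Ct) (j u) (tmap j u v) = tmap (fq F \o beta) u v.
Proof.
have mj : mdiff j u by exact/msmooth_mdiff/j_msmooth.
have mp : mdiff (pproj Ct) (j u) by exact/msmooth_mdiff/pproj_msmooth.
have [_ <-] := tmap_comp v mj mp.
by congr (tmap _ u v); apply/funext => u' /=; exact: (j_proj Ct_ext).
Qed.

Lemma tderiv_j phi u v : fsmooth phi (j u) ->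
  tderiv Ct W phi (j u) (tmap j u v) = tderiv C W (phi \o j) u v.
Proof.
move=> sphi; rewrite /tderiv (j_om Ct_ext) /=; congr (_ + _).
have mj : mdiff j u by exact/msmooth_mdiff/j_msmooth.
by have [_ ->] := dfun_comp v mj (fsmooth_fdiff sphi).
Qed.

Lemma tractor_conn_j phi xi xit u :
  tractor_section Ct W phi -> tractor_section C W (phi \o j) ->
  (forall y, tmap (fproj F) y (xit y) = xi (fproj F y)) ->
  tractor_conn Ct W xit phi (j u) = tractor_conn C W xi (phi \o j) u.
Proof.
move=> Hphi Hphij xiE.
have [v vE] := fq_beta_submersion u (xit (fq F (beta u))).
rewrite (tractor_connE hPt hSO Pt_SO0 (fun _ => id) (v := tmap j u v)) //; last first.
  by rewrite tmap_pproj_j vE (j_proj Ct_ext).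
rewrite (tractor_connE hP hSO P_SO0 lie_SU_SO0 (v := v)) //; last first.
  have mfb : mdiff (fq F \o beta) u by exact/msmooth_mdiff/fq_beta_msmooth.
  have mfp : mdiff (fproj F) ((fq F \o beta) u) by exact: fproj_mdiff.
  have [_ H] := tmap_comp v mfb mfp.
  have fE : fproj F \o (fq F \o beta) = pproj C by apply/funext => u' /=; exact: fproj_beta.
  by rewrite fE in H; rewrite H vE /= xiE fproj_beta.
by apply: tderiv_j; exact: (section_smooth _ Hphi).
Qed.

Section generator.
Variables (JJ : GGt -> 'M[R]_(n.+2 + n.+2)) (JJ_section : adjoint_section Ct JJ).
Hypothesis JJ_i : forall u, JJ (j u) = realify ('i%C)%:M.
Variables (k : Mt -> 'rV[R]_n.*2.+2) (k_JJ : is_adjoint_proj Ct JJ k).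

(** The vector on which [om Ct] takes the value i splits as the image of the circle velocity plus
    the fundamental vector of i - E'(0), which is vertical over the Fefferman space. *)
Lemma k_circle u : tmap (pproj Ct) (j u) (tmap j u (circle_velocity u)) = k (pproj Ct (j u)).
Proof.
rewrite k_JJ; set o := om_inv _ _ _.
have oE : om Ct (j u) o = realify ('i%C)%:M.
  rewrite -(JJ_i u); apply: (@xgetPex _ 0 [set v | om Ct (j u) v = JJ (j u)]).
  have [_ lJ _] := JJ_section; exact: (om_surj Ct (j u) (lJ (j u))).
have [a Ha aE] := circle_curve_complement hs v0_null w_null wv.
pose nu : 'rV[R]_dGt := velocity (fun t => pact Ct (j u) (a t)) 0.
have mp : mdiff (pproj Ct) (j u) by exact/msmooth_mdiff/pproj_msmooth.
have -> : o = tmap j u (circle_velocity u) + nu.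
  apply: (@om_inj _ _ _ _ _ _ _ _ Ct (j u)).
  rewrite omD oE (j_om Ct_ext) !om_fundamental //; last exact: circle_P.
  by rewrite aE addrC subrK.
rewrite tmapD //.
suff -> : tmap (pproj Ct) (j u) nu = 0 by rewrite addr0.
have [_ Pa a0] := Ha.
have c0 : (fun t => pact Ct (j u) (a t)) 0 = j u by rewrite a0 pact1.
have pc : pdiff (fun t => pact Ct (j u) (a t)) 0 by exact/psmooth_pdiff1/pact_curve.
have mp' : mdiff (pproj Ct) ((fun t => pact Ct (j u) (a t)) 0) by rewrite c0.
have [_ H] := pdiff_map (1 : R) pc mp'.
rewrite /nu velocityE -{1}c0 -H.
have -> : pproj Ct \o (fun t => pact Ct (j u) (a t)) = fun=> pproj Ct (j u).
  by apply/funext => t /=; exact: pproj_act.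
by have [_ ->] := dplot_cst (pproj Ct (j u)) (0 : R) (1 : R).
Qed.

Lemma tractor_conn_k phi u : tractor_section Ct W phi ->
  tractor_conn Ct W k phi (j u) = tderiv C W (phi \o j) u (circle_velocity u).
Proof.
move=> Hphi.
rewrite (tractor_connE hPt hSO Pt_SO0 (fun _ => id) (v := tmap j u (circle_velocity u))) //.
  by apply: tderiv_j; exact: (section_smooth _ Hphi).
exact: k_circle.
Qed.

(** A generator of the real line under [ut] is z times some beta(u0). The phase of z is absorbed by
    moving u0 along the circle, its modulus by passing to the real line, and the rest is the fibre
    action. Equivariant identities thus need checking on the image of j only. *)
Lemma j_orbit ut : exists u b, Ptgroup h v0 b /\ ut = pact Ct (j u) b.
Proof.
have [e e0 eE] := fq_surj F (pproj Ct ut).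
have [u0 u0E] := fibre_nonempty C (lproj e).
have [U [s [t [[oU Ux] _ _ Hs Ht]]]] := ltriv Em1 (lproj e).
have b0 : nonzero (beta u0) by exact: (beta_nonzero C_beta).
have bE : lproj (beta u0) = lproj e by rewrite (beta_proj C_beta).
have eT := Ht e Ux.
have bT : beta u0 = lscale (t (beta u0)) (s (lproj e)).
  by rewrite -bE; apply: Ht; rewrite bE.
have nz (e' : Em1) : nonzero e' -> e' = lscale (t e') (s (lproj e)) -> t e' != 0.
  move=> e'0 e'E; apply/eqP => te; apply: e'0; rewrite te in e'E.
  by rewrite {1}e'E lscaleA mul0r -e'E.
have te0 := nz _ e0 eT; have tb0 := nz _ b0 bT.
have [rr [th [rr0 zE]]] := polar (mulf_neq0 te0 (invr_neq0 tb0)).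
have ebeta : e = lscale (rr%:C) (beta (pact C u0 (E th))).
  rewrite beta_circle lscaleA -zE bT lscaleA.
  by rewrite -bT divfK.
exists (pact C u0 (E th)).
have [|b Pb bE'] := @same_fibre _ _ _ hPt _ _ _ _ Ct (j (pact C u0 (E th))) ut.
  rewrite (j_proj Ct_ext) -eE ebeta; apply/esym/fq_scale.
    by rewrite gt_eqF.
  exact: (beta_nonzero C_beta).
by exists b.
Qed.

Lemma section_parallel phi : tractor_section Ct W phi ->
  tractor_section C W (phi \o j) -> forall u, tractor_conn Ct W k phi u = 0.
Proof.
move=> Hphi Hphij ut; have [u [b [Pb ->]]] := j_orbit ut.
rewrite (tractor_conn_equivariant hPt hSO Pt_SO0 (fun _ => id)) //.
rewrite tractor_conn_k // (tderiv_fundamental hSO P_SO0) ?mulmx0 //.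
exact: circle_P.
Qed.

(** The one-parameter property turns the derivative at time s into W(E s) applied to the derivative
    at time 0 from the point u E(s), which vanishes because phi is parallel along k. *)
Lemma parallel_transport phi u t : tractor_section Ct W phi ->
  (forall u, tractor_conn Ct W k phi u = 0) ->
  W (E t) *m phi (j (pact C u (E t))) = phi (j u).
Proof.
move=> Hphi par; have [_ PE E0] := circle_P.
pose G (s : R) := W (E s) *m phi (j (pact C u (E s))).
have G0 : G 0 = phi (j u) by rewrite /G E0 rho1 mul1mx pact1.
have ED s s' : E (s + s') = E s *m E s'.
  exact: (circle_curveD hs v0_null w_null wv).
have dG0 s : derivable G s 1 /\ 'D_1 G s = 0.
  pose us := pact C u (E s).
  pose H (x : R) := W (E x) *m (phi \o j) (pact C us (E x)).
  have sphi : fsmooth (phi \o j) us.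
    by apply: fsmooth_comp; [exact: j_msmooth|exact: (section_smooth _ Hphi)].
  have [dH DH] := derive_transport P_SO0 C W sphi circle_P.
  have DH0 : 'D_1 H 0 = 0.
    by rewrite [LHS]DH -[RHS](par (j us)) tractor_conn_k.
  have GH : G = fun x : R => W (E s) *m H (x *: 1 + - s).
    apply/funext => x; rewrite /G /H /us /= mulmxA -rhoM; [|exact/P_SO0|exact/P_SO0].
    by rewrite pactM // -ED [x *: 1]mulr1 addrC subrK.
  have dHs : derivable (fun x : R => H (x *: 1 + - s)) s 1.
    by apply: derivable_line; rewrite [s *: 1]mulr1 subrr.
  split; last first.
    by rewrite GH derive_mulmxl // (derive_line H) [s *: 1]mulr1 subrr DH0 mulmx0.
  rewrite GH; have cW : derivable (fun=> W (E s)) s 1 by exact: derivable_cst.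
  by have [] := derivable_mulmx cW dHs.
rewrite -/(G t) -G0; apply/colP => i.
apply: (@is_derive_0_is_cst R (fun x => G x i 0)) => x.
have [dGx DGx] := dG0 x; have dGxi := (derivable_mxP G x 1).1 dGx i 0.
split=> //; have := congr1 (fun A : 'cV[R]_d => A i 0) (derive_mx dGx).
by rewrite DGx !mxE => <-.
Qed.

Lemma parallel_section phi : tractor_section Ct W phi ->
  (forall u, tractor_conn Ct W k phi u = 0) -> tractor_section C W (phi \o j).
Proof.
move=> Hphi par; have [_ ephi] := Hphi; have [_ PE E0] := circle_P; split.
  apply: smooth_funP => u _; apply: fsmooth_comp; first exact: j_msmooth.
  exact: (section_smooth _ Hphi).
move=> u a Pa; have [Ga [z zE]] := Pa.
have z0 := P_eigen hs v0_neq0 Pa zE.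
have [rr [th [rr0 zr]]] := polar z0.
have ED s s' : E (s + s') = E s *m E s' by exact: (circle_curveD hs v0_null w_null wv).
have EN : E th *m E (- th) = 1%:M by rewrite -ED subrr.
have hSU := SU_mxgroup hs.
have EG s : SUgroup h (E s) by have [] := PE s.
(* Removing the phase of the eigenvalue z of a on v0 leaves the positive real [rr], so b lies in P
   and in P~. Equivariance under b comes from phi and j, under [E th] from parallel transport. *)
pose b := E (- th) *m a.
have Gb : SUgroup h b by exact: (mxgroupM hSU).
have Ev s : cvec (E s *m rvec v0) = cis s *: v0 by exact: (circle_curve_v0 hs v0_null wv).
have bv : cvec (b *m rvec v0) = rr%:C *: v0.
  have av : a *m rvec v0 = rvec (z *: v0) by rewrite -zE cvecK.
  rewrite /b -mulmxA av /circle_curve cvec_realify rvecK -scalemxAr (null_mx_v0 hs v0_null wv).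
  by rewrite scalerA zr -mulrA -cisD subrr cis0 mulr1.
have Pb : Ptgroup h v0 b := Pt_of_real hs Gb bv.
have aE : a = E th *m b by rewrite /b mulmxA EN mul1mx.
have Pb' : Pgroup h v0 b by split=> //; exists rr%:C.
have S0E := P_SO0 (PE th); have S0b := P_SO0 Pb'.
have VE := mxgroupV hSO S0E; have Vb := mxgroupV hSO S0b.
rewrite /= {1}aE -pactM // (j_equivariant Ct_ext) // ephi //.
rewrite -(parallel_transport u th Hphi par) !mulmxA.
have -> : W (invmx a) *m W (E th) = W (invmx b).
  rewrite -rhoM //; last exact: (mxgroupV hSO (P_SO0 Pa)).
  congr (W _); apply: (can_inj (mulKmx (mxgroupU hSU Ga))).
  rewrite mulmxA mulmxV ?mul1mx ?(mxgroupU hSU Ga) // aE -mulmxA mulmxV ?mulmx1 //.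
  exact: (mxgroupU hSU Gb).
by [].
Qed.

End generator.
End fefferman.

Theorem proposition3p2 (R : realType) (p q n : nat)
  (n_gt0 : (0 < n)%N)
  (* the Hermitian space V, the null line V^1 and the real line V^1_R *)
  (h : 'M[R[i]]_n.+2) (v0 : 'cV[R[i]]_n.+2)
  (h_signature : herm_signature h p.+1)
  (v0_neq0 : v0 != 0) (v0_null : herm h v0 v0 = 0)
  (* the CR manifold M with E(1,0), E(-1,0) *)
  (M : manifold R n.*2.+1) (S : cr_structure M p q)
  (E1 Em1 : line_bundle M)
  (ev : line_duality Em1 E1) (D : canonical_duality S E1)
  (* its Cartan geometry *)
  (dG : nat) (GG : manifold R dG)
  (C : cartan_geometry (SUgroup h) (Pgroup h v0) GG M)
  (C_regular : regular_cartan C) (C_normal : normal_cartan C)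
  (C_induces : induces_cr S C)
  (beta : GG -> Em1) (C_beta : tautological_iso ev D C beta)
  (* the Fefferman space with its extended Cartan geometry *)
  (Mt : manifold R n.*2.+2) (F : real_lines Em1 Mt)
  (dGt : nat) (GGt : manifold R dGt)
  (Ct : cartan_geometry (SO0group h) (Ptgroup h v0) GGt Mt)
  (j : GG -> GGt) (Ct_ext : fefferman_extension C F Ct beta j)
  (* the representation W, the adjoint tractor J and the vector field k *)
  (d : nat) (W : representation (SO0group h) d)
  (JJ : GGt -> 'M[R]_(n.+2 + n.+2)) (JJ_section : adjoint_section Ct JJ)
  (JJ_i : forall u, JJ (j u) = realify ('i%C)%:M)
  (k : Mt -> 'rV[R]_n.*2.+2) (k_JJ : is_adjoint_proj Ct JJ k) :
  (forall phi, tractor_section Ct W phi ->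
     (tractor_section C W (phi \o j) <->
      forall u, tractor_conn Ct W k phi u = 0)) /\
  (exists nabla : (M -> 'rV[R]_n.*2.+1) ->
                  (GG -> 'cV[R]_d) -> GG -> 'cV[R]_d,
     [/\ linear_connection C W nabla,
         forall phi xi xit,
           tractor_section Ct W phi -> tractor_section C W (phi \o j) ->
           smooth_vf setT xi -> smooth_vf setT xit ->
           (forall y, tmap (fproj F) y (xit y) = xi (fproj F y)) ->
           tractor_section C W (tractor_conn Ct W xit phi \o j) /\
           tractor_conn Ct W xit phi \o j = nabla xi (phi \o j) &
         forall phi xi, tractor_section C W phi -> smooth_vf setT xi ->
           nabla xi phi = tractor_conn C W xi phi]).
Proof.
have [w [w_null wv]] := null_dual h_signature v0_neq0 v0_null.
have hP := P_mxgroup h_signature v0_neq0.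
have hSO := SO0_mxgroup h_signature.
have PSO := P_SO0 (v0 := v0) h_signature.
have lieSO := lie_SU_SO0 h_signature.
split=> [phi Hphi|].
  split=> [Hphij|par].
    exact: (section_parallel n_gt0 h_signature v0_neq0 v0_null w_null wv C_beta
      Ct_ext JJ_section JJ_i k_JJ Hphi Hphij).
  exact: (parallel_section n_gt0 h_signature v0_neq0 v0_null w_null wv
    Ct_ext JJ_section JJ_i k_JJ Hphi par).
exists (tractor_conn C W); split=> // [|phi xi xit Hphi Hphij sxi sxit xiE].
  exact: (tractor_conn_linear hP hSO PSO lieSO).
have -> : tractor_conn Ct W xit phi \o j = tractor_conn C W xi (phi \o j).
  apply/funext => u.
  exact: (tractor_conn_j n_gt0 h_signature v0_neq0 v0_null w_null wv C_beta
    Ct_ext u Hphi Hphij xiE).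
by split=> //; exact: (tractor_section_conn hP hSO PSO lieSO Hphij sxi).
Qed.
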